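(* Let $n>1$ and $m$ be integers with $2\le m\le n-1$, and suppose $\det V(x_0,\dots,x_{m-1})\ne0$ for all pairwise distinct integers $x_0,\dots,x_{m-1}\in[0,n-1]$. Let $p$ be a prime with $p>\max\{M_n(m),\,2n^3-n^2-n+1\}$, $q=p^a$, $t\in\mathbb{F}_q^*$, and write $\det(I-AT)=1+b_1T+\dots+b_{2n+1}T^{2n+1}$. Then $$\mathrm{ord}_pb_m=\frac{m(m-1)}{2n}+\frac{2n+1}{n(p-1)}\sum_{i=0}^{m-1}\alpha_{i,\delta(i)}$$ for any $\delta\in S_m^0$.
   Context: $V(x_0,\dots,x_{m-1})$ is the $m\times m$ matrix with entry $\prod_{r=0}^{c-1}(x_k-r)^2$ in row $k$, column $c$; $M_n(m)=\max|\det V(x_0,\dots,x_{m-1})|$ over pairwise distinct integers $x_k\in[0,n-1]$. $\alpha_{i,j}=i-pj+n\lceil\frac{pj-i}n\rceil$; $S_m$ permutations of $\{0,\dots,m-1\}$; $S_m^0$ the set of $\delta\in S_m$ minimizing $\sum_{i=0}^{m-1}\alpha_{i,\delta(i)}$. Matrix $A$: $\mathrm{ord}_p(p)=1$; $\mathbb{Z}_q$ ring of integers of the unramified degree-$a$ extension $\mathbb{Q}_q$ of $\mathbb{Q}_p$, with Frobenius $\sigma$ extended to $\mathbb{Q}_q(\zeta_p,\widetilde\gamma)$ fixing $\zeta_p,\widetilde\gamma$. $\gamma\in\mathbb{C}_p$ a root of $\sum_{k\ge0}x^{p^k}/p^k$ with $\mathrm{ord}_p\gamma=\frac1{p-1}$,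 $\widetilde\gamma^n=\gamma$, $\Theta(x)=\exp(\sum_{k\ge0}(\gamma x)^{p^k}/p^k)$, $\bar t$ the Teichmüller lift of $t$, $F_t=\Theta(x^n)\Theta(y)\Theta(\bar t/(xy))$. $\omega(a,b)=\frac an+b+\frac{2n+1}n\max\{0,-a,-b\}$. $\mathcal{C}_0$: series $\sum\xi(a,b)\widetilde\gamma^{n\omega(a,b)}x^ay^b$, $\xi(a,b)\in\mathbb{Z}_q[\widetilde\gamma]$, $|\xi(a,b)|_p\to0$ as $\omega\to\infty$. $\alpha_1=\sigma^{-1}\circ\psi_p\circ F_t$ with $\psi_p(\sum c_{a,b}x^ay^b)=\sum c_{pa,pb}x^ay^b$. With $\gamma_i=\sum_{k=0}^i\gamma^{p^k}/p^k$: $D_x=x\partial_x+\sum_{i\ge0}\gamma_ip^i(nx^{np^i}-\sigma^i(\bar t)x^{-p^i}y^{-p^i})$, $D_y=y\partial_y+\sum_{i\ge0}\gamma_ip^i(y^{p^i}-\sigma^i(\bar t)x^{-p^i}y^{-p^i})$. $\varepsilon_i=x^i$ ($0\le i\le n$), $x^{i-n}y$ ($n+1\le i\le2n$), $\widetilde\varepsilon_i=\widetilde\gamma^i\varepsilon_i$; $\mathcal{C}_0=\bigoplus_i\mathbb{Z}_q[\widetilde\gamma]\widetilde\varepsilon_i\oplus(D_x\mathcal{C}_0+D_y\mathcal{C}_0)$; $\widetilde A(\widetilde\varepsilon_j,\widetilde\varepsilon_i)$ defined by $\alpha_1(\widetilde\varepsilon_i)\equiv\sum_j\widetilde A(\widetilde\varepsilon_j,\widetilde\varepsilon_i)\widetilde\varepsilon_j\pmod{D_x\mathcal{C}_0+D_y\mathcal{C}_0}$;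 $A=(A_{ij})_{0\le i,j\le 2n}$, $A_{ij}=\widetilde A(\widetilde\varepsilon_j,\widetilde\varepsilon_i)$. *)

(* Defs.v *)
From HB Require Import structures.
From mathcomp Require Import all_boot all_order all_algebra all_fingroup.
From mathcomp Require Import finmap.
From mathcomp Require Import boolp classical_sets functions constructive_ereal.

Set Implicit Arguments.
Unset Strict Implicit.
Unset Printing Implicit Defensive.

Import Order.TTheory GRing.Theory Num.Theory.

Local Open Scope classical_set_scope.
Local Open Scope ring_scope.

Definition Vmx (m : nat) (x : 'I_m -> int) : 'M[int]_m :=
  \matrix_(k < m, c < m) \prod_(r < c) (x k - r%:Z) ^+ 2.

Definition maxdetV (n m : nat) : nat :=
  \max_(x : {ffun 'I_m -> 'I_n} | injectiveb x)
    `|\det (Vmx (fun k => (x k)%:Z))|%N.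

Definition alpha (n p : nat) (i j : nat) : int :=
  i%:Z - p%:Z * j%:Z
  + n%:Z * Num.ceil ((p%:Q * j%:Q - i%:Q) / n%:Q : rat).

Definition alpha_sum (n p m : nat) (d : 'S_m) : int :=
  \sum_(i < m) alpha n p i (d i).

Definition minperms (n p m : nat) : {set 'S_m} :=
  [set d : 'S_m | [forall e : 'S_m, alpha_sum n p d <= alpha_sum n p e]].

Section ValuedField.
Context (K : closedFieldType) (ord : K -> \bar rat).

(* The closure of the prime field; in a model of C_p this is Q_p. *)
Definition Qp_set : set K :=
  [set x | forall M : rat, exists r : rat, (M%:E <= ord (x - ratr r))%E].

Definition ord_cauchy (u : nat -> K) : Prop :=
  forall M : rat, exists N : nat, forall i j : nat,
    (N <= i)%N -> (N <= j)%N -> (M%:E <= ord (u i - u j))%E.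

Definition ord_lim (u : nat -> K) (l : K) : Prop :=
  forall M : rat, exists N : nat, forall i : nat,
    (N <= i)%N -> (M%:E <= ord (u i - l))%E.

Definition algebraic_over_Qp (y : K) : Prop :=
  exists P : {poly K}, [/\ P != 0, forall i : nat, Qp_set P`_i & root P y].

(* (K, ord) is a completion of an algebraic closure of Q_p, which determines it
   up to isometric isomorphism. Characteristic 0 follows from ord_p; the value
   group of C_p is the rationals, hence the codomain of ord. *)
Record is_Cp (p : nat) : Prop := IsCp {
  ord_zero : forall x, (ord x = +oo)%E <-> x = 0;
  ord_neq_ninfty : forall x, (ord x != -oo)%E;
  ord_mul : forall x y, ord (x * y) = (ord x + ord y)%E;
  ord_add : forall x y, (Order.min (ord x) (ord y) <= ord (x + y))%E;
  ord_p : ord p%:R = 1%:E;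
  Cp_complete : forall u, ord_cauchy u -> exists l, ord_lim u l;
  Cp_dense : forall (x : K) (M : rat),
    exists2 y, algebraic_over_Qp y & (M%:E <= ord (x - y))%E }.

(* Unordered summation: the net of finite partial sums converges to s. *)
Definition is_psum (I : choiceType) (f : I -> K) (s : K) : Prop :=
  forall M : rat, exists S : {fset I}, forall T : {fset I},
    (S `<=` T)%fset -> (M%:E <= ord (s - \sum_(i <- T) f i)%R)%E.

(* The sum is unique when it exists, see psumE. *)
Definition psum (I : choiceType) (f : I -> K) : K := xget 0 (is_psum f).

Definition unramified_extension (a : nat) (L : set K) : Prop :=
  [/\ divring_closed (mem L),
      Qp_set `<=` L,
      exists e : 'I_a -> K, (forall i, L (e i)) /\
        forall x, L x -> exists! c : {ffun 'I_a -> K},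
          (forall i, Qp_set (c i)) /\ x = \sum_(i < a) c i * e i
    & forall x, L x -> x != 0 -> exists z : int, ord x = (z%:~R)%:E].

Definition integers_of (L : set K) : set K :=
  [set x | L x /\ (0 <= ord x)%E].

Definition adjoin_ring (B : set K) (g : K) : set K :=
  smallest (fun E : set K => subring_closed (mem E)) (B `|` [set g]).

Definition adjoin_field (L X : set K) : set K :=
  smallest (fun E : set K => divring_closed (mem E)) (L `|` X).

Definition is_residue_map (L : set K) (F : finFieldType) (red : K -> F) : Prop :=
  [/\ red 1 = 1,
      forall x y, integers_of L x -> integers_of L y ->
        red (x + y) = red x + red y /\ red (x * y) = red x * red y,
      forall x, integers_of L x -> (red x = 0 <-> (0 < ord x)%E)
    & forall u : F, exists2 x, integers_of L x & red x = u].

Definition is_teichmuller (L : set K) (F : finFieldType) (red : K -> F)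
    (t : F) (tbar : K) : Prop :=
  [/\ integers_of L tbar, tbar ^+ #|F| = tbar & red tbar = t].

(* The p-power Frobenius of L / Q_p, extended to L(zeta, tg) by fixing zeta and
   tg; the values of sigma outside L(zeta, tg) are irrelevant. *)
Record is_frobenius (p : nat) (L : set K) (zeta tg : K) (sigma : K -> K)
    (E := adjoin_field L [set zeta; tg]) : Prop := IsFrobenius {
  frob_bij : set_bij E E sigma;
  frob_one : sigma 1 = 1;
  frob_add : forall x y, E x -> E y -> sigma (x + y) = sigma x + sigma y;
  frob_mul : forall x y, E x -> E y -> sigma (x * y) = sigma x * sigma y;
  frob_Qp : forall x, Qp_set x -> sigma x = x;
  frob_L : forall x, L x -> L (sigma x);
  frob_lift : forall x, integers_of L x -> (0 < ord (sigma x - x ^+ p)%R)%E;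
  frob_zeta : sigma zeta = zeta;
  frob_tg : sigma tg = tg }.

(* Formal power series in one variable, as coefficient sequences. *)
Definition ps_mul (f g : nat -> K) : nat -> K :=
  fun k => \sum_(i < k.+1) f i * g (k - i)%N.

Definition ps_one : nat -> K := fun k => (k == 0%N)%:R.

Definition ps_pow (f : nat -> K) (j : nat) : nat -> K := iter j (ps_mul f) ps_one.

(* Meant for f 0 = 0: then f ^ j does not contribute in degree k < j. *)
Definition ps_exp (f : nat -> K) : nat -> K :=
  fun k => \sum_(j < k.+1) ps_pow f j k / (j`!)%:R.

(* Laurent series in x, y: xi a b is the coefficient of x^a y^b. *)
Definition ls := int -> int -> K.

Definition ls_add (xi eta : ls) : ls := fun a b => xi a b + eta a b.

Definition ls_mul (xi eta : ls) : ls := fun a b =>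
  psum (fun c : int * int => xi c.1 c.2 * eta (a - c.1) (b - c.2)).

(* f(c x^u y^v) for a power series f and (u, v) <> (0, 0). *)
Definition ls_subst (f : nat -> K) (c : K) (u v : int) : ls := fun a b =>
  psum (fun k : nat => if (a == k%:Z * u) && (b == k%:Z * v)
                       then f k * c ^+ k else 0).

Definition is_gamma (p : nat) (gamma : K) : Prop :=
  is_psum (fun k : nat => gamma ^+ (p ^ k) / p%:R ^+ k) 0
  /\ ord gamma = ((p%:Q - 1)^-1)%:E.

(* Coefficients of sum_k (gamma x)^(p^k) / p^k; d = p^k forces k <= d. *)
Definition AH_log (p : nat) (gamma : K) : nat -> K := fun d =>
  \sum_(k < d.+1 | d == (p ^ k)%N) gamma ^+ (p ^ k) / p%:R ^+ k.

Definition Theta (p : nat) (gamma : K) : nat -> K := ps_exp (AH_log p gamma).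

Definition Ft (n p : nat) (gamma tbar : K) : ls :=
  ls_mul (ls_mul (ls_subst (Theta p gamma) 1 n%:Z 0)
                 (ls_subst (Theta p gamma) 1 0 1))
         (ls_subst (Theta p gamma) tbar (- 1) (- 1)).

Definition psi_p (p : nat) (xi : ls) : ls := fun a b => xi (p%:Z * a) (p%:Z * b).

Definition sigma_inv (E : set K) (sigma : K -> K) (y : K) : K :=
  xget 0 [set x | E x /\ sigma x = y].

Definition alpha1 (n p : nat) (L : set K) (zeta gamma tg tbar : K)
    (sigma : K -> K) (xi : ls) : ls := fun a b =>
  sigma_inv (adjoin_field L [set zeta; tg]) sigma
    (psi_p p (ls_mul (Ft n p gamma tbar) xi) a b).

Definition omega (n : nat) (a b : int) : rat :=
  a%:Q / n%:Q + b%:Q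
  + (2 * n%:Q + 1) / n%:Q * Num.max 0 (Num.max (- a%:Q) (- b%:Q)).

(* n * omega n a b, as an integer. *)
Definition nomega (n : nat) (a b : int) : int :=
  a + n%:Z * b + (2 * n%:Z + 1) * Num.max 0 (Num.max (- a) (- b)).

Definition C0 (n : nat) (L : set K) (tg : K) : set ls :=
  [set f | exists xi : ls,
    [/\ forall a b, adjoin_ring (integers_of L) tg (xi a b),
        forall M : rat, exists W : rat, forall a b,
          W <= omega n a b -> (M%:E <= ord (xi a b))%E
      & forall a b, f a b = xi a b * tg ^ nomega n a b]].

Definition gamma_ (p : nat) (gamma : K) (i : nat) : K :=
  \sum_(k < i.+1) gamma ^+ (p ^ k) / p%:R ^+ k.

Definition Dx (n p : nat) (gamma tbar : K) (sigma : K -> K) (xi : ls) : ls :=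
  fun a b => a%:~R * xi a b +
    psum (fun i : nat => gamma_ p gamma i * p%:R ^+ i *
      (n%:R * xi (a - (n * p ^ i)%:Z) b
       - iter i sigma tbar * xi (a + (p ^ i)%:Z) (b + (p ^ i)%:Z))).

Definition Dy (p : nat) (gamma tbar : K) (sigma : K -> K) (xi : ls) : ls :=
  fun a b => b%:~R * xi a b +
    psum (fun i : nat => gamma_ p gamma i * p%:R ^+ i *
      (xi a (b - (p ^ i)%:Z)
       - iter i sigma tbar * xi (a + (p ^ i)%:Z) (b + (p ^ i)%:Z))).

Definition eps (n i : nat) : ls := fun a b =>
  if (i <= n)%N then ((a == i%:Z) && (b == 0))%:R
  else ((a == i%:Z - n%:Z) && (b == 1))%:R.

Definition teps (n : nat) (tg : K) (i : nat) : ls := fun a b =>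
  tg ^+ i * eps n i a b.

(* The congruences modulo Dx C0 + Dy C0 that define A; the i-th row of A holds
   the coordinates of the image of the i-th basis element, i.e. A is the
   transpose of the column convention. *)
Definition is_matrix_of_alpha1 (n p : nat) (L : set K) (zeta gamma tg tbar : K)
    (sigma : K -> K) (A : 'M[K]_(2 * n + 1)) : Prop :=
  (forall i j, adjoin_ring (integers_of L) tg (A i j)) /\
  forall i : 'I_(2 * n + 1), exists xi eta : ls,
    [/\ C0 n L tg xi, C0 n L tg eta &
        forall a b,
          alpha1 n p L zeta gamma tg tbar sigma (teps n tg i) a b
          = \sum_(j < 2 * n + 1) A i j * teps n tg j a b
            + ls_add (Dx n p gamma tbar sigma xi) (Dy p gamma tbar sigma eta)
                a b].

End ValuedField.

Arguments is_matrix_of_alpha1 {K} ord n p L zeta gamma tg tbar sigma A.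

Definition det_one_subT (K : closedFieldType) (N : nat) (A : 'M[K]_N) :
    {poly K} :=
  \det (1%:M - 'X *: map_mx polyC A).

Lemma nomegaE (n : nat) (a b : int) : (0 < n)%N ->
  (nomega n a b)%:~R = n%:Q * omega n a b.
Proof.
move=> n0; have nn0 : n%:Q != 0 by rewrite intr_eq0 -lt0n.
have maxE (x y : int) : (Num.max x y)%:~R = Num.max x%:~R y%:~R :> rat.
  by rewrite /Order.max ltr_int; case: ifP.
rewrite /nomega /omega !rmorphD !rmorphM /= !maxE !rmorphN /= rmorphD rmorphM /=.
rewrite !mulrDr !mulrA [n%:Q * a%:Q]mulrC [n%:Q * (2 * _ + 1)]mulrC mulfK //.
by rewrite [_ * n%:Q / n%:Q]mulfK.
Qed.

Lemma psumE (p : nat) (K : closedFieldType) (ord : K -> \bar rat)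
    (I : choiceType) (f : I -> K) (s : K) :
  is_Cp ord p -> is_psum ord f s -> psum ord f = s.
Proof.
move=> hC hs; have := xgetPex 0 (ex_intro _ s hs).
rewrite -/(psum ord f); move: (psum ord f) => s' hs'.
have ordN x : ord (- x) = ord x.
  have e1 : (ord (-1)%R + ord (-1)%R)%E = ord 1 by rewrite -(ord_mul hC) mulrNN mulr1.
  have e2 : (ord 1%R + ord 1%R)%E = ord 1 by rewrite -(ord_mul hC) mulr1.
  have n1 : ord 1 <> +oo%E by move=> /(ord_zero hC) /eqP; rewrite oner_eq0.
  have := ord_neq_ninfty hC 1; rewrite -mulN1r (ord_mul hC) => nn1.
  case E1 : (ord 1) e1 e2 n1 nn1 => [r| |] // e1 [/eqP]; rewrite -subr_eq0 addrK.
  move=> /eqP r0 _ _; move: e1; rewrite r0.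
  case: (ord (-1)) => [u| |] //= [/eqP]; rewrite -mulr2n mulrn_eq0 /= => /eqP ->.
  by rewrite add0e.
apply/eqP/negPn/negP => ne.
have [r Er] : exists r, ord (s' - s) = r%:E.
  have := ord_neq_ninfty hC (s' - s).
  case E : (ord (s' - s)) => [r| |] // _; first by exists r.
  by move/(ord_zero hC): E => /eqP; rewrite subr_eq0 (negbTE ne).
have [S hS] := hs (r + 1); have [S' hS'] := hs' (r + 1).
have h1 := hS _ (fsubsetUl S S'); have h2 := hS' _ (fsubsetUr S S').
set T := (S `|` S')%fset in h1 h2; set w := \sum_(i <- T) f i in h1 h2.
have := ord_add hC (s' - w) (- (s - w)).
rewrite ordN opprB addrA subrK Er ge_min => /orP[] h.
  by have := le_trans h2 h; rewrite lee_fin gerDl ler10.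
by have := le_trans h1 h; rewrite lee_fin gerDl ler10.
Qed.

(* Main.v *)
(** Put [e_(a,b) = tg^(n omega(a,b)) x^a y^b]. On C0 the operators Dx and Dy agree modulo
    p^2 with [x d/dx + gamma (n x^n - t/(xy))] and [y d/dy + gamma (y - t/(xy))]. The linear
    functionals killing the images of the latter are explicit: their values on the powers of
    x satisfy a two-sided linear recurrence of order 2n+1, and the other values follow. The
    functional dual to the j-th basis element is integral on every [e_(a,b)] and vanishes on
    those of weight below j/n. The coefficient of [e_(a,b)] in the image of a basis element
    under alpha_1 has order at least [omega(a,b)], so pairing with this functional shows
    that [ord A_ij >= j/n] and, for j < n, that A_ij is, modulo order (j+1)/n, a single
    coefficient of Ft with t replaced by a conjugate.

    For i, j < m the leading part of that coefficient is, up to row and column factors, the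
    square of the falling factorial of length m-1-i of x_j, where x_j is the residue of
    m-1-pj modulo n. Hence the leading principal minor of size m is a known factor times
    [+- det V(x_0, ..., x_(m-1))], a p-adic unit, and all other principal minors of size m
    have larger order. *)

Require Import Defs.
From HB Require Import structures.
From mathcomp Require Import all_boot all_order all_algebra all_fingroup.
From mathcomp Require Import finmap zify ring lra.
From mathcomp Require Import boolp classical_sets functions constructive_ereal.
Import Order.TTheory GRing.Theory Num.Theory.
Local Open Scope ring_scope.

Set Implicit Arguments.
Unset Strict Implicit.
Unset Printing Implicit Defensive.

(** * Valuations *)

(** This is why Dx and Dy may be replaced modulo p^2, and why series in C0 may be cut down to finite
    boxes, where pairing with a functional is a finite sum.

    [sigma] is known only algebraically: a field automorphism that fixes Q_p and lifts the p-th
    power. Nothing says that it is continuous, so its inverse can be applied to a coefficient of Ft,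
    an infinite sum, only once that coefficient is written as a finite combination over Q_p.

    The bounds on p serve different ends. p > M_n(m) makes the nonzero integer det V prime to p. The
    other one is n(n-1)(2n+1) + 1: as alpha_(i,j) <= n-1 and m < n, it yields (2n+1) sum alpha <
    p-1, so the leading minor has order below (1 + sum_(i<m) i)/n. Any other principal minor of size
    m has at least that order, since column j has order at least j/n and the sum of its indices is
    larger by at least 1. The same bound separates the error of order (j+1)/n in A_ij from the
    leading part. *)

Section Valuation.
Context (K : closedFieldType) (ord : K -> \bar rat) (p : nat).
Context (pr : prime p).
Context (hC : is_Cp ord p).

(** Lower bounds pass through sums and cover [ord 0 = +oo] without a case distinction. *)
Definition vge (M : rat) (x : K) : Prop := (M%:E <= ord x)%E.
Notation ge := vge.

Lemma ordK0 : ord 0 = +oo%E.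
Proof. exact/(ord_zero hC). Qed.

Lemma ord_fin x : x != 0 -> exists r, ord x = r%:E.
Proof.
move=> /eqP x0; have := ord_neq_ninfty hC x.
case E : (ord x) => [r| |] // _; first by exists r.
by move/(ord_zero hC): E.
Qed.

Lemma ordK1 : ord 1 = 0%:E.
Proof.
have [r Er] := ord_fin (oner_neq0 K).
have := ord_mul hC 1 1; rewrite mulr1 Er => -[] /eqP.
by rewrite -subr_eq0 opprD addNKr oppr_eq0 => /eqP ->.
Qed.

Lemma ordM x y r s : ord x = r%:E -> ord y = s%:E -> ord (x * y) = (r + s)%:E.
Proof. by move=> hx hy; rewrite (ord_mul hC) hx hy. Qed.

Lemma ordN x : ord (- x) = ord x.
Proof.
have [r Er] : exists r, ord (-1) = r%:E by apply: ord_fin; rewrite oppr_eq0 oner_eq0.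
have := ord_mul hC (-1) (-1); rewrite mulrNN mulr1 ordK1 Er => -[] /eqP.
rewrite eq_sym -mulr2n mulrn_eq0 /= => /eqP r0.
by rewrite -mulN1r (ord_mul hC) Er r0 add0e.
Qed.

Lemma ord_neq0 x r : ord x = r%:E -> x != 0.
Proof. by move=> h; apply/eqP => x0; move: h; rewrite x0 ordK0. Qed.

Lemma ordV x r : ord x = r%:E -> ord x^-1 = (- r)%:E.
Proof.
move=> hx; have x0 := ord_neq0 hx.
have [s Es] : exists s, ord x^-1 = s%:E by apply: ord_fin; rewrite invr_eq0.
have := ord_mul hC x x^-1; rewrite mulfV // ordK1 hx Es => -[] /eqP.
by rewrite eq_sym addrC addr_eq0 => /eqP ->.
Qed.

Lemma ordX x r k : ord x = r%:E -> ord (x ^+ k) = (r * k%:R)%:E.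
Proof.
move=> hx; elim: k => [|k IH]; first by rewrite expr0 ordK1 mulr0.
by rewrite exprS (ordM hx IH) -natr1 mulrDr mulr1 addrC.
Qed.

Lemma ordXz x r (z : int) : ord x = r%:E -> ord (x ^ z) = (r * z%:~R)%:E.
Proof.
move=> hx; case: z => k; first exact: (ordX k hx).
have := ordV (ordX k.+1 hx); rewrite -mulrN NegzE rmorphN => <-.
by rewrite exprnN.
Qed.

Lemma ge_ord x r : ord x = r%:E -> ge r x.
Proof. by rewrite /vge => ->. Qed.

Lemma ge0 M : ge M 0.
Proof. by rewrite /vge ordK0 leey. Qed.

Lemma geN M x : ge M x -> ge M (- x).
Proof. by rewrite /vge ordN. Qed.

Lemma geD M x y : ge M x -> ge M y -> ge M (x + y).
Proof.
move=> hx hy; apply: le_trans (ord_add hC x y).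
by rewrite le_min hx hy.
Qed.

Lemma geB M x y : ge M x -> ge M y -> ge M (x - y).
Proof. by move=> hx /geN; apply: geD. Qed.

Lemma geW M N x : N <= M -> ge M x -> ge N x.
Proof. by move=> h; apply: le_trans; rewrite lee_fin. Qed.

Lemma geM M N x y : ge M x -> ge N y -> ge (M + N) (x * y).
Proof. by move=> hx hy; rewrite /vge (ord_mul hC) EFinD leeD. Qed.

Lemma ge_sum M (I : Type) (r : seq I) (P : pred I) (F : I -> K) :
  (forall i, P i -> ge M (F i)) -> ge M (\sum_(i <- r | P i) F i).
Proof. by move=> h; apply: big_ind => //; [exact: ge0 | exact: geD]. Qed.

Lemma ge_sum_seq M (I : eqType) (r : seq I) (P : pred I) (F : I -> K) :
  (forall i, i \in r -> P i -> ge M (F i)) -> ge M (\sum_(i <- r | P i) F i).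
Proof.
by move=> h; rewrite big_seq_cond; apply: ge_sum => i /andP[]; apply: h.
Qed.

Lemma ge1 : ge 0 1.
Proof. exact/ge_ord/ordK1. Qed.

Lemma ge_prod (I : Type) (r : seq I) (P : pred I) (F : I -> K) (M : I -> rat) :
  (forall i, P i -> ge (M i) (F i)) ->
  ge (\sum_(i <- r | P i) M i) (\prod_(i <- r | P i) F i).
Proof.
move=> h; elim/big_rec2: _ => [|i x y Pi IH]; first exact: ge1.
by apply: geM => //; apply: h.
Qed.

Lemma ord_prod (I : Type) (r : seq I) (P : pred I) (F : I -> K) (M : I -> rat) :
  (forall i, P i -> ord (F i) = (M i)%:E) ->
  ord (\prod_(i <- r | P i) F i) = (\sum_(i <- r | P i) M i)%:E.
Proof.
move=> h; elim/big_rec2: _ => [|i x y Pi IH]; first exact: ordK1.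
by apply: ordM => //; apply: h.
Qed.

Lemma geX M x k : ge M x -> ge (M * k%:R) (x ^+ k).
Proof.
move=> hx; elim: k => [|k IH]; first by rewrite mulr0 expr0; exact: ge1.
by rewrite exprS -natr1 mulrDr mulr1 addrC; apply: geM.
Qed.

Lemma ge0X x k : ge 0 x -> ge 0 (x ^+ k).
Proof. by move=> /(geX k); rewrite mul0r. Qed.

Lemma ge0M M x y : ge 0 x -> ge M y -> ge M (x * y).
Proof. by move=> hx hy; rewrite -[M]add0r; apply: geM. Qed.

Lemma ge_nat k : ge 0 k%:R.
Proof.
by elim: k => [|k IH]; [exact: ge0 | rewrite -natr1; apply: geD => //; exact: ge1].
Qed.

Lemma ge_int (z : int) : ge 0 z%:~R.
Proof. by case: z => k; [exact: ge_nat | rewrite NegzE rmorphN; apply/geN/ge_nat]. Qed.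

(** A larger order of the sum would force a larger order on [x = (x + y) - y]. *)
Lemma ordD_eq x y r s : ord x = r%:E -> ge s y -> r < s -> ord (x + y) = r%:E.
Proof.
move=> hx hy rs; apply/eqP; rewrite eq_le; apply/andP; split; last first.
  by apply: geD; [exact: ge_ord | apply: geW hy; exact: ltW].
rewrite leNgt; apply/negP => h.
case E : (ord (x + y)) => [u| |]; last 1 first.
- by have := ord_neq_ninfty hC (x + y); rewrite E.
- move: h; rewrite E lte_fin => ru.
  have : ge (Num.min u s) x.
    rewrite -(addrK y x); apply: geB.
      by apply: geW (ge_ord E); rewrite ge_min lexx.
    by apply: geW hy; rewrite ge_min lexx orbT.
  by rewrite /vge hx lee_fin leNgt lt_min ru rs.
- have xy : x = - y by move/(ord_zero hC)/eqP: E; rewrite addr_eq0 => /eqP.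
  by move: hy; rewrite /vge -ordN -xy hx lee_fin leNgt rs.
Qed.

Lemma ge_eq0 x : (forall M, ge M x) -> x = 0.
Proof.
move=> h; apply/eqP/negPn/negP => /ord_fin[r Er].
by have := h (r + 1); rewrite /vge Er lee_fin gerDl ler10.
Qed.

(** By Bezout [u * p + v * z = 1], so [p] and [z] cannot both have positive order. *)
Lemma ord_int_unit (z : int) : ~~ (p %| `|z|)%N -> ord (z%:~R) = 0%:E.
Proof.
move=> pz.
have cop : coprimez p z by rewrite coprimezE absz_nat prime_coprime.
have /coprimezP[[u v] /= e] := cop.
have h1 : u%:~R * p%:R + v%:~R * z%:~R = 1 :> K.
  by rewrite -[p%:R]/((p : int)%:~R) -!intrM -intrD e.
have z0 : z%:~R != 0 :> K.
  apply/eqP => z0; move: h1; rewrite z0 mulr0 addr0 => h1.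
  have : ge 1 (1 : K) by rewrite -h1; apply: ge0M (ge_int u) (ge_ord (ord_p hC)).
  by rewrite /vge ordK1 lee_fin ler10.
have [r Er] := ord_fin z0; rewrite Er; congr (_%:E).
have r0 : 0 <= r by have := ge_int z; rewrite /vge Er lee_fin.
apply/eqP; rewrite eq_le r0 andbT leNgt; apply/negP => rgt.
have : ge (Num.min 1 r) (1 : K).
  rewrite -h1; apply: geD.
    by apply: geW (ge0M (ge_int u) (ge_ord (ord_p hC))); rewrite ge_min lexx.
  by apply: geW (ge0M (ge_int v) (ge_ord Er)); rewrite ge_min lexx orbT.
by rewrite /vge ordK1 lee_fin leNgt lt_min ltr01 rgt.
Qed.

Lemma ord_nat_unit (k : nat) : ~~ (p %| k)%N -> ord (k%:R) = 0%:E.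
Proof. exact: (@ord_int_unit k). Qed.

Lemma ord_nat (k : nat) : (0 < k)%N -> ord k%:R = (logn p k)%:R%:E.
Proof.
move=> k0; have [k' pk' Ek] := pfactor_coprime pr k0.
have h : ord (k'%:R * p%:R ^+ logn p k) = (0 + 1 * (logn p k)%:R)%:E.
  by apply: ordM; [apply: ord_nat_unit; rewrite -prime_coprime | exact: ordX (ord_p hC)].
by rewrite {1}Ek natrM natrX h add0r mul1r.
Qed.

Lemma natK_neq0 (k : nat) : (0 < k)%N -> k%:R != 0 :> K.
Proof. by move=> /ord_nat /ord_neq0. Qed.

Lemma intK_eq0 (z : int) : (z%:~R == 0 :> K) = (z == 0).
Proof.
apply/idP/idP => [|/eqP ->]; last by rewrite mulr0z.
apply: contraLR => z0; case: z z0 => k.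
  by move=> k0; apply: natK_neq0; case: k k0.
by move=> _; rewrite NegzE rmorphN oppr_eq0; exact: natK_neq0.
Qed.

Lemma ord_fact_unit k : (k < p)%N -> ord (k`!)%:R = 0%:E.
Proof.
move=> kp; apply: ord_nat_unit; elim: k kp => [|k IH] kp.
  by rewrite gtnNdvd // prime_gt1.
by rewrite factS Euclid_dvdM // negb_or IH ?andbT ?gtnNdvd // ltnW.
Qed.

End Valuation.

(** * Convergent sums *)

Section Summation.
Context (K : closedFieldType) (ord : K -> \bar rat) (p : nat).
Context (hC : is_Cp ord p).
Notation ge := (vge ord).

Definition null (f : nat -> K) : Prop :=
  forall M, exists N, forall i, (N <= i)%N -> ge M (f i).

Lemma lim_uniq u l l' : ord_lim ord u l -> ord_lim ord u l' -> l = l'.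
Proof.
move=> h h'; apply/eqP; rewrite -subr_eq0; apply/eqP/(ge_eq0 hC) => M.
have [N hN] := h M; have [N' hN'] := h' M.
have -> : l - l' = (u (N + N')%N - l') - (u (N + N')%N - l) by ring.
by apply: (geB hC); [apply: hN'; rewrite leq_addl | apply: hN; rewrite leq_addr].
Qed.

Lemma ge_lim M u l : ord_lim ord u l ->
  (exists N, forall i, (N <= i)%N -> ge M (u i)) -> ge M l.
Proof.
move=> /(_ M)[N hN] [N' hN'].
have -> : l = u (N + N')%N - (u (N + N')%N - l) by ring.
by apply: (geB hC); [apply: hN'; rewrite leq_addl | apply: hN; rewrite leq_addr].
Qed.

Lemma lim_cst c : ord_lim ord (fun=> c) c.
Proof. by move=> M; exists 0%N => i _; rewrite subrr; exact: (ge0 hC). Qed.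

Lemma limD u v l l' : ord_lim ord u l -> ord_lim ord v l' ->
  ord_lim ord (fun i => u i + v i) (l + l').
Proof.
move=> hu hv M; have [N hN] := hu M; have [N' hN'] := hv M.
exists (N + N')%N => i hi; rewrite opprD addrACA; apply: (geD hC).
  by apply: hN; apply: leq_trans hi; rewrite leq_addr.
by apply: hN'; apply: leq_trans hi; rewrite leq_addl.
Qed.

Lemma limZ c u l : ord_lim ord u l -> ord_lim ord (fun i => c * u i) (c * l).
Proof.
have [->|/(ord_fin hC)[r Er]] := eqVneq c 0.
  move=> _; rewrite mul0r; move=> M; exists 0%N => i _.
  by rewrite mul0r subrr; exact: (ge0 hC).
move=> hu M; have [N hN] := hu (M - r); exists N => i hi.
rewrite -mulrBr; have -> : M = r + (M - r) by ring.
by apply: (geM hC); [exact: ge_ord | exact: hN].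
Qed.

Lemma lim_sum (I : Type) (s : seq I) (u : I -> nat -> K) (l : I -> K) :
  (forall r, ord_lim ord (u r) (l r)) ->
  ord_lim ord (fun i => \sum_(r <- s) u r i) (\sum_(r <- s) l r).
Proof.
move=> h; elim: s => [|r s IH].
  by rewrite big_nil => M; exists 0%N => i _; rewrite big_nil subrr; exact: (ge0 hC).
rewrite big_cons; have := limD (h r) IH.
by congr ord_lim; apply/funext => i; rewrite big_cons.
Qed.

Lemma lim_sub u l (g : nat -> nat) : (forall i, (i <= g i)%N) ->
  ord_lim ord u l -> ord_lim ord (fun i => u (g i)) l.
Proof.
move=> hg hu M; have [N hN] := hu M; exists N => i hi.
by apply: hN; apply: leq_trans (hg i).
Qed.

Definition nsum (f : nat -> K) (s : K) : Prop :=
  null f /\ ord_lim ord (fun N => \sum_(i < N) f i) s.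

Lemma partial_sum_tail M f N i : (forall j, (N <= j)%N -> ge M (f j)) -> (N <= i)%N ->
  ge M (\sum_(j < i) f j - \sum_(j < N) f j).
Proof.
move=> hN Ni; rewrite -(big_mkord predT f) (big_cat_nat (n := N)) //= big_mkord.
rewrite addrAC subrr add0r big_nat_cond; apply: (ge_sum hC) => j /andP[/andP[Nj _] _].
exact: hN.
Qed.

Lemma nsum_ex f : null f -> exists s, nsum f s.
Proof.
move=> nf; have [|l hl] := Cp_complete hC (u := fun N => \sum_(i < N) f i).
  move=> M; have [N hN] := nf M; exists N => i j hi hj.
  rewrite -[X in ord X](subrKA (\sum_(k < N) f k)); apply: (geD hC).
    exact: partial_sum_tail.
  by rewrite -opprB; apply: (geN hC); exact: partial_sum_tail.
by exists l.
Qed.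

Lemma nsum_tail M f s N : nsum f s -> (forall j, (N <= j)%N -> ge M (f j)) ->
  ge M (s - \sum_(i < N) f i).
Proof.
move=> [_ hs] hN; have := limD hs (lim_cst (- \sum_(i < N) f i)).
move/ge_lim; apply; exists N => i hi; exact: partial_sum_tail.
Qed.

Lemma nsum_ge M f s : nsum f s -> (forall i, ge M (f i)) -> ge M s.
Proof.
by move=> hs h; have := nsum_tail (N := 0) hs (fun j _ => h j); rewrite big_ord0 subr0.
Qed.

(** Ultrametric form of unordered summation: one finite set with small terms outside it replaces a
    condition on all larger partial sums. *)
Definition csum (I : choiceType) (f : I -> K) (s : K) : Prop :=
  forall M, exists S : {fset I},
    (forall i, i \notin S -> ge M (f i)) /\ ge M (s - \sum_(i <- S) f i).

Lemma csum_is_psum (I : choiceType) (f : I -> K) s : csum f s -> is_psum ord f s.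
Proof.
move=> hf M; have [S [h1 h2]] := hf M; exists S => T ST.
rewrite (big_fsetID _ (mem S)) /=.
have -> : [fset x | x in T & x \in S]%fset = S.
  apply/fsetP => x; rewrite !inE /=; apply: andb_idl; exact: (fsubsetP ST).
rewrite opprD addrA; apply: (geB hC) => //.
by apply: (ge_sum_seq hC) => i; rewrite !inE => /andP[_ /h1].
Qed.

Lemma csum_psum (I : choiceType) (f : I -> K) s : csum f s -> psum ord f = s.
Proof. by move=> /csum_is_psum; exact: psumE hC. Qed.

Lemma csum_fin (I : choiceType) (f : I -> K) (S : {fset I}) :
  (forall i, i \notin S -> f i = 0) -> csum f (\sum_(i <- S) f i).
Proof.
move=> h M; exists S; split => [i /h ->|]; first exact: (ge0 hC).
by rewrite subrr; exact: (ge0 hC).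
Qed.

Lemma psum1 (I : choiceType) (f : I -> K) (i0 : I) :
  (forall i, i != i0 -> f i = 0) -> psum ord f = f i0.
Proof.
move=> h; rewrite (csum_psum (csum_fin (S := [fset i0]%fset) _)); last first.
  by move=> i; rewrite inE; exact: h.
by rewrite big_seq_fset1.
Qed.

Lemma psum0 (I : choiceType) (f : I -> K) : (forall i, f i = 0) -> psum ord f = 0.
Proof.
move=> h; rewrite (csum_psum (csum_fin (S := fset0) _)) => [|i _]; last exact: h.
by rewrite big_seq_fset0.
Qed.

Lemma csum_inj (I J : choiceType) (g : J -> I) (f : I -> K) s :
  injective g -> (forall i, (forall j, g j != i) -> f i = 0) ->
  csum (fun j => f (g j)) s -> csum f s.
Proof.
move=> gi f0 hs M; have [S [h1 h2]] := hs M; exists (g @` S)%fset; split.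
  move=> i hi; have [[j ji]|nj] := pselect (exists j, g j = i).
    rewrite -ji; apply: h1; apply: contra hi => jS; rewrite -ji.
    by apply/imfsetP; exists j.
  rewrite f0; first exact: (ge0 hC).
  by move=> j; apply/eqP => ji; apply: nj; exists j.
by rewrite big_imfset //= => x y _ _; exact: gi.
Qed.

Lemma sum_iota_fset N (f : nat -> K) :
  \sum_(i <- seq_fset tt (iota 0 N)) f i = \sum_(i < N) f i.
Proof.
rewrite -(big_mkord predT f) /index_iota subn0.
by rewrite (perm_big _ (seq_fset_perm tt (iota 0 N))) undup_id ?iota_uniq.
Qed.

Lemma nsum_csum f s : nsum f s -> csum f s.
Proof.
move=> hs M; have [N hN] := hs.1 M; exists (seq_fset tt (iota 0 N)); split.
  by move=> i hi; apply: hN; move: hi; rewrite seq_fsetE mem_iota -leqNgt.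
by rewrite sum_iota_fset; exact: nsum_tail.
Qed.

Lemma nsum_psum f s : nsum f s -> psum ord f = s.
Proof. by move=> /nsum_csum; exact: csum_psum. Qed.

(** Stated for [is_psum] because the equation of gamma comes in that form. The finite set given by
    convergence is enlarged by the initial segment; what is then in excess consists of small
    terms. *)
Lemma is_psum_tail M f s N : is_psum ord f s -> (forall j, (N <= j)%N -> ge M (f j)) ->
  ge M (s - \sum_(i < N) f i).
Proof.
move=> /(_ M)[S hS] hN; set S0 := (seq_fset tt (iota 0 N)).
have := hS _ (fsubsetUl S S0); rewrite (big_fsetID _ (mem S0)) /=.
have -> : [fset x | x in (S `|` S0) & x \in S0]%fset = S0.
  by apply/fsetP => x; rewrite !inE seq_fsetE; case: (x \in iota 0 N); rewrite ?andbT ?andbF ?orbT.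
set T := [fset x | x in _ & _]%fset.
have hT : ge M (\sum_(i <- T) f i).
  apply: (ge_sum_seq hC) => i; rewrite !inE seq_fsetE mem_iota => /andP[_].
  by rewrite -leqNgt => /hN.
rewrite sum_iota_fset => h.
have -> : s - \sum_(i < N) f i = (s - (\sum_(i < N) f i + \sum_(i <- T) f i))
   + \sum_(i <- T) f i by ring.
exact: (geD hC).
Qed.

End Summation.

(** * Functionals on twisted de Rham cohomology *)

Section TwistedDeRham.
Context (K : fieldType) (n : nat) (g t : K).
Context (n0 : n%:R != 0 :> K) (g0 : g != 0) (t0 : t != 0).

(** The extreme coefficients n^2 and t are invertible, so the recurrence runs in both directions
    from 2n+1 free values. *)
Definition row_rec (a : int) (x0 x1 x2 x3 : K) : Prop :=
  n%:R ^+ 2 * x3 + n%:R * (2 * a + n%:Z + 2)%:~R / g * x2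
    + ((a + 1)%:~R / g) ^+ 2 * x1 = t * x0.

Let fwd (a : int) (w : nat -> K) : K :=
  (t * w 0%N - n%:R * (2 * a + n%:Z + 2)%:~R / g * w n.+1
    - ((a + 1)%:~R / g) ^+ 2 * w 1%N) / n%:R ^+ 2.

Let bwd (a : int) (w : nat -> K) : K :=
  (n%:R ^+ 2 * w (2 * n)%N + n%:R * (2 * a + n%:Z + 2)%:~R / g * w n
    + ((a + 1)%:~R / g) ^+ 2 * w 0%N) / t.

(** A window lists 2n+1 consecutive values, starting at [k] here and at [- k] in [bwindow]; a step
    shifts it by one and computes the value that enters. *)
Fixpoint fwindow (c : nat -> K) (k : nat) : nat -> K :=
  if k is k'.+1 then
    fun i => if (i < 2 * n)%N then fwindow c k' i.+1 else fwd k'%:Z (fwindow c k')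
  else c.

Fixpoint bwindow (c : nat -> K) (k : nat) : nat -> K :=
  if k is k'.+1 then
    fun i => if i is i'.+1 then bwindow c k' i' else bwd (- k%:Z) (bwindow c k')
  else c.

Lemma row_exists (c : nat -> K) : exists u : int -> K,
  (forall i, (i <= 2 * n)%N -> u i%:Z = c i) /\
  forall a : int, row_rec a (u a) (u (a + 1)) (u (a + n%:Z + 1)) (u (a + (2 * n)%:Z + 1)).
Proof.
have ngt0 : (0 < n)%N by case: n n0 => //; rewrite eqxx.
pose w (a : int) := match a with Posz k => fwindow c k | Negz k => bwindow c k.+1 end.
have shift a i : (i < 2 * n)%N -> w (a + 1) i = w a i.+1.
  move=> hi; case: a => k.
    by rewrite [k%:Z + 1]addrC -intS /= hi.
  rewrite NegzE; case: k => [|k]; first by rewrite addNr.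
  by rewrite (_ : - k.+2%:Z + 1 = Negz k) // NegzE; lia.
have rec a : row_rec a (w a 0%N) (w a 1%N) (w a n.+1) (w (a + 1) (2 * n)%N).
  rewrite /row_rec; case: a => k.
    rewrite [k%:Z + 1]addrC -intS /= ltnn /fwd; field.
    by rewrite n0 g0.
  have -> : w (Negz k + 1) = bwindow c k.
    rewrite NegzE; case: k => [|k]; first by rewrite addNr.
    by rewrite (_ : - k.+2%:Z + 1 = Negz k) // NegzE; lia.
  rewrite /w /= /bwd -NegzE; field.
  by rewrite t0 g0.
have wE a i : (i <= 2 * n)%N -> w (a + i%:Z) 0%N = w a i.
  elim: i a => [|i IH] a hi; first by rewrite addr0.
  have -> : a + i.+1%:Z = (a + 1) + i%:Z by lia.
  by rewrite IH ?shift // ltnW.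
exists (fun a => w a 0%N); split => [i hi|a].
  by rewrite -[i%:Z]add0r wE.
have := rec a; rewrite -(wE a 1%N) ?muln_gt0 // -(wE a n.+1); last by lia.
rewrite -(wE (a + 1) (2 * n)%N) //.
have -> : a + n.+1%:Z = a + n%:Z + 1 by lia.
by have -> : a + 1 + (2 * n)%:Z = a + (2 * n)%:Z + 1 by lia.
Qed.

(* A functional [phi] on Laurent polynomials that kills the images of
   [x d/dx + g (n x^n - t/(xy))] and [y d/dy + g (y - t/(xy))] has
   [phi a (b+1) = rowop b (phi _ b) a] and [t * phi a (b-1) = rowop 0 (phi _ b) (a+1)];
   the two together are the recurrence [row_rec] for the row [b = 0]. *)
Definition rowop (c : int) (r : int -> K) (a : int) : K :=
  n%:R * r (a + n%:Z) + (a - c)%:~R / g * r a.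

Lemma rowopC b c r a : rowop b (rowop c r) a = rowop c (rowop b r) a.
Proof. rewrite /rowop; field. by rewrite g0. Qed.

Lemma rowop_shift c r a : rowop c (fun a => r (a + 1)) a = rowop (c + 1) r (a + 1).
Proof.
rewrite /rowop; have -> : a + n%:Z + 1 = a + 1 + n%:Z by lia.
by have -> : a + 1 - (c + 1) = a - c by lia.
Qed.

Lemma rowopZ c x r a : x * rowop c r a = rowop c (fun a => x * r a) a.
Proof. by rewrite /rowop; ring. Qed.

(** Going up from row b and down again must give back the row; on row 0 this is [row_rec]. The
    condition passes to the neighbouring rows because the operators [rowop c] commute. *)
Definition row_inv (b : int) (r : int -> K) : Prop :=
  forall a, t * r a = rowop 0 (rowop b r) (a + 1).

Lemma row_inv_up b r : row_inv b r -> row_inv (b + 1) (rowop b r).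
Proof.
move=> h a; rewrite rowopZ (_ : (fun _ => _) = fun a => rowop 0 (rowop b r) (a + 1)).
  rewrite rowop_shift rowopC; congr (rowop 0 _ _).
by apply/funext.
Qed.

Definition row_down (r : int -> K) (a : int) : K := t^-1 * rowop 0 r (a + 1).

Lemma row_downK b r : row_inv b r -> forall a, rowop (b - 1) (row_down r) a = r a.
Proof.
move=> h a; rewrite /row_down -rowopZ (rowop_shift _ (rowop 0 r)) subrK rowopC -h.
by rewrite mulKf.
Qed.

Lemma row_inv_down b r : row_inv b r -> row_inv (b - 1) (row_down r).
Proof.
move=> h a; rewrite /row_down mulVKf //; congr (rowop 0 _ _).
by apply/funext => x; rewrite (row_downK h).
Qed.

Lemma functional_exists (u : int -> K) :
  (forall a : int,
    row_rec a (u a) (u (a + 1)) (u (a + n%:Z + 1)) (u (a + (2 * n)%:Z + 1))) ->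
  exists phi : int -> int -> K,
  [/\ forall a, phi a 0 = u a,
      forall a b, phi a (b + 1) = n%:R * phi (a + n%:Z) b + (a - b)%:~R / g * phi a b
    & forall a b, t * phi a (b - 1)
        = n%:R * phi (a + 1 + n%:Z) b + (a + 1)%:~R / g * phi (a + 1) b].
Proof.
move=> hu.
have I0 : row_inv 0 u.
  move=> a; rewrite -hu /rowop !subr0.
  have -> : a + 1 + n%:Z + n%:Z = a + (2 * n)%:Z + 1 by lia.
  have -> : a + 1 + n%:Z = a + n%:Z + 1 by lia.
  by field; rewrite g0.
pose up := fix up k := if k is k'.+1 then rowop k'%:Z (up k') else u.
pose down k := iter k row_down u.
have Iup k : row_inv k%:Z (up k).
  by elim: k => [|k IH] //; rewrite -addn1 PoszD addn1; exact: row_inv_up.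
have Idn k : row_inv (- k%:Z) (down k).
  elim: k => [|k IH]; first exact: I0.
  have -> : - k.+1%:Z = - k%:Z - 1 by lia.
  by rewrite /down iterS; exact: row_inv_down.
pose r (b : int) := match b with Posz k => up k | Negz k => down k.+1 end.
have rN k : r (- k%:Z) = down k by case: k.
have rI b : row_inv b (r b).
  by case: b => k; [exact: Iup | rewrite NegzE rN; exact: Idn].
have rS b : r (b + 1) = rowop b (r b).
  case: b => k; first by rewrite [k%:Z + 1]addrC -intS.
  rewrite NegzE; have -> : - k.+1%:Z + 1 = - k%:Z by lia.
  have -> : - k.+1%:Z = - k%:Z - 1 by lia.
  apply/funext => a; rewrite rN -(row_downK (Idn k)).
  by have -> : - k%:Z - 1 = - k.+1%:Z by lia; rewrite rN.
exists (fun a b => r b a); split => // [a b|a b]; first by rewrite rS.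
have := rI (b - 1) a; rewrite -rS subrK => ->.
by rewrite /rowop subr0.
Qed.

End TwistedDeRham.

(** * The weight of a monomial and its subadditivity *)

Section Weight.
Context (n : nat).
Context (n_gt0 : (0 < n)%N).

Lemma nomega_ge0 a b : 0 <= nomega n a b.
Proof. by rewrite /nomega; nia. Qed.

Lemma nomegaD a b c d : nomega n (a + c) (b + d) <= nomega n a b + nomega n c d.
Proof.
rewrite /nomega.
have h : Num.max 0 (Num.max (- (a + c)) (- (b + d))) <=
  Num.max 0 (Num.max (- a) (- b)) + Num.max 0 (Num.max (- c) (- d)) by lia.
have := ler_wpM2l (_ : 0 <= 2 * n%:Z + 1) h; rewrite mulrDr => /(_ ltac:(lia)); lia.
Qed.

Lemma nomega_up a b : 0 <= b -> nomega n a (b + 1) = nomega n a b + n%:Z.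
Proof.
move=> b0; rewrite /nomega.
have -> : Num.max 0 (Num.max (- a) (- (b + 1))) = Num.max 0 (Num.max (- a) (- b)) by lia.
by ring.
Qed.

Lemma nomega_right a b k : 0 <= k -> nomega n (a + k) b <= nomega n a b + k.
Proof.
move=> k0; have := nomegaD a b k 0; rewrite addr0.
by have -> : nomega n k 0 = k by rewrite /nomega; nia.
Qed.

Lemma nomega_down a b : b <= 0 -> nomega n (a + 1) b + n%:Z <= nomega n a (b - 1).
Proof.
move=> b0; rewrite /nomega.
have -> : Num.max 0 (Num.max (- a) (- (b - 1))) = Num.max 0 (Num.max (- (a + 1)) (- b)) + 1.
  by lia.
by lia.
Qed.

Lemma nomega_diag a b k : nomega n a b <= nomega n (a + k%:Z) (b + k%:Z) + n%:Z * k%:Z.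
Proof.
have := nomegaD (a + k%:Z) (b + k%:Z) (- k%:Z) (- k%:Z); rewrite !addrK.
have -> // : nomega n (- k%:Z) (- k%:Z) = n%:Z * k%:Z.
rewrite /nomega !opprK.
have -> : Num.max 0 (Num.max k%:Z k%:Z) = k%:Z by lia.
ring.
Qed.

Lemma nomega_nat (k : nat) : nomega n k%:Z 0 = k%:Z.
Proof. by rewrite /nomega; nia. Qed.

Lemma nomega_neg (k : nat) : nomega n (- k%:Z) 0 = 2 * n%:Z * k%:Z.
Proof.
rewrite /nomega; have -> : Num.max 0 (Num.max (- - k%:Z) (- 0)) = k%:Z by lia.
by ring.
Qed.

Lemma nomega_absz a b : (`|a| <= nomega n a b) /\ (`|b| <= nomega n a b).
Proof. by rewrite /nomega; nia. Qed.

(** Hence x^j is the only monomial of weight j < n, which is why A_ij reduces to a single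
    coefficient of Ft for such j. *)
Lemma nomega_small a b : nomega n a b < n%:Z -> 0 <= a /\ b = 0.
Proof. by rewrite /nomega; nia. Qed.

End Weight.

(** * Integral functionals dual to the basis *)

Section Functional.
Context (K : closedFieldType) (ord : K -> \bar rat) (p : nat).
Context (hC : is_Cp ord p).
Context (n : nat) (t tg : K) (rho : rat).
Context (n_gt0 : (0 < n)%N) (ordn : ord n%:R = 0%:E) (ordt : ord t = 0%:E).
Context (rho_gt0 : 0 < rho) (ordtg : ord tg = rho%:E).
Notation ge := (vge ord).
Notation g := (tg ^+ n).

(* [good j v y]: [y] is integral after multiplication by [tg ^ v] and vanishes
   in weight [v < j]. *)
Definition good (j v : int) (y : K) : Prop :=
  ge (- v%:~R * rho) y /\ (v < j -> y = 0).

Lemma goodW j v v' y : v <= v' -> good j v y -> good j v' y.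
Proof.
move=> vv [h1 h2]; split; last by move=> h; apply: h2; apply: le_lt_trans h.
by apply: geW h1; rewrite ler_pM2r // lerN2 ler_int.
Qed.

Lemma goodD j v y z : good j v y -> good j v z -> good j v (y + z).
Proof.
move=> [h1 h2] [h3 h4]; split; first exact: (geD hC).
by move=> h; rewrite h2 // h4 // addr0.
Qed.

Lemma goodZ j v c y : ge 0 c -> good j v y -> good j v (c * y).
Proof.
move=> hc [h1 h2]; split; first exact: (ge0M hC).
by move=> h; rewrite h2 // mulr0.
Qed.

Lemma goodN j v y : good j v y -> good j v (- y).
Proof.
move=> [h1 h2]; split; first exact: (geN hC).
by move=> h; rewrite h2 // oppr0.
Qed.

Lemma good_div j v v' y : v + n%:Z <= v' -> good j v y -> good j v' (y / g).
Proof.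
move=> vv h; apply: (goodW vv); case: h => h1 h2; split.
  have -> : - (v + n%:Z)%:~R * rho = - v%:~R * rho + - (rho * n%:R) by ring.
  apply: (geM hC) => //; apply/ge_ord/(ordV hC)/(ordX hC)/ordtg.
by move=> h; rewrite h2 ?mul0r //; lia.
Qed.

Lemma ge0t : ge 0 t. Proof. exact: ge_ord. Qed.
Lemma ge0tV : ge 0 t^-1.
Proof. by apply: ge_ord; rewrite (ordV hC ordt) oppr0. Qed.
Lemma ge0nV : ge 0 n%:R^-1.
Proof. by apply: ge_ord; rewrite (ordV hC ordn) oppr0. Qed.

Let n0 : n%:R != 0 :> K := ord_neq0 hC ordn.
Let t0 : t != 0 := ord_neq0 hC ordt.
Let tg0 : tg != 0 := ord_neq0 hC ordtg.
Let g0 : g != 0 := expf_neq0 n tg0.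

Section OneFunctional.
Context (j : nat) (u : int -> K) (phi : int -> int -> K).
Context (u_init : forall k, (k <= 2 * n)%N -> good j%:Z k%:Z (u k%:Z)).
Context (u_rec : forall a : int,
  row_rec n g t a (u a) (u (a + 1)) (u (a + n%:Z + 1)) (u (a + (2 * n)%:Z + 1))).
Context (phi_row : forall a, phi a 0 = u a).
Context (phi_up : forall a b,
  phi a (b + 1) = n%:R * phi (a + n%:Z) b + (a - b)%:~R / g * phi a b).
Context (phi_down : forall a b, t * phi a (b - 1)
  = n%:R * phi (a + 1 + n%:Z) b + (a + 1)%:~R / g * phi (a + 1) b).

(** The recurrence is solved for its top value, n being a unit. Each division by [g] costs weight n,
    which is exactly the gap n or 2n between the index of the term and [a]. *)
Lemma good_row_nat (a : nat) : good j%:Z a%:Z (u a%:Z).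
Proof.
elim/ltn_ind: a => a IH; have [|ha] := leqP a (2 * n); first exact: u_init.
have [b Eb] : exists b, a = (b + (2 * n).+1)%N by exists (a - (2 * n).+1)%N; lia.
have := u_rec b%:Z; rewrite /row_rec.
have -> : b%:Z + (2 * n)%:Z + 1 = a%:Z by lia.
have -> : b%:Z + 1 = (b + 1)%N by lia.
have -> : b%:Z + n%:Z + 1 = (b + n + 1)%N by lia.
move=> h; have -> : u a%:Z = n%:R^-1 * (n%:R^-1 * (t * u b%:Z
    - n%:R * ((2 * b%:Z + n%:Z + 2)%:~R * (u (b + n + 1)%N / g))
    - (b + 1)%:R * ((b + 1)%:R * (u (b + 1)%N / g / g)))).
  rewrite -h; field; by rewrite ?tg0 ?g0 ?n0.
apply: goodZ ge0nV _; apply: goodZ ge0nV _; apply: goodD; first apply: goodD.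
- by apply: goodZ ge0t _; apply: goodW (IH b _); lia.
- apply: goodN; apply: goodZ; first exact: (ge_nat hC).
  apply: goodZ; first exact: (ge_int hC).
  by apply: good_div (IH (b + n + 1)%N _); lia.
- apply: goodN; apply: goodZ; first exact: (ge_nat hC).
  apply: goodZ; first exact: (ge_nat hC).
  have h1 : (b + 1 < a)%N by lia.
  by apply: (@good_div _ (b + 1 + n)%N%:Z); [lia | apply: good_div (IH (b + 1)%N h1); lia].
Qed.

Lemma good_row (a : int) : good j%:Z (nomega n a 0) (u a).
Proof.
case: a => k; first by rewrite nomega_nat //; exact: good_row_nat.
rewrite NegzE; elim/ltn_ind: k => k IH.
have {}IH (i : int) : - k%:Z <= i -> good j%:Z (nomega n i 0) (u i).
  case: i => i; first by rewrite nomega_nat //; move=> _; exact: good_row_nat.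
  by rewrite NegzE => hi; apply: IH; lia.
have := u_rec (- k.+1%:Z); rewrite /row_rec.
set a := - k.+1%:Z => h.
have -> : u a = t^-1 * (n%:R * (n%:R * u (a + (2 * n)%:Z + 1))
  + n%:R * ((2 * a + n%:Z + 2)%:~R * (u (a + n%:Z + 1) / g))
  + (a + 1)%:~R * ((a + 1)%:~R * (u (a + 1) / g / g))).
  apply: (mulfI t0); rewrite -h; field; by rewrite ?t0 ?tg0 ?g0.
have ea : a = - k.+1%:Z by [].
have na (i : int) : nomega n i 0 = i \/ nomega n i 0 = - (2 * n%:Z) * i /\ i < 0.
  case: i => i; first by left; rewrite nomega_nat.
  by right; rewrite NegzE nomega_neg // mulNr mulrN opprK.
have nk : nomega n a 0 = 2 * n%:Z * k.+1%:Z by rewrite nomega_neg.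
apply: goodZ ge0tV _; apply: goodD; first apply: goodD.
- do 2 (apply: goodZ; first exact: (ge_nat hC)).
  apply: goodW (IH _ _); last by lia.
  by rewrite nk; case: (na (a + (2 * n)%:Z + 1)) => [->|[-> _]]; nia.
- apply: goodZ; first exact: (ge_nat hC).
  apply: goodZ; first exact: (ge_int hC).
  apply: good_div (IH _ _); last by lia.
  by rewrite nk; case: (na (a + n%:Z + 1)) => [->|[-> _]]; nia.
- do 2 (apply: goodZ; first exact: (ge_int hC)).
  apply: (@good_div _ (nomega n (a + 1) 0 + n%:Z)).
    by rewrite nk (_ : a + 1 = - k%:Z) ?nomega_neg //; lia.
  by apply: good_div (IH _ _); lia.
Qed.

Lemma good_phi a b : good j%:Z (nomega n a b) (phi a b).
Proof.
have hnat (k : nat) c : good j%:Z (nomega n c k%:Z) (phi c k%:Z).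
  elim: k c => [|k IH] c; first by rewrite phi_row; exact: good_row.
  have -> : k.+1%:Z = k%:Z + 1 by lia.
  rewrite phi_up; apply: goodD.
    apply: goodZ; first exact: (ge_nat hC).
    by apply: goodW (IH _); rewrite nomega_up // nomega_right.
  rewrite -mulrA [_^-1 * _]mulrC; apply: goodZ; first exact: (ge_int hC).
  by apply: good_div (IH _); rewrite nomega_up.
case: b => k //; rewrite NegzE.
have -> : - k.+1%:Z = - k%:Z - 1 by lia.
suff h c (i : nat) : good j%:Z (nomega n c (- i%:Z)) (phi c (- i%:Z)).
  by have -> : - k%:Z - 1 = - k.+1%:Z by lia; exact: h.
elim: i c => [|i IH] c; first by rewrite oppr0; exact: hnat 0%N c.
have -> : - i.+1%:Z = - i%:Z - 1 by lia.
have le0 : - i%:Z <= 0 by lia.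
have -> : phi c (- i%:Z - 1) = t^-1 * (n%:R * phi (c + 1 + n%:Z) (- i%:Z)
    + (c + 1)%:~R * (phi (c + 1) (- i%:Z) / g)).
  by apply: (mulfI t0); rewrite phi_down mulVKf // -mulrA [_^-1 * _]mulrC.
apply: goodZ ge0tV _; apply: goodD.
  apply: goodZ; first exact: (ge_nat hC).
  apply: goodW (IH _); apply: le_trans (nomega_down n_gt0 c le0).
  exact: nomega_right.
apply: goodZ; first exact: (ge_int hC).
by apply: good_div (IH _); exact: nomega_down.
Qed.

End OneFunctional.

Lemma dual_functional (j : nat) : exists phi : int -> int -> K,
  [/\ forall a b, a%:~R * phi a b + g * (n%:R * phi (a + n%:Z) b)
        = g * (t * phi (a - 1) (b - 1)),
      forall a b, b%:~R * phi a b + g * phi a (b + 1) = g * (t * phi (a - 1) (b - 1)),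
      forall a b, good j%:Z (nomega n a b) (phi a b)
    & forall k, (k <= 2 * n)%N ->
        tg ^+ k * (if (k <= n)%N then phi k%:Z 0 else phi (k%:Z - n%:Z) 1) = (k == j)%:R].
Proof.
(* For k > n the basis element is x^(k-n) y, and phi(k-n, 1) = n u(k) + (k-n) u(k-n) / g. Duality
   prescribes this value; solving for u(k) gives the second case. *)
pose d (k : nat) : K := if (k <= n)%N then (k == j)%:R
  else ((k == j)%:R - (k - n)%N%:R * (k - n == j)%N%:R) / n%:R.
have [u [u_init u_rec]] := row_exists n0 g0 t0 (fun k => tg ^- k * d k).
have [phi [phi_row phi_up phi_down]] := functional_exists n0 g0 t0 u_rec.
exists phi; split.
- move=> a b; have := phi_down (a - 1) b; rewrite subrK => ->.
  by field; rewrite ?tg0 ?g0.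
- move=> a b; have := phi_down (a - 1) b; rewrite subrK phi_up => ->.
  by rewrite rmorphB /=; field; rewrite ?tg0 ?g0.
- apply: good_phi u_rec phi_row phi_up phi_down => k hk; rewrite u_init //.
  split.
    apply: (@geW _ ord (- (rho * k%:R) + 0)).
      by rewrite addr0 mulNr mulrC.
    apply: (geM hC); first exact/ge_ord/(ordV hC)/(ordX hC)/ordtg.
    rewrite /d; case: ifP => _; first exact: (ge_nat hC).
    rewrite mulrC; apply: (ge0M hC) ge0nV _; apply: (geB hC); first exact: (ge_nat hC).
    by apply: (ge0M hC); exact: (ge_nat hC).
  move=> kj; rewrite /d; case: ifP => kn.
    have -> : (k == j) = false by lia.
    by rewrite mulr0.
  have -> : (k == j) = false by lia.
  have -> : (k - n == j)%N = false by lia.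
  by rewrite mulr0 subr0 mul0r mulr0.
move=> k hk; case: ifP => kn.
  by rewrite phi_row u_init // /d kn mulVKf // expf_neq0.
have -> : k%:Z - n%:Z = (k - n)%N%:Z by lia.
have := phi_up (k - n)%N%:Z 0; rewrite add0r => ->.
rewrite !phi_row -PoszD subnK; last by lia.
rewrite u_init // u_init; last by lia.
rewrite /d kn (_ : (k - n <= n)%N); last by lia.
rewrite subr0; have -> : tg ^+ k = tg ^+ (k - n) * tg ^+ n by rewrite -exprD subnK //; lia.
rewrite invfM; field.
by rewrite ?n0 ?expf_neq0 ?tg0.
Qed.

End Functional.

Lemma rat_bound (M : rat) : exists N : nat, M <= N%:R.
Proof. by exists (Num.trunc M).+1; apply/ltW/truncnS_gt. Qed.

Lemma finite_box (N : nat) : exists B : {fset int * int},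
  forall a b, `|a| <= N%:Z -> `|b| <= N%:Z -> (a, b) \in B.
Proof.
pose s : seq int := [seq i%:Z - N%:Z | i <- iota 0 (2 * N).+1].
have hs (a : int) : `|a| <= N%:Z -> a \in s.
  move=> ha; apply/mapP; exists (absz (a + N%:Z)); last by lia.
  by rewrite mem_iota; lia.
exists (seq_fset tt [seq (a, b) | a <- s, b <- s]) => a b /hs ha /hs hb.
by rewrite seq_fsetE; apply/allpairsP; exists (a, b).
Qed.

Lemma sum_fset_delta (V : zmodType) (I : choiceType) (Q : {fset I}) (z0 : I) (F : I -> V) :
  z0 \in Q -> (forall z, z != z0 -> F z = 0) -> \sum_(z <- Q) F z = F z0.
Proof.
move=> z0Q h; rewrite (big_fsetD1 z0) //= big1_seq ?addr0 // => z /=.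
by rewrite !inE => /andP[/h].
Qed.

(** Moves a shift of exponents from the truncated series onto the functional; nothing is lost at the
    boundary because [Q] contains the shifted box. *)
Lemma sum_fset_shift (R : pzRingType) (I : choiceType) (B Q : {fset I}) (f g : I -> I)
    (xi H : I -> R) : cancel f g -> cancel g f -> (forall s, s \in B -> g s \in Q) ->
  \sum_(z <- Q) (if f z \in B then xi (f z) else 0) * H z
  = \sum_(s <- B) xi s * H (g s).
Proof.
move=> fg gf hQ.
transitivity (\sum_(z <- (g @` B)%fset) xi (f z) * H z); last first.
  rewrite big_imfset /=; last by move=> x y _ _; exact: (can_inj gf).
  by apply: eq_bigr => s _; rewrite gf.
rewrite -(@big_fset_incl _ _ _ _ (g @` B)%fset) /=.
- apply: eq_big_seq => z /imfsetP[s /= sB ->].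
  by rewrite gf sB.
- by apply/fsubsetP => z /imfsetP[s /= sB ->]; exact: hQ.
- move=> z _ hz; case: ifP => [fB|]; last by rewrite mul0r.
  by case/imfsetP: hz; exists (f z).
Qed.

(** * Coordinates modulo the images of Dx and Dy *)

Section Coordinates.
Context (K : closedFieldType) (ord : K -> \bar rat) (p : nat).
Context (pr : prime p).
Context (hC : is_Cp ord p).
Context (n : nat) (t tg : K) (rho : rat) (sigma : K -> K).
Context (n_gt0 : (0 < n)%N).
Context (p_ge3 : (3 <= p)%N) (hrho : rho * n%:R * (p%:R - 1) = 1).
Context (ordtg : ord tg = rho%:E).
Notation ge := (vge ord).
Notation g := (tg ^+ n).
Context (gsum : is_psum ord (fun k : nat => g ^+ (p ^ k) / p%:R ^+ k) 0).
Context (ge_sigma : forall i, ge 0 (iter i sigma t)).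

Let q := rho * n%:R.
Let qP : q * (p%:R - 1) = 1 := hrho.

Let p1_gt0 : 0 < p%:R - 1 :> rat.
Proof. by rewrite subr_gt0 ltr1n; lia. Qed.

Let q_gt0 : 0 < q.
Proof. by rewrite -(pmulr_lgt0 _ p1_gt0) qP. Qed.

Lemma rho_gt0 : 0 < rho.
Proof. by have := q_gt0; rewrite /q pmulr_lgt0 // ltr0n. Qed.

Let ordg : ord g = q%:E.
Proof. exact: (ordX hC). Qed.

Let qS i : q * (p ^ i.+1)%:R = q * (p ^ i)%:R + (p ^ i)%:R.
Proof.
have -> : q * (p ^ i.+1)%:R = q * (p ^ i)%:R + q * (p%:R - 1) * (p ^ i)%:R.
  by rewrite expnS natrM; ring.
by rewrite qP mul1r.
Qed.

Let ge_gamma_term k : ge (q * (p ^ k)%:R - k%:R) (g ^+ (p ^ k) / p%:R ^+ k).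
Proof.
apply: (geM hC); first exact/ge_ord/(ordX hC).
by apply/ge_ord; have := ordV hC (ordX hC k (ord_p hC)); rewrite mul1r.
Qed.

(** The full series sums to 0, so its partial sum is minus a tail, and the bounds q p^k - k for the
    terms do not decrease with k. *)
Lemma ge_gamma_ i : ge (q * (p ^ i.+1)%:R - i.+1%:R) (gamma_ p g i).
Proof.
have -> : gamma_ p g i = - (0 - gamma_ p g i) by rewrite sub0r opprK.
apply: (geN hC); apply: (is_psum_tail hC gsum) => k.
elim: k => // k IH; rewrite leq_eqVlt => /orP[/eqP <-|]; first exact: ge_gamma_term.
move=> ik; apply: geW (ge_gamma_term k.+1).
have {IH ik} : q * (p ^ i.+1)%:R - i.+1%:R <= q * (p ^ k)%:R - k%:R.
  move: ik; rewrite ltnS; elim: k {IH} => // k IH.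
  rewrite leq_eqVlt => /orP[/eqP ->//|]; rewrite ltnS => /IH h; apply: le_trans h _.
  rewrite qS -natr1; have : 1 <= (p ^ k)%:R :> rat by rewrite ler1n expn_gt0; lia.
  lra.
rewrite [q * (p ^ k.+1)%:R]qS -[k.+1%:R]natr1.
have : 1 <= (p ^ k)%:R :> rat by rewrite ler1n expn_gt0; lia.
lra.
Qed.

Lemma ge_gamma_p i : ge (q * (p ^ i)%:R + (p ^ i)%:R - 1) (gamma_ p g i * p%:R ^+ i).
Proof.
have := geM hC (ge_gamma_ i) (ge_ord (ordX hC i (ord_p hC))).
by rewrite qS -natr1 mul1r; congr (vge _ _ _); ring.
Qed.

(* Lowering the weight by [p^i] costs [p^i / (p-1)] while the coefficient gains
   [p^(i+1) / (p-1) - 1], so only the term [i = 0] survives modulo [p^2]. *)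
Lemma psum_gamma (F : nat -> K) v : (forall i, ge 0 (F i)) ->
  (forall i, ge (v - q * (p ^ i)%:R) (F i)) ->
  ge (v + 2) (psum ord (fun i => gamma_ p g i * p%:R ^+ i * F i) - g * F 0%N).
Proof.
move=> F0 Fv.
have pi i : (i < p ^ i)%N by apply: ltn_expl; lia.
have nf : null ord (fun i => gamma_ p g i * p%:R ^+ i * F i).
  move=> M; have [N hN] := rat_bound M; exists N => i Ni.
  rewrite -[M]addr0; apply: (geM hC) => //; apply: geW (ge_gamma_p i).
  have h1 : i.+1%:R <= (p ^ i)%:R :> rat by rewrite ler_nat.
  have h2 : N%:R <= i%:R :> rat by rewrite ler_nat.
  have h3 : 0 <= q * (p ^ i)%:R by rewrite mulr_ge0 // ltW.
  by move: h1; rewrite -natr1; lra.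
have [s hs] := nsum_ex hC nf; rewrite (nsum_psum hC hs).
have := nsum_tail (N := 1) (M := v + 2) hC hs; rewrite big_ord1 expr0 mulr1.
rewrite /gamma_ big_ord1 expn0 expr1 expr0 divr1; apply.
move=> i i1; have -> : v + 2 = (q * (p ^ i)%:R + 2) + (v - q * (p ^ i)%:R) by ring.
apply: (geM hC) => //; apply: geW (ge_gamma_p i).
(* The gain of p^i - 1 must reach the required 2; this is the place where p >= 3 enters. *)
have : 3%:R <= (p ^ i)%:R :> rat.
  by rewrite ler_nat; case: i i1 => // i _; rewrite expnS; have := pi i; nia.
by lra.
Qed.

(** What the pairing needs of a series in C0. The extra 2 outside a region of bounded weight, hence
    outside a finite box, is the working precision p^2. *)
Definition decaying (xi : ls K) : Prop :=
  (forall a b, ge ((nomega n a b)%:~R * rho) (xi a b)) /\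
  exists N : nat, forall a b, N%:Z <= nomega n a b ->
    ge ((nomega n a b)%:~R * rho + 2) (xi a b).

Lemma C0_decaying (L : set K) xi : C0 ord n L tg xi -> decaying xi.
Proof.
move=> [x [x0 xW xE]].
have gx a b : ge 0 (x a b).
  have : (smallest (fun E : set K => subring_closed (mem E))
    (integers_of ord L `|` [set tg]) `<=` [set y | ge 0 y])%classic.
    apply: smallest_sub.
      split; rewrite ?inE; first exact: (ge1 hC).
        by move=> y z; rewrite !inE; exact: (geB hC).
      by move=> y z; rewrite !inE; exact: (ge0M hC).
    move=> y [[_ //]|->] /=; apply: geW (ge_ord ordtg); exact/ltW/rho_gt0.
  by apply; exact: x0.
have gt a b : ge ((nomega n a b)%:~R * rho) (tg ^ nomega n a b).
  by rewrite mulrC; apply/ge_ord/(ordXz hC).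
split; first by move=> a b; rewrite xE; apply: (ge0M hC).
have [W hW] := xW 2; have [N hN] := rat_bound (n%:R * W); exists N => a b hab.
rewrite xE addrC; apply: (geM hC) => //; apply: hW.
have n0 : 0 < n%:R :> rat by rewrite ltr0n.
rewrite -(ler_pM2l n0); apply: le_trans hN _.
by rewrite -[n%:R]/(n%:Q) -nomegaE // -[N%:R]/(N%:Z%:~R) ler_int.
Qed.

Let geW_nu v w y : v <= w -> ge (w%:~R * rho) y -> ge (v%:~R * rho) y.
Proof. by move=> vw; apply: geW; rewrite ler_pM2r ?ler_int // rho_gt0. Qed.

Let nuB (v k : int) (i : nat) : k = n%:Z * (p ^ i)%:Z ->
  v%:~R * rho - q * (p ^ i)%:R = (v - k)%:~R * rho.
Proof. by move=> ->; rewrite /q rmorphB rmorphM /=; ring. Qed.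

Definition Dx0 (xi : ls K) : ls K := fun a b =>
  a%:~R * xi a b + g * (n%:R * xi (a - n%:Z) b - t * xi (a + 1) (b + 1)).

Definition Dy0 (xi : ls K) : ls K := fun a b =>
  b%:~R * xi a b + g * (xi a (b - 1) - t * xi (a + 1) (b + 1)).

Lemma Dx_mod xi : (forall a b, ge ((nomega n a b)%:~R * rho) (xi a b)) ->
  forall a b, ge ((nomega n a b)%:~R * rho + 2)
    (Dx ord n p g t sigma xi a b - Dx0 xi a b).
Proof.
move=> hxi a b; rewrite /Dx /Dx0 opprD addrACA subrr add0r.
have xi0 c d : ge 0 (xi c d).
  apply: geW (hxi c d); rewrite mulr_ge0 ?ler0z ?nomega_ge0 //; exact/ltW/rho_gt0.
have := @psum_gamma (fun i => n%:R * xi (a - (n * p ^ i)%:Z) b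
       - iter i sigma t * xi (a + (p ^ i)%:Z) (b + (p ^ i)%:Z)) ((nomega n a b)%:~R * rho).
rewrite muln1; apply => i.
  by apply: (geB hC); apply: (ge0M hC) => //; exact: (ge_nat hC).
rewrite (nuB _ (erefl _)); apply: (geB hC); apply: (ge0M hC) => //.
- exact: (ge_nat hC).
- apply: geW_nu (hxi _ _); have := nomega_right n_gt0 (a - (n * p ^ i)%:Z) b (k := (n * p ^ i)%:Z).
  by rewrite subrK; lia.
- apply: geW_nu (hxi _ _); have := nomega_diag n_gt0 a b (p ^ i).
  by lia.
Qed.

Lemma Dy_mod xi : (forall a b, ge ((nomega n a b)%:~R * rho) (xi a b)) ->
  forall a b, ge ((nomega n a b)%:~R * rho + 2)
    (Dy ord p g t sigma xi a b - Dy0 xi a b).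
Proof.
move=> hxi a b; rewrite /Dy /Dy0 opprD addrACA subrr add0r.
have xi0 c d : ge 0 (xi c d).
  apply: geW (hxi c d); rewrite mulr_ge0 ?ler0z ?nomega_ge0 //; exact/ltW/rho_gt0.
have := @psum_gamma (fun i => xi a (b - (p ^ i)%:Z)
       - iter i sigma t * xi (a + (p ^ i)%:Z) (b + (p ^ i)%:Z)) ((nomega n a b)%:~R * rho).
apply => i.
  by apply: (geB hC) => //; apply: (ge0M hC).
rewrite (nuB _ (erefl _)); apply: (geB hC).
- apply: geW_nu (hxi _ _); have := nomegaD n_gt0 a (b - (p ^ i)%:Z) 0 (p ^ i)%:Z.
  rewrite subrK addr0.
  have -> : nomega n 0 (p ^ i)%:Z = n%:Z * (p ^ i)%:Z by rewrite /nomega; nia.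
  by lia.
- apply: (ge0M hC) => //.
  apply: geW_nu (hxi _ _); have := nomega_diag n_gt0 a b (p ^ i).
  by lia.
Qed.

Let diag1 a b : nomega n a b <= nomega n (a + 1) (b + 1) + n%:Z.
Proof. by rewrite -[n%:Z]mulr1; exact: (nomega_diag n_gt0 a b 1). Qed.

Lemma Dx0_ge v xi : (forall a b, ge ((nomega n a b)%:~R * rho + v) (xi a b)) ->
  forall a b, ge ((nomega n a b)%:~R * rho + v) (Dx0 xi a b).
Proof.
move=> hxi a b; have ht : ge 0 t by exact: (ge_sigma 0).
have e c : (nomega n a b)%:~R * rho + v
    = c%:~R * 0 + q + ((nomega n a b)%:~R * rho - q * (p ^ 0)%:R + v).
  by rewrite expn0; ring.
apply: (geD hC); first by apply: (ge0M hC) => //; exact: (ge_int hC).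
rewrite (e 0) mulr0 add0r; apply: (geM hC); first exact: ge_ord.
rewrite (nuB _ (erefl _)) expn0 mulr1; apply: (geB hC); apply: (ge0M hC) => //.
- exact: (ge_nat hC).
- apply: geW (hxi _ _); rewrite lerD2r ler_pM2r ?rho_gt0 // ler_int.
  by have := nomega_right n_gt0 (a - n%:Z) b (k := n%:Z); rewrite subrK; lia.
- apply: geW (hxi _ _); rewrite lerD2r ler_pM2r ?rho_gt0 // ler_int.
  by have := diag1 a b; lia.
Qed.

Lemma Dy0_ge v xi : (forall a b, ge ((nomega n a b)%:~R * rho + v) (xi a b)) ->
  forall a b, ge ((nomega n a b)%:~R * rho + v) (Dy0 xi a b).
Proof.
move=> hxi a b; have ht : ge 0 t by exact: (ge_sigma 0).
have e : (nomega n a b)%:~R * rho + v = q + ((nomega n a b)%:~R * rho - q * (p ^ 0)%:R + v).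
  by rewrite expn0; ring.
apply: (geD hC); first by apply: (ge0M hC) => //; exact: (ge_int hC).
rewrite e; apply: (geM hC); first exact: ge_ord.
rewrite (nuB _ (erefl _)) expn0 mulr1; apply: (geB hC).
- apply: geW (hxi _ _); rewrite lerD2r ler_pM2r ?rho_gt0 // ler_int.
  have := nomegaD n_gt0 a (b - 1) 0 1; rewrite subrK addr0.
  have -> : nomega n 0 1 = n%:Z by rewrite /nomega; lia.
  by lia.
- apply: (ge0M hC) => //; apply: geW (hxi _ _); rewrite lerD2r ler_pM2r ?rho_gt0 // ler_int.
  by have := diag1 a b; lia.
Qed.

Section Pairing.
Context (j : nat) (phi : int -> int -> K).
Context (phi_x : forall a b, a%:~R * phi a b + g * (n%:R * phi (a + n%:Z) b)
  = g * (t * phi (a - 1) (b - 1))).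
Context (phi_y : forall a b, b%:~R * phi a b + g * phi a (b + 1)
  = g * (t * phi (a - 1) (b - 1))).
Context (phi_good : forall a b, good ord rho j%:Z (nomega n a b) (phi a b)).
Context (phi_dual : forall k, (k <= 2 * n)%N ->
  tg ^+ k * (if (k <= n)%N then phi k%:Z 0 else phi (k%:Z - n%:Z) 1) = (k == j)%:R).

Definition truncate (B : {fset int * int}) (xi : ls K) : ls K :=
  fun a b => if (a, b) \in B then xi a b else 0.

Let move_right (z : int * int) : int * int := (z.1 + n%:Z, z.2).
Let move_left (z : int * int) : int * int := (z.1 - n%:Z, z.2).
Let move_up (z : int * int) : int * int := (z.1, z.2 + 1).
Let move_down (z : int * int) : int * int := (z.1, z.2 - 1).
Let diag_up (z : int * int) : int * int := (z.1 + 1, z.2 + 1).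
Let diag_down (z : int * int) : int * int := (z.1 - 1, z.2 - 1).

Let leftK : cancel move_left move_right.
Proof. by case=> a b; rewrite /move_left /move_right /= subrK. Qed.
Let rightK : cancel move_right move_left.
Proof. by case=> a b; rewrite /move_left /move_right /= addrK. Qed.
Let upK : cancel move_up move_down.
Proof. by case=> a b; rewrite /move_up /move_down /= addrK. Qed.
Let downK : cancel move_down move_up.
Proof. by case=> a b; rewrite /move_up /move_down /= subrK. Qed.
Let diag_upK : cancel diag_up diag_down.
Proof. by case=> a b; rewrite /diag_up /diag_down /= !addrK. Qed.
Let diag_downK : cancel diag_down diag_up.
Proof. by case=> a b; rewrite /diag_up /diag_down /= !subrK. Qed.

Lemma pairing_Dx0 (B Q : {fset int * int}) xi :
  (forall z, z \in B -> [/\ z \in Q, move_right z \in Q & diag_down z \in Q]) ->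
  \sum_(z <- Q) Dx0 (truncate B xi) z.1 z.2 * phi z.1 z.2 = 0.
Proof.
move=> hQ; pose x (z : int * int) := xi z.1 z.2.
have s1 := @sum_fset_shift K _ B Q id id x (fun z => z.1%:~R * phi z.1 z.2)
  (fun _ => erefl) (fun _ => erefl) (fun z zB => let: And3 h _ _ := hQ z zB in h).
have s2 := @sum_fset_shift K _ B Q _ _ x (fun z => g * (n%:R * phi z.1 z.2))
  leftK rightK (fun z zB => let: And3 _ h _ := hQ z zB in h).
have s3 := @sum_fset_shift K _ B Q _ _ x (fun z => g * (t * phi z.1 z.2))
  diag_upK diag_downK (fun z zB => let: And3 _ _ h := hQ z zB in h).
transitivity (\sum_(s <- B) x s * (s.1%:~R * phi s.1 s.2)
  + \sum_(s <- B) x s * (g * (n%:R * phi (s.1 + n%:Z) s.2))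
  - \sum_(s <- B) x s * (g * (t * phi (s.1 - 1) (s.2 - 1)))).
  rewrite -s1 -s2 -s3 -sumrN -!big_split /=; apply: eq_bigr => -[a b] _ /=.
  by rewrite /Dx0 /truncate /x /move_left /diag_up /=; do 3 case: ifP => _; ring.
rewrite -sumrN -!big_split big1 //= => -[a b] _ /=.
by rewrite -mulrDr phi_x subrr.
Qed.

Lemma pairing_Dy0 (B Q : {fset int * int}) xi :
  (forall z, z \in B -> [/\ z \in Q, move_up z \in Q & diag_down z \in Q]) ->
  \sum_(z <- Q) Dy0 (truncate B xi) z.1 z.2 * phi z.1 z.2 = 0.
Proof.
move=> hQ; pose x (z : int * int) := xi z.1 z.2.
have s1 := @sum_fset_shift K _ B Q id id x (fun z => z.2%:~R * phi z.1 z.2)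
  (fun _ => erefl) (fun _ => erefl) (fun z zB => let: And3 h _ _ := hQ z zB in h).
have s2 := @sum_fset_shift K _ B Q _ _ x (fun z => g * phi z.1 z.2)
  downK upK (fun z zB => let: And3 _ h _ := hQ z zB in h).
have s3 := @sum_fset_shift K _ B Q _ _ x (fun z => g * (t * phi z.1 z.2))
  diag_upK diag_downK (fun z zB => let: And3 _ _ h := hQ z zB in h).
transitivity (\sum_(s <- B) x s * (s.2%:~R * phi s.1 s.2)
  + \sum_(s <- B) x s * (g * phi s.1 (s.2 + 1))
  - \sum_(s <- B) x s * (g * (t * phi (s.1 - 1) (s.2 - 1)))).
  rewrite -s1 -s2 -s3 -sumrN -!big_split /=; apply: eq_bigr => -[a b] _ /=.
  by rewrite /Dy0 /truncate /x /move_down /diag_up /=; do 3 case: ifP => _; ring.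
rewrite -sumrN -!big_split big1 //= => -[a b] _ /=.
by rewrite -mulrDr phi_y subrr.
Qed.

Let ge_phi v a b y : ge ((nomega n a b)%:~R * rho + v) y -> ge v (y * phi a b).
Proof.
move=> hy; have -> : v = ((nomega n a b)%:~R * rho + v) + - (nomega n a b)%:~R * rho by ring.
by apply: (geM hC) => //; case: (phi_good a b).
Qed.

Let tail_ge (N : nat) (B : {fset int * int}) xi :
  (forall a b, `|a| <= N%:Z -> `|b| <= N%:Z -> (a, b) \in B) ->
  (forall a b, N%:Z <= nomega n a b -> ge ((nomega n a b)%:~R * rho + 2) (xi a b)) ->
  forall a b, ge ((nomega n a b)%:~R * rho + 2) (xi a b - truncate B xi a b).
Proof.
move=> hB hN a b; rewrite /truncate; case: ifP => [_|h]; first by rewrite subrr; exact: (ge0 hC).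
rewrite subr0; apply: hN; rewrite leNgt; apply/negP => hlt.
by have [h1 h2] := nomega_absz n_gt0 a b; rewrite hB // in h; lia.
Qed.

(** On truncated series [phi] kills the images of [Dx0] and [Dy0] exactly. The errors from
    truncating and from passing to [Dx0] and [Dy0] exceed the weight bound by 2, and [phi] costs at
    most the weight. The point (j, 0) is put in [Q] because its term later becomes the leading part
    of the entry. *)
Lemma coordinate (c : 'I_(2 * n + 1) -> K) (G xi eta : ls K) (j0 : 'I_(2 * n + 1)) :
  j0 = j :> nat -> decaying xi -> decaying eta ->
  (forall a b, G a b = \sum_i c i * teps n tg i a b
     + ls_add (Dx ord n p g t sigma xi) (Dy ord p g t sigma eta) a b) ->
  exists Q : {fset int * int}, (j%:Z, 0) \in Q /\
    ge 2 (c j0 - \sum_(z <- Q) G z.1 z.2 * phi z.1 z.2).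
Proof.
move=> j0j [xi1 [N1 xi2]] [eta1 [N2 eta2]] hG.
pose N := (N1 + N2 + 2 * n + 1)%N.
have [B hB] := finite_box N.
pose Q := (B `|` move_right @` B `|` move_up @` B `|` diag_down @` B)%fset.
have BQ z : z \in B -> z \in Q by move=> zB; rewrite !inE zB.
have RQ z : z \in B -> move_right z \in Q.
  by move=> zB; rewrite !inE (in_imfset _ move_right zB) orbT.
have UQ z : z \in B -> move_up z \in Q.
  by move=> zB; rewrite !inE (in_imfset _ move_up zB) orbT.
have DQ z : z \in B -> diag_down z \in Q.
  by move=> zB; rewrite !inE (in_imfset _ diag_down zB) orbT.
have jn : (j <= 2 * n)%N by have := ltn_ord j0; lia.
exists Q; split; first by apply/BQ/hB; rewrite /N; lia.
have eps_sum (i : 'I_(2 * n + 1)) :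
    \sum_(z <- Q) teps n tg i z.1 z.2 * phi z.1 z.2 = ((i : nat) == j)%:R.
  have hi : (i <= 2 * n)%N by have := ltn_ord i; lia.
  rewrite -(phi_dual hi) /teps /eps; case: ifP => hin.
    rewrite (@sum_fset_delta _ _ _ (i%:Z, 0)) /= ?eqxx ?mulr1 //.
      by apply/BQ/hB; rewrite /N; lia.
    by case=> a b; rewrite xpair_eqE => /negbTE -> ; rewrite mulr0 mul0r.
  rewrite (@sum_fset_delta _ _ _ (i%:Z - n%:Z, 1)) /= ?eqxx ?mulr1 //.
    by apply/BQ/hB; rewrite /N; lia.
  by case=> a b; rewrite xpair_eqE => /negbTE -> ; rewrite mulr0 mul0r.
pose R a b := Dx ord n p g t sigma xi a b - Dx0 (truncate B xi) a b
  + (Dy ord p g t sigma eta a b - Dy0 (truncate B eta) a b).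
have R_ge a b : ge ((nomega n a b)%:~R * rho + 2) (R a b).
  have hN1 c0 d : N%:Z <= nomega n c0 d -> N1%:Z <= nomega n c0 d by rewrite /N; lia.
  have hN2 c0 d : N%:Z <= nomega n c0 d -> N2%:Z <= nomega n c0 d by rewrite /N; lia.
  apply: (geD hC).
    have -> : Dx ord n p g t sigma xi a b - Dx0 (truncate B xi) a b
      = (Dx ord n p g t sigma xi a b - Dx0 xi a b)
        + Dx0 (fun a b => xi a b - truncate B xi a b) a b by rewrite /Dx0; ring.
    apply: (geD hC); first exact: Dx_mod.
    by apply: Dx0_ge; apply: (tail_ge hB) => c0 d /hN1; exact: xi2.
  have -> : Dy ord p g t sigma eta a b - Dy0 (truncate B eta) a b
      = (Dy ord p g t sigma eta a b - Dy0 eta a b)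
        + Dy0 (fun a b => eta a b - truncate B eta a b) a b by rewrite /Dy0; ring.
  apply: (geD hC); first exact: Dy_mod.
  by apply: Dy0_ge; apply: (tail_ge hB) => c0 d /hN2; exact: eta2.
have -> : \sum_(z <- Q) G z.1 z.2 * phi z.1 z.2
    = c j0 + \sum_(z <- Q) R z.1 z.2 * phi z.1 z.2.
  transitivity (\sum_(z <- Q) (\sum_i c i * (teps n tg i z.1 z.2 * phi z.1 z.2)
     + R z.1 z.2 * phi z.1 z.2 + Dx0 (truncate B xi) z.1 z.2 * phi z.1 z.2
     + Dy0 (truncate B eta) z.1 z.2 * phi z.1 z.2)).
    apply: eq_bigr => -[a b] _ /=; rewrite hG mulrDl mulr_suml.
    rewrite -!addrA; congr (_ + _).
      by apply: eq_bigr => i _; rewrite mulrA.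
    by rewrite /ls_add /R; ring.
  rewrite !big_split /= pairing_Dx0; last by move=> z zB; split; [exact: BQ|exact: RQ|exact: DQ].
  rewrite pairing_Dy0; last by move=> z zB; split; [exact: BQ|exact: UQ|exact: DQ].
  rewrite !addr0 exchange_big /=; congr (_ + _).
  under eq_bigr do rewrite -mulr_sumr eps_sum.
  rewrite (bigD1 j0) //= j0j eqxx mulr1 big1 ?addr0 // => i ij.
  by rewrite -j0j (inj_eq val_inj) (negbTE ij) mulr0.
rewrite opprD addNKr; apply: (geN hC); apply: (ge_sum hC) => z _; exact: ge_phi.
Qed.

End Pairing.

End Coordinates.

(** Legendre's formula with each floor bounded by l / 2^k; the geometric sum up to k = l leaves l /
    2^l to spare. *)
Lemma logn_fact_lt (p l : nat) : prime p -> (0 < l)%N -> (logn p l`! < l)%N.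
Proof.
move=> pr l0; rewrite logn_fact // -(ltr_nat rat) natr_sum.
have h k : ((l %/ p ^ k)%N%:R <= l%:R / 2 ^+ k :> rat).
  rewrite ler_pdivlMr ?exprn_gt0 // -natrX -natrM ler_nat.
  apply: leq_trans (leq_divM l (p ^ k)); rewrite leq_mul2l.
  by case: k => [|k]; rewrite ?expn0 ?leqnn ?orbT // leq_exp2r // prime_gt1 ?orbT.
have -> : l%:R = l%:R * (2^-1 ^+ l + \sum_(1 <= k < l.+1) 2^-1 ^+ k) :> rat.
  rewrite -[LHS]mulr1; congr (_ * _); elim: {h} l {l0} => [|m IH].
    by rewrite expr0 big_geq // addr0.
  by rewrite big_nat_recr //= {1}IH exprS; field.
rewrite mulrDr -[ltLHS]add0r ltr_leD //; first by rewrite mulr_gt0 ?exprn_gt0 ?ltr0n.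
rewrite mulr_sumr; apply: ler_sum => k _; apply: le_trans (h k) _.
by rewrite exprVn.
Qed.

(** * Formal exponentials through truncated polynomials *)

Section PolyCongruence.
Context (R : nzRingType).

Definition agree (N : nat) (P Q : {poly R}) : Prop :=
  forall i, (i < N)%N -> P`_i = Q`_i.

Lemma agreeM N P P' Q Q' : agree N P P' -> agree N Q Q' -> agree N (P * Q) (P' * Q').
Proof.
move=> hP hQ i iN; rewrite !coefM; apply: eq_bigr => j _.
have ji := ltn_ord j; rewrite hP ?hQ //; first exact: leq_ltn_trans (leq_subr _ _) iN.
exact: leq_trans ji iN.
Qed.

Lemma agree_refl N P : agree N P P.
Proof. by []. Qed.

Lemma coef_exp_small (P : {poly R}) j k : P`_0 = 0 -> (k < j)%N -> (P ^+ j)`_k = 0.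
Proof.
move=> P0; elim: j k => // j IH k kj; rewrite exprS coefM big1 // => -[[|i] hi] _ /=.
  by rewrite P0 mul0r.
by rewrite IH ?mulr0 //; lia.
Qed.

End PolyCongruence.

Section PowerSeriesExp.
Context (K : closedFieldType) (f : nat -> K).
Context (f0 : f 0%N = 0).
Context (char0 : forall k, (k.+1)%:R != 0 :> K).

Let P N : {poly K} := \poly_(i < N) f i.

Lemma ps_pow_poly N j k : (k < N)%N -> ps_pow f j k = (P N ^+ j)`_k.
Proof.
elim: j k => [|j IH] k kN; first by rewrite expr0 coef1.
rewrite /ps_pow iterS -/(ps_pow f j) /ps_mul exprS coefM; apply: eq_bigr => i _.
have ik := ltn_ord i; rewrite coef_poly (leq_ltn_trans _ kN) ?IH //; lia.
Qed.

Let expo N M : {poly K} := \sum_(j < M) (j`!)%:R^-1 *: P N ^+ j.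

Let fact_neq0 k : (k`!)%:R != 0 :> K.
Proof. by have := fact_gt0 k; case: (k`!). Qed.

Let coef_expo N M k : (k < N)%N -> (k < M)%N -> (expo N M)`_k = ps_exp f k.
Proof.
move=> kN kM; rewrite /expo coef_sum /ps_exp.
rewrite -(big_mkord predT (fun j => ((j`!)%:R^-1 *: P N ^+ j)`_k)).
rewrite (big_cat_nat (n := k.+1)) //= [X in _ + X]big_nat_cond [X in _ + X]big1 ?addr0.
  rewrite big_mkord; apply: eq_bigr => j _.
  by rewrite coefZ (ps_pow_poly j kN) mulrC.
move=> j /andP[/andP[kj _] _]; rewrite coefZ coef_exp_small ?mulr0 //.
by rewrite coef_poly; case: ifP.
Qed.

(** Compares coefficients in y' = f' y for y = exp f. Truncating the exponential sum one step
    further on the side that is differentiated makes the equation exact for polynomials. *)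
Lemma ps_exp_rec k : k.+1%:R * ps_exp f k.+1
  = \sum_(d < k.+1) d.+1%:R * f d.+1 * ps_exp f (k - d)%N.
Proof.
pose N := k.+2.
have dE : (expo N N.+1)^`() = (P N)^`() * expo N N.
  rewrite /expo raddf_sum /= big_ord_recl /= expr0 linearZ /= derivC scaler0 add0r.
  rewrite mulr_sumr; apply: eq_bigr => j _; rewrite linearZ /= deriv_exp /=.
  rewrite -scalerAr -scaler_nat scalerA /bump /= add1n factS natrM; congr (_ *: _).
  by field; rewrite fact_neq0 addrC natr1 char0.
have := congr1 (fun Q : {poly K} => Q`_k) dE; rewrite coef_deriv coef_expo //.
rewrite mulr_natl => ->; rewrite coefM; apply: eq_bigr => d _; have dk := ltn_ord d.
rewrite coef_deriv coef_poly coef_expo; try (rewrite /N; lia).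
by rewrite /N ltnS dk mulr_natl.
Qed.

Lemma ps_exp0 : ps_exp f 0 = 1.
Proof. by rewrite /ps_exp big_ord1 /ps_pow /= /ps_one eqxx divr1. Qed.

End PowerSeriesExp.

(** * Integrality of the Artin-Hasse exponential *)

Section ArtinHasse.
Context (K : closedFieldType) (ord : K -> \bar rat) (p : nat).
Context (pr : prime p).
Context (hC : is_Cp ord p).
Notation ge := (vge ord).

Definition is_pow (d : nat) : bool := (d == p ^ logn p d)%N.

Lemma is_pow1 : is_pow 1.
Proof. by rewrite /is_pow logn1. Qed.

Lemma is_powM d : (0 < d)%N -> is_pow (p * d) = is_pow d.
Proof.
move=> d0; rewrite /is_pow lognM ?(prime_gt0 pr) // logn_prime // eqxx expnD expn1.
by rewrite eqn_pmul2l ?prime_gt0.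
Qed.

Lemma is_pow_dvd d : (1 < d)%N -> is_pow d -> (p %| d)%N.
Proof.
move=> d1; rewrite /is_pow; case: (logn p d) => [|e] /eqP Ed; last by rewrite Ed expnS dvdn_mulr.
by rewrite Ed in d1.
Qed.

Lemma is_powP d : reflect (exists k, d = p ^ k)%N (is_pow d).
Proof.
apply: (iffP eqP) => [->|[k ->]]; first by exists (logn p d).
by rewrite pfactorK.
Qed.

Definition rational (c : K) : Prop := exists u v : int, v != 0 /\ c = u%:~R / v%:~R.

Lemma rational_nat k : rational k%:R.
Proof. by exists k%:Z, 1; rewrite divr1. Qed.

Lemma rational_natV k : rational k%:R^-1.
Proof.
case: k => [|k]; first by rewrite invr0; exact: (rational_nat 0).
by exists 1, k.+1%:Z; rewrite mul1r.
Qed.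

Lemma rationalM x y : rational x -> rational y -> rational (x * y).
Proof.
move=> [u [v [v0 ->]]] [u' [v' [v0' ->]]]; exists (u * u'), (v * v').
by rewrite mulf_neq0 // !intrM invfM mulrACA.
Qed.

Lemma rationalD x y : rational x -> rational y -> rational (x + y).
Proof.
move=> [u [v [v0 ->]]] [u' [v' [v0' ->]]]; exists (u * v' + u' * v), (v * v').
rewrite mulf_neq0 // intrD !intrM; split => //.
by field; rewrite !(intK_eq0 pr hC) v0 v0'.
Qed.

Lemma rational_ratr x : rational x -> exists r : rat, x = ratr r.
Proof.
move=> [u [v [v0 ->]]]; exists (u%:Q / v%:Q); rewrite /ratr.
set r := u%:Q / v%:Q.
have e : numq r * v = u * denq r.
  apply: (@intr_inj rat); rewrite !intrM numqE /r.
  by field; rewrite intr_eq0.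
apply/eqP; rewrite eqr_div ?(intK_eq0 pr hC) ?denq_neq0 //.
by rewrite -!intrM -e mulrC.
Qed.

Lemma AH_logE (gam : K) d : d%:R * AH_log p gam d = (is_pow d)%:R * gam ^+ d.
Proof.
rewrite /AH_log; have [/is_powP[k ->]|hd] := boolP (is_pow d).
  have kp : (k < (p ^ k).+1)%N by rewrite ltnS; apply/ltnW/ltn_expl/prime_gt1.
  rewrite (bigD1 (Ordinal kp)) //= big1 ?addr0.
    rewrite natrX mul1r mulrC mulfVK // expf_neq0 //.
    by rewrite (natK_neq0 pr hC) // prime_gt0.
  move=> i /andP[/eqP Ei]; rewrite -(inj_eq val_inj) /=.
  by case/eqP; apply: (@expnI p); [exact: prime_gt1|].
rewrite big1 ?mulr0 ?mul0r // => i /eqP Ed.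
by case/is_powP: hd; exists i.
Qed.

(** For gam nonzero these are the coefficients of the Artin-Hasse exponential exp(sum_k x^(p^k) /
    p^k), which do not depend on gam. *)
Definition ah (gam : K) (k : nat) : K := Theta p gam k / gam ^+ k.

Section Coefficients.
Context (h : nat -> K).
Context (h0 : h 0%N = 1).
Context (h_rec : forall k,
  k.+1%:R * h k.+1 = \sum_(d < k.+1) (is_pow d.+1)%:R * h (k - d)%N).

(** Below p the only power of p is 1, so the recurrence is that of the ordinary exponential. *)
Lemma ah_small k : (k < p)%N -> h k = (k`!)%:R^-1.
Proof.
elim: k => [|k IH] kp; first by rewrite h0 invr1.
have k0 := natK_neq0 pr hC (ltn0Sn k).
apply: (mulfI k0); rewrite h_rec big_ord_recl /= is_pow1 mul1r subn0 IH ?(ltnW kp) //.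
rewrite big1 ?addr0.
  rewrite factS natrM invfM mulVKf //.
move=> i _; rewrite (_ : is_pow _ = false) ?mul0r //; apply/negbTE/negP.
rewrite /bump /= => /is_pow_dvd; have := ltn_ord i; move=> ik.
by rewrite gtnNdvd //; try lia; move=> /(_ isT).
Qed.

Lemma ah_rational k : rational (h k).
Proof.
elim/ltn_ind: k => -[|k] IH; first by rewrite h0; exact: (rational_nat 1).
have k0 := natK_neq0 pr hC (ltn0Sn k).
rewrite -(mulKf k0 (h k.+1)) h_rec; apply: rationalM; first exact: rational_natV.
apply: (big_ind rational) => [||d _]; [exact: (rational_nat 0)|exact: rationalD|].
apply: rationalM; first exact: rational_nat.
by apply: IH; rewrite ltnS leq_subr.
Qed.

Let S N : {poly K} := \poly_(i < N) (is_pow i.+1)%:R.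
Let H N : {poly K} := \poly_(i < N) h i.

Let H_deriv N k : (k < N)%N -> agree k (H N)^`() (S N * H N).
Proof.
move=> kN i ik; rewrite coef_deriv coef_poly (leq_ltn_trans ik kN) -mulr_natl h_rec.
rewrite coefM; apply: eq_bigr => d _; have di := ltn_ord d.
by rewrite !coef_poly (leq_trans di (leq_trans ik (ltnW kN)))
  (leq_ltn_trans _ (ltn_trans ik kN)) ?leq_subr.
Qed.

(* Both sides of [E(x)^p = E(x^p) exp(p x)] solve [y' = p (sum_i x^(p^i - 1)) y]. *)
Let ode_uniq N (P Q : {poly K}) : P`_0 = 1 -> Q`_0 = 1 ->
  agree N P^`() (S N.+1 * P *+ p) -> agree N Q^`() (S N.+1 * Q *+ p) -> agree N.+1 P Q.
Proof.
move=> P0 Q0 hP hQ i; elim/ltn_ind: i => -[|i] IH iN; first by rewrite P0 Q0.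
have i0 := natK_neq0 pr hC (ltn0Sn i).
apply: (mulfI i0); rewrite !mulr_natl -!coef_deriv hP ?hQ //.
rewrite !coefMn !coefM; congr (_ *+ _); apply: eq_bigr => d _.
by rewrite [P`_ _]IH //; lia.
Qed.

Let T N : {poly K} := \poly_(l < N) (p%:R ^+ l / (l`!)%:R).

Let T_deriv N k : (k < N)%N -> agree k (T N)^`() (T N *+ p).
Proof.
move=> kN i ik; rewrite coef_deriv coefMn !coef_poly (leq_ltn_trans ik kN) (ltn_trans ik kN).
have i0 := natK_neq0 pr hC (ltn0Sn i).
have f0 : (i`!)%:R != 0 :> K by apply: (natK_neq0 pr hC); exact: fact_gt0.
by rewrite -[LHS]mulr_natl -[RHS]mulr_natl factS natrM exprS; field; rewrite f0 addrC natr1.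
Qed.

(** [S] truncates sum_k X^(p^k - 1), and p^(k+1) - 1 = (p - 1) + p (p^k - 1); the summand 1 is the
    term k = 0. *)
Let S_rec N k : (k < N)%N -> agree k ('X^(p.-1) * (S N \Po 'X^p) + 1) (S N).
Proof.
have p0 := prime_gt0 pr; have p1 := prime_gt1 pr.
move=> kN i ik; rewrite coefD coefXnM coef1 coef_comp_poly_Xn // !coef_poly (ltn_trans ik kN).
case: i ik => [|i] ik /=.
  by rewrite is_pow1; case: ifP => [_|]; [rewrite add0r | lia].
rewrite addr0; have [/dvdnP[e Ee]|ndvd] := boolP (p %| i.+2)%N.
  have e0 : (0 < e)%N by case: e Ee.
  have -> : (i.+1 < p.-1)%N = false by nia.
  have -> : (i.+1 - p.-1 = e.-1 * p)%N by nia.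
  rewrite dvdn_mull // mulnK //.
  have -> : (e.-1 < N)%N by nia.
  by rewrite Ee prednK // mulnC is_powM.
have -> : is_pow i.+2 = false.
  by apply: contraNF ndvd => /is_pow_dvd; apply.
case: ifP => // hp; case: ifP => // /dvdnP[e Ee]; case/negP: ndvd.
by apply/dvdnP; exists e.+1; nia.
Qed.

Lemma dwork_identity k : (0 < k)%N ->
  ((H k.+1) ^+ p)`_k = ((H k.+1 \Po 'X^p) * T k.+1)`_k.
Proof.
have p0 := prime_gt0 pr.
move=> k0; pose N := k.+1.
have H0 : (H N)`_0 = 1 by rewrite coef_poly /= h0.
have T0 : (T N)`_0 = 1 by rewrite coef_poly /= expr0 fact0 divr1.
apply: (@ode_uniq k _ _ _ _ _ _ k (ltnSn k)); rewrite -/N.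
- by rewrite -!/(coefp 0 _) rmorphXn /= H0 expr1n.
- by rewrite coef0M T0 coef_comp_poly_Xn // dvdn0 div0n H0 mulr1.
- rewrite deriv_exp => i ik; rewrite !coefMn; congr (_ *+ _).
  have -> : H N ^+ p = H N * H N ^+ p.-1 by rewrite -exprS prednK.
  by rewrite mulrA; apply: agreeM (H_deriv (ltnSn k)) (agree_refl _) _ ik.
- set C := _ \Po _; set A : {poly K} := 'X^(p.-1) * (S N \Po 'X^p).
  have hC' : agree k C^`() (A * C *+ p).
    rewrite deriv_comp derivXn => i ik; rewrite mulrnAr !coefMn; congr (_ *+ _); move: i ik.
    rewrite mulrC /A -mulrA; apply: agreeM (agree_refl _) _; rewrite -rmorphM /= => l lk.
    rewrite !coef_comp_poly_Xn //; case: ifP => // _; apply: (H_deriv (ltnSn k)).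
    exact: leq_ltn_trans (leq_div _ _) lk.
  move=> i ik; transitivity (((A + 1) * (C * T N)) *+ p)`_i.
    rewrite derivM coefD (agreeM hC' (agree_refl _) ik).
    rewrite (agreeM (agree_refl _) (T_deriv (ltnSn k)) ik) -coefD; congr (_`_i).
    by rewrite mulrnAl mulrnAr -mulrnDl mulrDl mul1r mulrA.
  rewrite !coefMn; congr (_ *+ _).
  exact: (agreeM (S_rec (ltnSn k)) (agree_refl _) ik).
Qed.


Lemma ge_fermat (z : int) : odd p -> ge 1 (z%:~R ^+ p - z%:~R).
Proof.
move=> odd_p.
have hnat (k : nat) : ge 1 (k%:R ^+ p - k%:R).
  have : (k ^ p == k %[mod p])%N by rewrite fermat_little.
  rewrite eqn_mod_dvd; last first.
    by case: k => // k; rewrite -{1}[k.+1]expn1; apply: leq_pexp2l => //; exact: prime_gt0.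
  move=> /dvdnP[e Ee]; rewrite -natrX -natrB; last first.
    by case: k {Ee} => // k; rewrite -{1}[k.+1]expn1; apply: leq_pexp2l => //; exact: prime_gt0.
  by rewrite Ee natrM; apply: (ge0M hC); [exact: (ge_nat hC) | exact/ge_ord/(ord_p hC)].
case: z => k; first exact: hnat.
rewrite NegzE rmorphN exprNn -signr_odd odd_p expr1 mulN1r -opprD.
by apply: (geN hC); exact: (hnat k.+1).
Qed.

(** Fermat's little theorem for numerator and denominator. If p divided the denominator, the
    numerator would be a unit and yet of order at least 1 as a product of [c] and the
    denominator. *)
Lemma ge_rational_frob c : odd p -> rational c -> ge 0 c -> ge 1 (c ^+ p - c).
Proof.
move=> odd_p /rational_ratr[r ->] hc.
have v0 : (denq r)%:~R != 0 :> K by rewrite (intK_eq0 pr hC) denq_neq0.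
have ndvd : ~~ (p %| `|denq r|)%N.
  apply/negP => pv.
  have pu : ~~ (p %| `|numq r|)%N.
    apply/negP => pu; have := coprime_num_den r; rewrite /coprime => /eqP e.
    have : (p %| gcdn `|numq r| `|denq r|)%N by rewrite dvdn_gcd pu.
    by rewrite e dvdn1 => /eqP p1; have := prime_gt1 pr; rewrite p1.
  have hv : ge 1 ((denq r)%:~R : K).
    have /dvdnP[e Ee] := pv.
    have -> : denq r = (e * p)%N%:Z by rewrite -Ee; have := denq_gt0 r; lia.
    rewrite -[_%:~R]/((e * p)%N%:R) natrM; apply: (ge0M hC); first exact: (ge_nat hC).
    exact/ge_ord/(ord_p hC).
  have := geM hC hc hv; rewrite /ratr mulfVK // add0r /vge (ord_int_unit pr hC pu).
  by rewrite lee_fin ler10.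
set x : K := (numq r)%:~R; set y : K := (denq r)%:~R.
have ordy := ord_int_unit pr hC ndvd; rewrite -/y in ordy.
have -> : ratr r ^+ p - ratr r
    = ((x ^+ p - x) * y - x * (y ^+ p - y)) * (y^-1 * y^-1 ^+ p) :> K.
  rewrite /ratr -/x -/y exprMn exprVn.
  have yp : y ^+ p != 0 by rewrite expf_neq0.
  by field; rewrite v0 yp.
rewrite -[1]addr0; apply: (geM hC).
  apply: (geB hC); last by apply: (ge0M hC); [exact: (ge_int hC) | exact: ge_fermat].
  by rewrite mulrC; apply: (ge0M hC); [exact: (ge_int hC) | exact: ge_fermat].
have yV : ge 0 y^-1 by apply: ge_ord; rewrite (ordV hC ordy) oppr0.
by apply: (ge0M hC) => //; exact: (ge0X hC).
Qed.

Definition gepoly (v : rat) (Q : {poly K}) : Prop := forall i, ge v Q`_i.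

Lemma gepolyD v Q R : gepoly v Q -> gepoly v R -> gepoly v (Q + R).
Proof. by move=> h1 h2 i; rewrite coefD; exact: (geD hC). Qed.

Lemma gepolyM v w Q R : gepoly v Q -> gepoly w R -> gepoly (v + w) (Q * R).
Proof.
by move=> h1 h2 i; rewrite coefM; apply: (ge_sum hC) => j _; exact: (geM hC).
Qed.

Lemma gepoly1 : gepoly 0 1.
Proof. by move=> i; rewrite coef1; exact: (ge_nat hC). Qed.

Lemma gepoly_exp Q k : gepoly 0 Q -> gepoly 0 (Q ^+ k).
Proof.
move=> hQ; elim: k => [|k IH]; first exact: gepoly1.
by rewrite exprS -[0]addr0; exact: gepolyM.
Qed.

Lemma gepoly_freshman Q R : gepoly 0 Q -> gepoly 0 R ->
  gepoly 1 ((Q + R) ^+ p - (Q ^+ p + R ^+ p)).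
Proof.
move=> hQ hR; have p0 := prime_gt0 pr.
rewrite exprDn -(big_mkord predT (fun i => Q ^+ (p - i) * R ^+ i *+ 'C(p, i))).
rewrite big_nat_recr //= big_ltn // subn0 expr0 mulr1 bin0 mulr1n subnn expr0 mul1r binn mulr1n.
set s := \sum_(1 <= i < p) _.
have -> : Q ^+ p + s + R ^+ p - (Q ^+ p + R ^+ p) = s by ring.
move=> k; rewrite coef_sum big_nat_cond; apply: (ge_sum hC) => i /andP[ip _].
rewrite coefMn -mulr_natl.
have /dvdnP[e ->] : (p %| 'C(p, i))%N by exact: prime_dvd_bin.
rewrite natrM -mulrA; apply: (ge0M hC); first exact: (ge_nat hC).
rewrite -[1]addr0; apply: (geM hC); first exact/ge_ord/(ord_p hC).
have := gepolyM (gepoly_exp (p - i) hQ) (gepoly_exp i hR).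
by rewrite addr0; apply.
Qed.

(** Rationality is what keeps the coefficients unchanged: the p-th power fixes them modulo p. *)
Lemma gepoly_frob (Q : {poly K}) : odd p -> (forall i, rational Q`_i) -> gepoly 0 Q ->
  gepoly 1 (Q ^+ p - (Q \Po 'X^p)).
Proof.
move=> odd_p; have p0 := prime_gt0 pr; elim/poly_ind: Q => [|Q c IH] rQ iQ.
  by rewrite comp_poly0 expr0n (gtn_eqF p0) subr0 => i; rewrite coef0; exact: (ge0 hC).
have rc : rational c by have := rQ 0%N; rewrite coefD coefMX coefC eqxx add0r.
have ic : ge 0 c by have := iQ 0%N; rewrite coefD coefMX coefC eqxx add0r.
have rQ' i : rational Q`_i by have := rQ i.+1; rewrite coefD coefMX coefC /= addr0.
have iQ' : gepoly 0 Q by move=> i; have := iQ i.+1; rewrite coefD coefMX coefC /= addr0.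
have iX : gepoly 0 'X by move=> i; rewrite coefX; exact: (ge_nat hC).
have iQX : gepoly 0 (Q * 'X) by rewrite -[0]addr0; exact: gepolyM.
have iC : gepoly 0 c%:P by move=> i; rewrite coefC; case: ifP => _ //; exact: (ge0 hC).
have -> : (Q * 'X + c%:P) ^+ p - ((Q * 'X + c%:P) \Po 'X^p)
  = ((Q * 'X + c%:P) ^+ p - ((Q * 'X) ^+ p + c%:P ^+ p))
    + ((Q ^+ p - (Q \Po 'X^p)) * 'X^p + (c ^+ p - c)%:P).
  rewrite comp_polyD comp_polyM comp_polyX comp_polyC exprMn polyCB polyC_exp.
  by move: (_ ^+ p) (Q ^+ p) ('X^p) (c%:P ^+ p) (_ \Po _) => *; ring.
apply: gepolyD; first exact: gepoly_freshman.
apply: gepolyD.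
  by rewrite -[1]addr0; apply: gepolyM (IH rQ' iQ') _; exact: gepoly_exp.
move=> i; rewrite coefC; case: ifP => _; last exact: (ge0 hC).
exact: ge_rational_frob.
Qed.

Lemma ge_exp_coef l : (0 < l)%N -> ge 1 (p%:R ^+ l / (l`!)%:R).
Proof.
move=> l0; have := ordM hC (ordX hC l (ord_p hC)) (ordV hC (ord_nat pr hC (fact_gt0 l))).
rewrite mul1r /vge => ->; rewrite lee_fin.
have : (logn p l`!).+1%:R <= l%:R :> rat by rewrite ler_nat; exact: logn_fact_lt.
by rewrite -natr1; lra.
Qed.

(** Dwork's argument. Let Q collect the earlier coefficients. In degree K1 the new coefficient
    enters E(x)^p only as p h(K1), next to the coefficient of Q^p, which is that of Q(x^p) modulo p.
    By [dwork_identity] the coefficient of E(x)^p is also that of Q(x^p) modulo p, exp(p x) being 1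
    modulo p. So p divides p h(K1). *)
Lemma ge_ah k : odd p -> ge 0 (h k).
Proof.
move=> odd_p; have p1 := prime_gt1 pr; have p0 := prime_gt0 pr.
elim/ltn_ind: k => -[|k] IH; first by rewrite h0; exact: (ge1 hC).
set K1 := k.+1; pose Q := H K1.
have iQ : gepoly 0 Q.
  by move=> i; rewrite coef_poly; case: ifP => [/IH //|_]; exact: (ge0 hC).
have rQ i : rational Q`_i.
  by rewrite coef_poly; case: ifP => _; [exact: ah_rational | exact: (rational_nat 0)].
have EH : H K1.+1 = Q + (h K1)%:P * 'X^K1.
  apply/polyP => i; rewrite coefD coefCM coefXn !coef_poly ltnS leq_eqVlt.
  by case: eqP => [->|_]; rewrite ?ltnn ?mulr1 ?add0r ?mulr0 ?addr0.
have H0 : (H K1.+1)`_0 = 1 by rewrite coef_poly /= h0.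
have Q0 : Q`_0 = 1 by rewrite coef_poly /= h0.
(* The difference of p-th powers is h(K1) X^K1 times a sum of p products, each with constant term
   1. *)
have e1 : (H K1.+1 ^+ p - Q ^+ p)`_K1 = p%:R * h K1.
  rewrite subrXX {1}EH addrC addKr -mulrA coefCM coefXnM ltnn subnn mulrC; congr (_ * _).
  rewrite coef_sum (eq_bigr (fun=> 1)); first by rewrite sumr_const card_ord.
  by move=> i _; rewrite -!/(coefp 0 _) rmorphM !rmorphXn /= H0 Q0 !expr1n mulr1.
have e2 : ge 1 ((Q ^+ p)`_K1 - (Q \Po 'X^p)`_K1).
  by rewrite -coefB; exact: gepoly_frob.
have e3 : ge 1 ((H K1.+1 ^+ p)`_K1 - (Q \Po 'X^p)`_K1).
  have lt_div : (K1 %/ p < K1)%N by apply: ltn_Pdiv.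
  rewrite dwork_identity // coefM big_ord_recr /= subnn addrC -addrA addrCA.
  have -> : (H K1.+1 \Po 'X^p)`_K1 * (T K1.+1)`_0 - (Q \Po 'X^p)`_K1 = 0.
    rewrite [(T _)`_0]coef_poly /= expr0 fact0 divr1 mulr1 !coef_comp_poly_Xn //.
    by rewrite !coef_poly lt_div (ltn_trans lt_div (ltnSn _)) subrr.
  rewrite addr0; apply: (ge_sum hC) => i _; have ik := ltn_ord i.
  rewrite -[1]add0r; apply: (geM hC).
    rewrite coef_comp_poly_Xn //; case: ifP => _; last exact: (ge0 hC).
    have ip : (i %/ p < K1)%N by apply: leq_ltn_trans (leq_div _ _) ik.
    by rewrite coef_poly (ltn_trans ip (ltnSn _)); exact: IH.
  rewrite coef_poly; case: ifP => _; last exact: (ge0 hC).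
  by apply: ge_exp_coef; rewrite subn_gt0.
have e4 : ge 1 (p%:R * h K1).
  rewrite -e1 coefB.
  have -> : (H K1.+1 ^+ p)`_K1 - (Q ^+ p)`_K1 = ((H K1.+1 ^+ p)`_K1 - (Q \Po 'X^p)`_K1)
    - ((Q ^+ p)`_K1 - (Q \Po 'X^p)`_K1) by ring.
  exact: (geB hC).
have pK := ord_neq0 hC (ord_p hC); rewrite -(mulKf pK (h K1)).
have := geM hC (ge_ord (ordV hC (ord_p hC))) e4.
by rewrite addNr.
Qed.

End Coefficients.

Section Theta.
Context (gam : K).
Context (gam0 : gam != 0).

Lemma AH_log0 : AH_log p gam 0 = 0.
Proof.
rewrite /AH_log big1 // => i /eqP E; have := expn_gt0 p i.
by rewrite -E ltnn prime_gt0.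
Qed.

Lemma ah0 : ah gam 0 = 1.
Proof. by rewrite /ah /Theta ps_exp0 expr0 divr1. Qed.

Lemma ah_rec k : k.+1%:R * ah gam k.+1
  = \sum_(d < k.+1) (is_pow d.+1)%:R * ah gam (k - d)%N.
Proof.
rewrite /ah /Theta mulrA ps_exp_rec; last exact: (fun k => natK_neq0 pr hC (ltn0Sn k)).
  rewrite mulr_suml; apply: eq_bigr => d _; rewrite AH_logE.
  have dk := ltn_ord d; have -> : gam ^+ k.+1 = gam ^+ d.+1 * gam ^+ (k - d).
    by rewrite -exprD; congr (_ ^+ _); lia.
  by field; rewrite !expf_neq0.
exact: AH_log0.
Qed.

Lemma ThetaE k : Theta p gam k = ah gam k * gam ^+ k.
Proof. by rewrite /ah mulfVK // expf_neq0. Qed.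

End Theta.

End ArtinHasse.

(** * Coefficients of Ft *)

Section QpClosure.
Context (K : closedFieldType) (ord : K -> \bar rat) (p : nat).
Context (pr : prime p).
Context (hC : is_Cp ord p).
Notation ge := (vge ord).

Lemma Qp_approxP x : Qp_set ord x <-> forall M, exists2 c, rational c & ge M (x - c).
Proof.
split=> h M.
  have [r hr] := h M; exists (ratr r) => //.
  by exists (numq r), (denq r); rewrite denq_neq0.
by have [c /(rational_ratr pr hC)[r ->] hc] := h M; exists r.
Qed.

Lemma Qp_rational c : rational c -> Qp_set ord c.
Proof.
by move=> hc; apply/Qp_approxP => M; exists c; rewrite // subrr; exact: (ge0 hC).
Qed.

Lemma QpD x y : Qp_set ord x -> Qp_set ord y -> Qp_set ord (x + y).
Proof.
move=> /Qp_approxP hx /Qp_approxP hy; apply/Qp_approxP => M.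
have [c rc hc] := hx M; have [d rd hd] := hy M.
by exists (c + d); [exact: (rationalD pr hC) | rewrite opprD addrACA; exact: (geD hC)].
Qed.

Lemma ge_some x : exists B, ge B x.
Proof.
have [->|/(ord_fin hC)[r hr]] := eqVneq x 0; first by exists 0; exact: (ge0 hC).
by exists r; exact: ge_ord.
Qed.

Lemma QpM x y : Qp_set ord x -> Qp_set ord y -> Qp_set ord (x * y).
Proof.
move=> /Qp_approxP hx /Qp_approxP hy; apply/Qp_approxP => M.
have [B hB] := ge_some x; have [d rd hd] := hy (M - B).
have [D hD] := ge_some d; have [c rc hc] := hx (M - D).
exists (c * d); first exact: rationalM.
have -> : x * y - c * d = x * (y - d) + (x - c) * d by ring.
apply: (geD hC).
  by rewrite -[M](subrKC B); exact: (geM hC).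
by rewrite -[M](subrK D); exact: (geM hC).
Qed.

Lemma QpX x k : Qp_set ord x -> Qp_set ord (x ^+ k).
Proof.
move=> hx; elim: k => [|k IH]; first exact/Qp_rational/(rational_nat _ 1).
by rewrite exprS; exact: QpM.
Qed.

Lemma Qp_sum (I : Type) (r : seq I) (F : I -> K) :
  (forall i, Qp_set ord (F i)) -> Qp_set ord (\sum_(i <- r) F i).
Proof.
move=> h; apply: big_ind => //; last exact: QpD.
exact/Qp_rational/(rational_nat _ 0).
Qed.

Lemma Qp_lim u l : ord_lim ord u l -> (forall i, Qp_set ord (u i)) -> Qp_set ord l.
Proof.
move=> hl hu; apply/Qp_approxP => M; have [N hN] := hl M.
have [c rc hc] := (Qp_approxP (u N)).1 (hu N) M; exists c => //.
have -> : l - c = (u N - c) - (u N - l) by ring.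
by apply: (geB hC) => //; exact: hN.
Qed.

Section Gamma.
Context (g : K) (q : rat).
Context (ordg : ord g = q%:E) (qP : q * (p%:R - 1) = 1).
Context (gsum : is_psum ord (fun k : nat => g ^+ (p ^ k) / p%:R ^+ k) 0).

Let y := g ^+ p.-1.
Let e k : nat := \sum_(i < k) p ^ i.

Let p_gt1 : (1 < p)%N. Proof. exact: prime_gt1. Qed.
Let pK : p%:R != 0 :> K. Proof. exact: (ord_neq0 hC (ord_p hC)). Qed.
Let g0 : g != 0. Proof. exact: (ord_neq0 hC ordg). Qed.

Let p1E : p.-1%:R = p%:R - 1 :> rat.
Proof. by rewrite -subn1 natrB // ltnW. Qed.

Let ordy : ord y = 1%:E.
Proof. by rewrite (ordX hC _ ordg) p1E qP. Qed.

Let gE k : g ^+ (p ^ k) = g * y ^+ e k.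
Proof.
by rewrite -exprM -exprS -predn_exp prednK // expn_gt0 ltnW.
Qed.

Let e_ge k : (2 * k + 3 <= e k.+2)%N.
Proof.
elim: k => [|k IH]; first by rewrite /e !big_ord_recr big_ord0 /= expn0 expn1; lia.
rewrite /e big_ord_recr /= -/(e k.+2).
have := ltn_expl k.+2 p_gt1; lia.
Qed.

Let tail k (z : K) : K := z ^+ e k.+2 / p%:R ^+ k.+1.

(** Multiplying the equation of gamma by p / g leaves an equation in y = g^(p-1) alone, because
    g^(p^k) = g y^(e k) with e k = (p^k - 1)/(p - 1). *)
Let tail_eq M : exists k, ge M (p%:R + y + \sum_(i < k) tail i y).
Proof.
have q0 : 0 < q.
  by rewrite -(@pmulr_lgt0 _ (p%:R - 1)) ?qP // subr_gt0 ltr1n.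
have [N hN] := rat_bound (`|M| + q + 1); exists N.
have : ge (N%:R : rat) (0 - \sum_(i < N.+2) g ^+ (p ^ i) / p%:R ^+ i).
  apply: (is_psum_tail hC gsum) => k Nk.
  have := geM hC (ge_ord (ordX hC (p ^ k) ordg)) (ge_ord (ordV hC (ordX hC k (ord_p hC)))).
  apply: geW; rewrite mul1r.
  have h1 : (p ^ k)%:R = (p%:R - 1) * (e k)%:R + 1 :> rat.
    by rewrite -p1E -natrM natr1 -predn_exp prednK // expn_gt0 ltnW.
  case: k Nk h1 => [|[|k]] // Nk ->.
  rewrite mulrDr mulrA qP mul1r mulr1.
  have : (N + k.+2)%:R <= (e k.+2)%:R :> rat by rewrite ler_nat; have := e_ge k; lia.
  by rewrite natrD; lra.
rewrite sub0r => /(geN hC); rewrite opprK => h.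
have := geM hC h (geM hC (ge_ord (ord_p hC)) (ge_ord (ordV hC ordg))).
have -> : (\sum_(i < N.+2) g ^+ (p ^ i) / p%:R ^+ i) * (p%:R / g)
    = p%:R + y + \sum_(i < N) tail i y.
  rewrite 2!big_ord_recl /= !mulrDl mulr_suml addrA; congr (_ + _ + _).
  - by rewrite expn0 expr0 expr1; field; rewrite g0 oner_neq0.
  - by rewrite gE /e big_ord1 expn0 !expr1; field; rewrite g0 pK.
  - apply: eq_bigr => i _; rewrite gE /tail /bump /= !add1n exprS.
    by field; rewrite ?g0 ?pK ?expf_neq0.
by apply: geW; have := ler_norm M; lra.
Qed.

(* [g^(p-1)] is the fixed point of
   [z |-> - p - sum_(k >= 2) z^((p^k-1)/(p-1)) / p^(k-1)],
   a contraction that maps rationals to rationals. *)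
Lemma gamma_pow_Qp : Qp_set ord y.
Proof.
apply/Qp_approxP; suff h (s : nat) : exists c, [/\ rational c, ge 1 c & ge s.+1%:R (y - c)].
  move=> M; have [N hN] := rat_bound M; have [c [rc _ hc]] := h N; exists c => //.
  by apply: geW hc; rewrite -natr1; apply: le_trans hN _; rewrite lerDl.
elim: s => [|s [c [rc c1 hc]]].
  exists 0; split; [exact: (rational_nat _ 0) | exact: (ge0 hC) |].
  by rewrite subr0; exact: ge_ord.
have [k hk] := tail_eq s.+2%:R.
pose c' := - (p%:R + \sum_(i < k) tail i c).
have hc' : ge s.+2%:R (y - c').
  have -> : y - c' = (p%:R + y + \sum_(i < k) tail i y) - \sum_(i < k) (tail i y - tail i c).
    by rewrite sumrB /c'; ring.
  apply: (geB hC) => //; apply: (ge_sum hC) => i _.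
  (* After splitting off y - c, the cofactor has order at least e(i+2) - 1 >= i + 2, one more than
     p^(i+1) takes away: each iteration gains one order. *)
  rewrite /tail -mulrBl subrXX -mulrA.
  set S := \sum_(j < _) _.
  have hS : ge (e i.+2).-1%:R S.
    apply: (ge_sum hC) => j _; have je := ltn_ord j.
    have := geM hC (geX hC ((e i.+2).-1 - j) (ge_ord ordy)) (geX hC j c1).
    by rewrite !mul1r -natrD subnK //; lia.
  have := geM hC hc (geM hC hS (ge_ord (ordV hC (ordX hC i.+1 (ord_p hC))))).
  apply: geW; rewrite mul1r -natr1.
  have : (i.+1).+1%:R <= (e i.+2).-1%:R :> rat by rewrite ler_nat; have := e_ge i; lia.
  by rewrite -[(i.+1).+1%:R]natr1; lra.
exists c'; split => //.
  rewrite -[c']mulN1r; apply: rationalM; first by exists (-1), 1; rewrite divr1.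
  apply: (rationalD pr hC); first exact: rational_nat.
  apply: (big_ind (@rational K)) => [||i _]; first exact: (rational_nat _ 0).
    exact: (rationalD pr hC).
  apply: rationalM; last by rewrite -natrX; exact: rational_natV.
  by elim: (e _) => [|j IH]; [exact: (rational_nat _ 1) | rewrite exprS; exact: rationalM].
have -> : c' = y - (y - c') by ring.
by apply: (geB hC); [exact: ge_ord | apply: geW hc'; rewrite ler1n].
Qed.

End Gamma.
End QpClosure.

(** * Coefficients of Ft as series in the exponent of t *)

Section FrobeniusSeries.
Context (K : closedFieldType) (ord : K -> \bar rat) (p : nat).
Context (pr : prime p).
Context (hC : is_Cp ord p).
Context (n : nat) (tg : K) (rho : rat).
Context (n_gt0 : (0 < n)%N) (odd_p : odd p).
Context (hrho : rho * n%:R * (p%:R - 1) = 1).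
Context (ordtg : ord tg = rho%:E).
Notation ge := (vge ord).
Notation g := (tg ^+ n).
Context (gsum : is_psum ord (fun k : nat => g ^+ (p ^ k) / p%:R ^+ k) 0).

Let rho_gt0 : 0 < rho := rho_gt0 pr n_gt0 (odd_prime_gt2 odd_p pr) hrho.
Let q := rho * n%:R.
Let ordg : ord g = q%:E.
Proof. exact: (ordX hC). Qed.
Let g0 : g != 0 := ord_neq0 hC ordg.
Let n0 : n%:Z != 0.
Proof. by case: n n_gt0. Qed.

Notation lam := (Theta p g).

Let lamE k : lam k = ah p g k * g ^+ k.
Proof. exact: ThetaE. Qed.

Let ge0_ah k : ge 0 (ah p g k).
Proof. exact: (ge_ah pr hC (ah0 p g) (ah_rec pr hC g0)). Qed.

Let rational_ah k : rational (ah p g k).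
Proof. exact: (ah_rational pr hC (ah0 p g) (ah_rec pr hC g0)). Qed.

Lemma Theta_small k : (k < p)%N -> lam k = (k`!)%:R^-1 * g ^+ k.
Proof. by move=> kp; rewrite lamE (ah_small pr hC (ah0 p g) (ah_rec pr hC g0)). Qed.

(** The k-th term of Theta(tau/(xy)) reaches x^u y^v only if Theta(x^n) supplies x^(u+k) and
    Theta(y) supplies y^(v+k). *)
Let contributes (u v : int) (k : nat) : bool :=
  [&& (n%:Z %| u + k%:Z)%Z, 0 <= u + k%:Z & 0 <= v + k%:Z].

Let expt (u v : int) (k : nat) : int := ((u + k%:Z) %/ n%:Z)%Z + (v + k%:Z) + k%:Z.

Let coeff (u v : int) (k : nat) : K :=
  if contributes u v k
  then ah p g (absz ((u + k%:Z) %/ n%:Z)%Z) * ah p g (absz (v + k%:Z)) * ah p g k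
  else 0.

(** The rational factor is kept apart from the powers of g and tau, since [sigma] fixes the former
    and g but moves tau. *)
Definition Fterm (u v : int) (tau : K) (k : nat) : K :=
  coeff u v k * (g ^ expt u v k * tau ^+ k).

Let rational_coeff u v k : rational (coeff u v k).
Proof.
rewrite /coeff; case: ifP => _; last exact: (rational_nat _ 0).
by do 2 apply: rationalM => //.
Qed.

Let ge0_coeff u v k : ge 0 (coeff u v k).
Proof.
rewrite /coeff; case: ifP => _; last exact: (ge0 hC).
by do 2 apply: (ge0M hC) => //.
Qed.

Lemma ge_Fterm u v tau k : ge 0 tau ->
  ge (rho * (u + n%:Z * v + (2 * n%:Z + 1) * k%:Z)%:~R) (Fterm u v tau k).
Proof.
move=> ht; rewrite /Fterm /coeff; case: ifP => [/and3P[/dvdzP[e Ee] _ _]|_]; last first.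
  by rewrite mul0r; exact: (ge0 hC).
apply: (ge0M hC); first by do 2 apply: (ge0M hC) => //.
rewrite -[X in ge X]addr0; apply: (geM hC); last exact: (ge0X hC).
apply/ge_ord; rewrite (ordXz hC _ ordg) /q; congr (_%:E).
rewrite -mulrA; congr (_ * _); rewrite -[n%:R]/(n%:Z%:~R) -intrM; congr (_%:~R).
by rewrite /expt Ee mulzK //; lia.
Qed.

Lemma Fterm_eq0 u v tau k : ~~ contributes u v k -> Fterm u v tau k = 0.
Proof. by rewrite /Fterm /coeff => /negbTE ->; rewrite mul0r. Qed.

Lemma Fterm_Theta u v tau (e w k : nat) : u + k%:Z = e%:Z * n%:Z -> v + k%:Z = w%:Z ->
  Fterm u v tau k = lam e * lam w * (lam k * tau ^+ k).
Proof.
move=> Eu Ev; have h : 0 <= e%:Z * n%:Z by nia.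
rewrite /Fterm /coeff /contributes /expt Eu Ev h dvdz_mull // mulzK //=.
by rewrite -!PoszD -exprnP !exprD !lamE; ring.
Qed.

(** A contributing k is at least max(0, -u, -v): this is the origin of the shape of omega. *)
Lemma ge_Fterm_nomega u v tau k : ge 0 tau ->
  ge (rho * (nomega n u v)%:~R) (Fterm u v tau k).
Proof.
move=> ht; have [/and3P[_ h1 h2]|/Fterm_eq0 ->] := boolP (contributes u v k); last exact: (ge0 hC).
apply: geW (ge_Fterm u v k ht); rewrite ler_pM2l // ler_int /nomega lerD2l.
by apply: ler_wpM2l; lia.
Qed.

Lemma null_Fterm u v tau : ge 0 tau -> null ord (Fterm u v tau).
Proof.
move=> ht M; have [N hN] := rat_bound (M / rho).
pose z : int := u + n%:Z * v; exists (N + absz z)%N => k hk.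
apply: geW (ge_Fterm u v k ht); rewrite -ler_pdivrMl // mulrC; apply: le_trans hN _.
rewrite -[N%:R]/(N%:Z%:~R) ler_int.
have : k%:Z <= (2 * n%:Z + 1) * k%:Z by rewrite -{1}[k%:Z]mul1r; apply: ler_wpM2r; lia.
by move: hk; rewrite /z; lia.
Qed.

Definition Fcoef (u v : int) (tau : K) : K := psum ord (Fterm u v tau).

Lemma nsum_Fcoef u v tau : ge 0 tau -> nsum ord (Fterm u v tau) (Fcoef u v tau).
Proof.
move=> ht; have [s hs] := nsum_ex hC (null_Fterm u v ht).
by rewrite /Fcoef (nsum_psum hC hs).
Qed.

Lemma ge_Fcoef u v tau : ge 0 tau -> ge (rho * (nomega n u v)%:~R) (Fcoef u v tau).
Proof.
by move=> ht; apply: (nsum_ge hC (nsum_Fcoef u v ht)) => k; exact: ge_Fterm_nomega.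
Qed.

(** In the row v = 0 a contributing k is congruent to y modulo n. As k >= 0 and y < n, such a k is y
    itself or at least y + n. *)
Lemma Fcoef_lead (u y : int) tau : (n%:Z %| u + y)%Z -> - n%:Z < y < n%:Z -> ge 0 tau ->
  ge (rho * (u + (2 * n%:Z + 1) * (y + n%:Z))%:~R)
    (Fcoef u 0 tau - if 0 <= y then Fterm u 0 tau (absz y) else 0).
Proof.
move=> /dvdzP[d Ed] /andP[y1 y2] ht.
have key k : contributes u 0 k -> k%:Z != y -> y + n%:Z <= k%:Z.
  move=> /and3P[/dvdzP[e Ee] _ _] /eqP ky.
  have Eky : k%:Z - y = (e - d) * n%:Z by rewrite mulrBl -Ee -Ed; ring.
  have [ed|ed|ed] := ltgtP e d; [exfalso; nia | nia | by exfalso; nia].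
have tail k : k%:Z != y ->
    ge (rho * (u + (2 * n%:Z + 1) * (y + n%:Z))%:~R) (Fterm u 0 tau k).
  move=> ky; have [hk|/Fterm_eq0 ->] := boolP (contributes u 0 k); last exact: (ge0 hC).
  apply: geW (ge_Fterm u 0 k ht); rewrite ler_pM2l // ler_int mulr0 addr0 lerD2l.
  by apply: ler_wpM2l; [lia | exact: key].
case: ifP => y0; last first.
  by rewrite subr0; apply: (nsum_ge hC (nsum_Fcoef u 0 ht)) => k; apply: tail; lia.
have hs := nsum_tail (N := (absz y).+1) hC (nsum_Fcoef u 0 ht)
  (fun j hj => tail j (ltac:(lia) : j%:Z != y)).
move: hs; rewrite big_ord_recr big1 /= ?add0r // => k _.
have ky := ltn_ord k; apply: Fterm_eq0; apply/negP => /key h.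
by have := h (ltac:(lia) : k%:Z != y); lia.
Qed.

Let S1 := ls_subst ord (Theta p g) 1 n%:Z 0.
Let S2 := ls_subst ord (Theta p g) 1 0 1.

Let S1_val k : S1 (k%:Z * n%:Z) 0 = lam k.
Proof.
rewrite /S1 /ls_subst (psum1 hC (i0 := k)).
  by rewrite eqxx mulr0 eqxx expr1n mulr1.
by move=> i ik; rewrite (inj_eq (mulIf n0)) eqz_nat eq_sym (negbTE ik).
Qed.

Let S1_out (a b : int) : b != 0 \/ (forall k : nat, a != k%:Z * n%:Z) -> S1 a b = 0.
Proof.
move=> h; apply: (psum0 hC) => k; case: h => h; last by rewrite (negbTE (h k)).
by rewrite mulr0 (negbTE h) andbF.
Qed.

Let S2_val k : S2 0 k%:Z = lam k.
Proof.
rewrite /S2 /ls_subst (psum1 hC (i0 := k)).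
  by rewrite mulr0 mulr1 !eqxx expr1n mulr1.
by move=> i ik; rewrite mulr1 eqz_nat [k == i]eq_sym (negbTE ik) andbF.
Qed.

Let S2_out (a b : int) : a != 0 \/ b < 0 -> S2 a b = 0.
Proof.
move=> h; apply: (psum0 hC) => k; case: h => h; first by rewrite mulr0 (negbTE h).
by rewrite mulr1 (_ : (b == k%:Z) = false) ?andbF //; apply/negbTE; lia.
Qed.

Let S3_val tau k : ls_subst ord (Theta p g) tau (- 1) (- 1) (- k%:Z) (- k%:Z) = lam k * tau ^+ k.
Proof.
rewrite /ls_subst (psum1 hC (i0 := k)); first by rewrite mulrN1 eqxx.
by move=> i ik; rewrite mulrN1 eqr_opp eqz_nat eq_sym (negbTE ik).
Qed.

Let S3_out tau (a b : int) : (forall k : nat, (a, b) != (- k%:Z, - k%:Z)) ->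
  ls_subst ord (Theta p g) tau (- 1) (- 1) a b = 0.
Proof.
by move=> h; apply: (psum0 hC) => k; rewrite !mulrN1; have := h k; rewrite xpair_eqE => /negbTE ->.
Qed.

(** The first two factors live on the coordinate axes, so their product has one term per monomial;
    the third lives on the diagonal, which turns the remaining double sum into a series in k. *)
Lemma FtE u v tau : ge 0 tau -> Ft ord n p g tau u v = Fcoef u v tau.
Proof.
move=> ht; have G a b : ls_mul ord S1 S2 a b = S1 a 0 * S2 0 b.
  rewrite /ls_mul (psum1 hC (i0 := (a, 0))) /= ?subrr ?subr0 // => -[c d].
  rewrite xpair_eqE negb_and => /orP[ca|d0]; last by rewrite S1_out ?mul0r //; left.
  by rewrite S2_out ?mulr0 //; left; rewrite subr_eq0 eq_sym.
rewrite /Ft -/S1 -/S2 /ls_mul; apply: (csum_psum hC).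
apply: (@csum_inj _ _ _ hC _ _ (fun k : nat => (u + k%:Z, v + k%:Z))).
- by move=> i j [] /addrI [].
- move=> [c d] h /=; rewrite S3_out ?mulr0 // => k; apply: contraNN (h k).
  by rewrite !xpair_eqE => /andP[/eqP h1 /eqP h2]; lia.
have -> : (fun j : nat => ls_mul ord S1 S2 (u + j%:Z, v + j%:Z).1 (u + j%:Z, v + j%:Z).2 *
   ls_subst ord lam tau (-1) (-1) (u - (u + j%:Z, v + j%:Z).1) (v - (u + j%:Z, v + j%:Z).2))
   = Fterm u v tau; last exact/(nsum_csum hC)/nsum_Fcoef.
apply/funext => k /=; rewrite G !opprD !addNKr S3_val.
have [/and3P[/dvdzP[e Ee] hu hv]|nc] := boolP (contributes u v k); last first.
  rewrite (Fterm_eq0 _ nc); have [hv|hv] := boolP (0 <= v + k%:Z); last first.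
    by rewrite S2_out ?mulr0 ?mul0r //; right; lia.
  rewrite S1_out ?mul0r //; right => j; apply: contraNneq nc => Ej.
  by rewrite /contributes hv Ej dvdz_mull //=; nia.
have e_ge0 : 0 <= e by move: hu; rewrite Ee pmulr_lge0 // ltz_nat.
case: e e_ge0 Ee => // e _ Ee; case Ev: (v + k%:Z) hv => [w|//] _.
by rewrite (Fterm_Theta _ Ee Ev) Ee S1_val S2_val.
Qed.

Section Periodic.
Context (Q : nat) (Q_gt1 : (1 < Q)%N).

Let X : nat := (p.-1 * Q.-1)%N.
Let per : nat := (n * X)%N.
(** The factor gained by the power of g when k grows by [per]: X from (u+k)/n and [per] from each of
    v+k and k. Its exponent is a multiple of p-1, so it lies in Q_p. *)
Let G : K := g ^+ (2 * per + X)%N.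

Let X_gt0 : (0 < X)%N.
Proof. by rewrite muln_gt0; have := prime_gt1 pr; lia. Qed.

Let expt_per u v r s : expt u v (r + per * s)%N = expt u v r + ((2 * per + X) * s)%N%:Z.
Proof.
rewrite /expt; have -> : u + (r + per * s)%N%:Z = (X * s)%N%:Z * n%:Z + (u + r%:Z).
  by rewrite /per; lia.
by rewrite divzMDl //; lia.
Qed.

(* Since [tau^(Q-1) = 1] and [g^(p-1)] is in Q_p, grouping the terms by the class of
   [k] modulo [n (p-1) (Q-1)] turns the infinite sum into a finite Q_p-combination of
   monomials in [g] and [tau], to which [sigma] can be applied. *)
Lemma Fcoef_periodic u v : exists w : 'I_per -> K,
  (forall r, Qp_set ord (w r)) /\
  forall tau, ge 0 tau -> tau ^+ Q.-1 = 1 ->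
    Fcoef u v tau = \sum_(r < per) (g ^ expt u v r * tau ^+ r) * w r.
Proof.
have GQp : Qp_set ord G.
  rewrite /G (_ : (2 * per + X)%N = (p.-1 * ((2 * n + 1) * Q.-1))%N); last by rewrite /per /X; lia.
  by rewrite exprM; apply: (QpX pr hC); exact: (gamma_pow_Qp pr hC ordg hrho gsum).
have q0 : 0 < q by rewrite mulr_gt0 // ltr0n.
have ordG : ord G = (q * (2 * per + X)%:R)%:E by exact: (ordX hC).
pose f (r : 'I_per) s := coeff u v (r + per * s)%N * G ^+ s.
have nf r : null ord (f r).
  move=> M; have [N hN] := rat_bound (M / (q * (2 * per + X)%:R)); exists N => s Ns.
  apply: (ge0M hC) => //; apply: geW (ge_ord (ordX hC s ordG)).
  have h0 : 0 < q * (2 * per + X)%:R by rewrite mulr_gt0 // ltr0n; lia.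
  by rewrite -ler_pdivrMl // mulrC; apply: le_trans hN _; rewrite ler_nat.
pose w r := projT1 (cid (nsum_ex hC (nf r))).
have hw r : nsum ord (f r) (w r) by rewrite /w; case: cid.
exists w; split => [r|tau ht tauQ].
  apply: (Qp_lim pr hC (hw r).2) => N; apply: (Qp_sum pr hC) => s.
  apply: (QpM pr hC); first exact/(Qp_rational pr hC).
  exact: (QpX pr hC).
have tau_per s : tau ^+ (per * s) = 1.
  by rewrite /per /X mulnA mulnAC mulnC exprM tauQ expr1n.
apply: (lim_uniq hC (u := fun N => \sum_(k < N * per) Fterm u v tau k)).
  apply: (lim_sub (g := fun N => (N * per)%N) _ (nsum_Fcoef u v ht).2) => i.
  by rewrite leq_pmulr // muln_gt0 n_gt0.
have := lim_sum hC (index_enum 'I_per) (fun r => limZ hC (g ^ expt u v r * tau ^+ r) (hw r).2).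
congr ord_lim; apply/funext => N.
under eq_bigr do rewrite mulr_sumr.
rewrite exchange_big /=; elim: N => [|N IH]; first by rewrite mul0n !big_ord0.
rewrite big_ord_recr /= IH mulSn addnC -!(big_mkord predT (Fterm u v tau)).
rewrite [RHS](big_cat_nat (n := (N * per)%N)) ?leq_addr //=; congr (_ + _).
rewrite -[X in \sum_(X <= _ < _) _]add0n big_addn addKn big_mkord; apply: eq_bigr => r _.
rewrite /f /Fterm [(N * per)%N]mulnC expt_per exprD tau_per.
have -> : g ^ (expt u v r + ((2 * per + X) * N)%N%:Z) = g ^ expt u v r * G ^+ N.
  have -> : G ^+ N = g ^ ((2 * per + X) * N)%N%:Z by rewrite -exprM.
  by rewrite -expfzDr.
by ring.
Qed.

End Periodic.

End FrobeniusSeries.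

(** * The action of sigma *)

Section AdjoinField.
Context (K : closedFieldType) (L X : set K).
Let E := adjoin_field L X.

Lemma adjoin_fieldL x : L x -> E x.
Proof. by move=> Lx A [_ h]; apply: h; left. Qed.

Lemma adjoin_fieldX x : X x -> E x.
Proof. by move=> Xx A [_ h]; apply: h; right. Qed.

Lemma adjoin_field1 : E 1.
Proof. by move=> A [[h _ _] _]; move: h; rewrite inE. Qed.

Lemma adjoin_fieldB x y : E x -> E y -> E (x - y).
Proof.
move=> hx hy A hA; have [_ h _] := hA.1.
by have := h x y; rewrite !inE; apply; [exact: hx | exact: hy].
Qed.

Lemma adjoin_field_div x y : E x -> E y -> E (x / y).
Proof.
move=> hx hy A hA; have [_ _ h] := hA.1.
by have := h x y; rewrite !inE; apply; [exact: hx | exact: hy].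
Qed.

Lemma adjoin_fieldV x : E x -> E x^-1.
Proof. by rewrite -[x^-1]mul1r; apply: adjoin_field_div; exact: adjoin_field1. Qed.

Lemma adjoin_fieldM x y : E x -> E y -> E (x * y).
Proof. by move=> hx /adjoin_fieldV; rewrite -{2}[y]invrK; exact: adjoin_field_div. Qed.

Lemma adjoin_field0 : E 0.
Proof. by rewrite -(subrr 1); apply: adjoin_fieldB; exact: adjoin_field1. Qed.

Lemma adjoin_fieldD x y : E x -> E y -> E (x + y).
Proof.
move=> hx hy; rewrite -[y]opprK -[- y]sub0r; apply: adjoin_fieldB => //.
by apply: adjoin_fieldB => //; exact: adjoin_field0.
Qed.

End AdjoinField.

Section Frobenius.
Context (K : closedFieldType) (ord : K -> \bar rat) (p : nat).
Context (pr : prime p).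
Context (hC : is_Cp ord p).
Context (a : nat) (Qq : set K) (Fq : finFieldType) (red : K -> Fq) (t : Fq).
Context (tbar zeta tg : K) (sigma : K -> K).
Context (a_gt0 : (0 < a)%N) (cardF : #|Fq| = (p ^ a)%N).
Context (hQq : unramified_extension ord a Qq).
Context (hred : is_residue_map ord Qq red).
Context (t0 : t != 0) (htbar : is_teichmuller ord Qq red t tbar).
Context (tg0 : tg != 0).
Context (hsigma : is_frobenius ord p Qq zeta tg sigma).
Notation ge := (vge ord).
Notation E := (adjoin_field Qq [set zeta; tg]).

Lemma ord_tbar : ord tbar = 0%:E.
Proof.
have [[Lt ht] _ rt] := htbar; have [_ _ h _] := hred.
apply/eqP; rewrite eq_le ht andbT leNgt; apply/negP => h0.
by move/(h tbar (conj Lt ht)): h0; rewrite rt; exact/eqP.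
Qed.

Lemma sigma_integers x : integers_of ord Qq x -> integers_of ord Qq (sigma x).
Proof.
move=> hx; split; first exact: (frob_L hsigma) hx.1.
have -> : sigma x = (sigma x - x ^+ p) + x ^+ p by rewrite subrK.
apply: (geD hC); last exact: (ge0X hC _ hx.2).
exact/ltW/(frob_lift hsigma).
Qed.

Lemma ge_iter_sigma i : ge 0 (iter i sigma tbar).
Proof.
suff [] : integers_of ord Qq (iter i sigma tbar) by [].
elim: i => [|i IH]; first by have [] := htbar.
exact: sigma_integers.
Qed.

(** Carries along membership in the field on which [sigma] is a morphism. *)
Definition sends (x y : K) : Prop := E x /\ sigma x = y.

Lemma sendsD x x' y y' : sends x x' -> sends y y' -> sends (x + y) (x' + y').
Proof.
move=> [hx <-] [hy <-]; split; first exact: adjoin_fieldD.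
exact: (frob_add hsigma).
Qed.

Lemma sendsM x x' y y' : sends x x' -> sends y y' -> sends (x * y) (x' * y').
Proof.
move=> [hx <-] [hy <-]; split; first exact: adjoin_fieldM.
exact: (frob_mul hsigma).
Qed.

Lemma sends1 : sends 1 1.
Proof. by split; [exact: adjoin_field1 | exact: (frob_one hsigma)]. Qed.

Lemma sends_Qp x : Qp_set ord x -> sends x x.
Proof.
move=> hx; split; last exact: (frob_Qp hsigma).
by apply: adjoin_fieldL; have [_ h _ _] := hQq; exact: h.
Qed.

Lemma sends_sum (I : Type) (r : seq I) (F G : I -> K) :
  (forall i, sends (F i) (G i)) -> sends (\sum_(i <- r) F i) (\sum_(i <- r) G i).
Proof.
move=> h; elim: r => [|i r IH]; last by rewrite !big_cons; exact: sendsD.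
by rewrite !big_nil; exact/sends_Qp/(Qp_rational pr hC)/(rational_nat _ 0).
Qed.

Lemma sendsX x y k : sends x y -> sends (x ^+ k) (y ^+ k).
Proof.
move=> h; elim: k => [|k IH]; first exact: sends1.
by rewrite !exprS; exact: sendsM.
Qed.

Lemma sendsV x : x != 0 -> sends x x -> sends x^-1 x^-1.
Proof.
move=> x0 [hx sx]; have hV := adjoin_fieldV hx; split => //.
apply: (mulfI x0); rewrite -{1}sx -(frob_mul hsigma) //.
by rewrite mulfV // (frob_one hsigma).
Qed.

Lemma sendsXz x (z : int) : x != 0 -> sends x x -> sends (x ^ z) (x ^ z).
Proof.
move=> x0 hx; case: z => k; first exact: sendsX.
rewrite NegzE -exprnN; apply: sendsV; first by rewrite expf_neq0.
exact: sendsX.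
Qed.

Lemma sends_tg : sends tg tg.
Proof. by split; [apply: adjoin_fieldX; right | exact: (frob_tg hsigma)]. Qed.

(** Uniqueness of Teichmüller lifts. Let z and y be the two sides, both roots of X^q - X. If z <> y,
    dividing z^q - y^q = z - y by z - y shows that the sum S of the z^(q-1-i) y^i is 1; but S is q
    y^(q-1) modulo z - y, so it has positive order. *)
Lemma sends_tbar : sends tbar (tbar ^+ p).
Proof.
have [hint tq _] := htbar.
have Et : E tbar by apply: adjoin_fieldL; exact: hint.1.
split=> //; apply/eqP; rewrite -subr_eq0; apply/eqP.
have [//|d0] := eqVneq (sigma tbar - tbar ^+ p) 0.
exfalso; set z := sigma tbar in d0 *; set y := tbar ^+ p in d0 *.
have [s Es] := ord_fin hC d0.
have s0 : 0 < s by have := frob_lift hsigma hint; rewrite -/z -/y Es lte_fin.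
have zq : z ^+ #|Fq| = z by have [_] := sendsX #|Fq| (conj Et erefl : sends tbar z); rewrite tq.
have yq : y ^+ #|Fq| = y by rewrite /y -exprM mulnC exprM tq.
have y0 : ge 0 y by apply: (ge0X hC); exact: hint.2.
have z0 : ge 0 z by have [] := sigma_integers hint.
have q1 : (0 < #|Fq|)%N by rewrite cardF expn_gt0 prime_gt0.
pose S := \sum_(i < #|Fq|) z ^+ (#|Fq|.-1 - i) * y ^+ i.
have S1 : S = 1.
  by apply: (mulfI d0); rewrite -subrXX zq yq mulr1.
have hS : ge s (S - #|Fq|%:R * y ^+ #|Fq|.-1).
  have -> : S - #|Fq|%:R * y ^+ #|Fq|.-1
      = \sum_(i < #|Fq|) (z ^+ (#|Fq|.-1 - i) - y ^+ (#|Fq|.-1 - i)) * y ^+ i.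
    have -> : #|Fq|%:R * y ^+ #|Fq|.-1 = \sum_(i < #|Fq|) y ^+ #|Fq|.-1.
      by rewrite sumr_const card_ord mulr_natl.
    rewrite -sumrB; apply: eq_bigr => i _.
    by rewrite mulrBl -exprD subnK //; have := ltn_ord i; lia.
  apply: (ge_sum hC) => i _; rewrite subrXX mulrC -[s]add0r.
  apply: (geM hC); first exact: (ge0X hC).
  rewrite -[s]addr0; apply: (geM hC); first exact: ge_ord.
  by apply: (ge_sum hC) => j _; apply: (ge0M hC); exact: (ge0X hC).
have hq : ge 1 (#|Fq|%:R * y ^+ #|Fq|.-1).
  rewrite -[1]addr0; apply: (geM hC); last exact: (ge0X hC).
  rewrite cardF natrX; have := geX hC a (ge_ord (ord_p hC)); apply: geW.
  by rewrite mul1r ler1n.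
have : ge (Num.min s 1) (1 : K).
  rewrite -S1 -[S](subrK (#|Fq|%:R * y ^+ #|Fq|.-1)); apply: (geD hC).
    by apply: geW hS; rewrite ge_min lexx.
  by apply: geW hq; rewrite ge_min lexx orbT.
by rewrite /vge (ordK1 hC) lee_fin leNgt lt_min s0 ltr01.
Qed.

(* The preimage of [tbar] under [sigma]. *)
Definition tprime : K := tbar ^+ (p ^ a.-1).

Lemma sends_tprime : sends tprime tbar.
Proof.
have := sendsX (p ^ a.-1) sends_tbar; rewrite -exprM -expnS prednK // -cardF.
by have [_ -> _] := htbar.
Qed.

Lemma sigma_invE x y : sends x y -> sigma_inv E sigma y = x.
Proof.
move=> [hx hy]; rewrite /sigma_inv.
have [hx' hy'] := xgetPex 0 (ex_intro (fun x => E x /\ sigma x = y) x (conj hx hy)).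
have [_ inj _] := frob_bij hsigma.
by apply: inj; rewrite ?inE // hy' hy.
Qed.

Lemma tbar_pow : tbar ^+ (p ^ a).-1 = 1.
Proof.
have tb0 := ord_neq0 hC ord_tbar; apply: (mulfI tb0).
have [_ + _] := htbar; rewrite cardF mulr1 -exprS prednK // expn_gt0 prime_gt0 //.
Qed.

Lemma tprime_pow : tprime ^+ (p ^ a).-1 = 1.
Proof. by rewrite /tprime -exprM mulnC exprM tbar_pow expr1n. Qed.

Lemma ord_tprime : ord tprime = 0%:E.
Proof. by rewrite (ordX hC _ ord_tbar) mul0r. Qed.

Context (n : nat) (rho : rat).
Context (n_gt0 : (0 < n)%N) (odd_p : odd p).
Context (hrho : rho * n%:R * (p%:R - 1) = 1).
Context (ordtg : ord tg = rho%:E).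
Notation g := (tg ^+ n).
Context (gsum : is_psum ord (fun k : nat => g ^+ (p ^ k) / p%:R ^+ k) 0).

Notation F := (Fcoef ord p n tg).

Lemma sends_Fcoef u v : sends (F u v tprime) (F u v tbar).
Proof.
have q_gt1 : (1 < p ^ a)%N by rewrite -(expn0 p) ltn_exp2l // prime_gt1.
have [w [hw hF]] := Fcoef_periodic pr hC n_gt0 odd_p hrho ordtg gsum q_gt1 u v.
rewrite !hF ?tbar_pow ?tprime_pow //; try exact/ge_ord/ord_tbar; try exact/ge_ord/ord_tprime.
apply: sends_sum => r; apply: sendsM (sends_Qp (hw r)).
apply: sendsM; last exact: sendsX sends_tprime.
apply: sendsXz; first by rewrite expf_neq0.
exact: sendsX sends_tg.
Qed.

Definition basis_x (i : nat) : int := if (i <= n)%N then i%:Z else i%:Z - n%:Z.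
Definition basis_y (i : nat) : int := if (i <= n)%N then 0 else 1.

Lemma epsE i u v : eps K n i u v = ((u == basis_x i) && (v == basis_y i))%:R.
Proof. by rewrite /eps /basis_x /basis_y; case: ifP. Qed.

(** Multiplying by a monomial only shifts exponents, so psi_p selects one coefficient of Ft. *)
Lemma alpha1_teps i u v :
  alpha1 ord n p Qq zeta g tg tbar sigma (teps n tg i) u v
  = tg ^+ i * F (p%:Z * u - basis_x i) (p%:Z * v - basis_y i) tprime.
Proof.
rewrite /alpha1 /psi_p /ls_mul.
set A := p%:Z * u; set B := p%:Z * v.
rewrite (psum1 hC (i0 := (A - basis_x i, B - basis_y i))) /=; last first.
  move=> [c d]; rewrite xpair_eqE => h; rewrite /teps epsE /=.
  rewrite (_ : _ && _ = false) ?mulr0 //; apply: contraNF h => /andP[/eqP <- /eqP <-].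
  by rewrite !subKr !eqxx.
rewrite /teps epsE !subKr !eqxx mulr1.
rewrite (FtE pr hC n_gt0 odd_p hrho ordtg); last exact/ge_ord/ord_tbar.
rewrite mulrC; apply: sigma_invE; apply: sendsM (sends_Fcoef _ _).
exact: sendsX sends_tg.
Qed.

End Frobenius.

(** * Determinants *)

Section PrincipalMinors.
Context (K : closedFieldType) (N : nat).

(** Its determinant is the principal minor on [I]; the size N is kept so that minors for all [I] can
    be summed and expanded over the same permutations. *)
Definition restrict (I : {set 'I_N}) (A : 'M[K]_N) : 'M[K]_N :=
  \matrix_(i, j) if i \in I then A i j else (i == j)%:R.

(** Each Leibniz product is distributed over its rows; [I] records the rows where the term in 'X is
    chosen. *)
Lemma coef_det_one_subT (A : 'M[K]_N) (m : nat) :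
  (det_one_subT A)`_m
  = (-1) ^+ m * \sum_(I : {set 'I_N} | #|I| == m) \det (restrict I A).
Proof.
have prodif (R : comNzRingType) (I : {set 'I_N}) (x : R) :
    \prod_i (if i \in I then x else 1) = x ^+ #|I|.
  by rewrite -big_mkcond prodr_const.
rewrite /det_one_subT /determinant coef_sum.
transitivity (\sum_(s : 'S_N) \sum_(I : {set 'I_N} | #|I| == m)
   (-1) ^+ s * ((-1) ^+ m * \prod_i restrict I A i (s i))); last first.
  rewrite exchange_big mulr_sumr; apply: eq_bigr => I _.
  by rewrite mulr_sumr; apply: eq_bigr => s _; rewrite mulrCA.
apply: eq_bigr => s _.
have -> : \prod_i (1%:M - 'X *: map_mx polyC A) i (s i)
    = \sum_(I : {set 'I_N}) ((-1) ^+ #|I| * \prod_i restrict I A i (s i))%:P * 'X^#|I|.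
  under eq_bigr => i _ do rewrite !mxE addrC.
  rewrite bigA_distr; apply: eq_bigr => I _.
  rewrite -!prodif -big_split rmorph_prod -big_split; apply: eq_bigr => i _ /=.
  rewrite mxE; case: ifP => _; last by rewrite mul1r mulr1 rmorph_nat.
  by rewrite mulN1r polyCN mulNr mulrC.
have coef_sign (b : bool) (P : {poly K}) : ((-1) ^+ b * P)`_m = (-1) ^+ b * P`_m.
  by rewrite !mulr_sign; case: b; rewrite ?coefN.
rewrite coef_sign coef_sum mulr_sumr.
rewrite [RHS]big_mkcond; apply: eq_bigr => I _ /=.
by rewrite coefCM coefXn eq_sym; case: eqP => [->|_]; rewrite ?mulr1 ?mulr0.
Qed.

(** Exchange argument: [I :\: J] and [J :\: I] have equally many elements, those of the former at
    least m and those of the latter below m. *)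
Lemma sum_initial_lt (m : nat) (I : {set 'I_N}) : (m <= N)%N -> #|I| = m ->
  I != [set i : 'I_N | (i < m)%N] -> (\sum_(i < m) i < \sum_(i in I) (i : nat))%N.
Proof.
move=> mN cI neq; set J := [set i : 'I_N | (i < m)%N].
have sJ : (\sum_(i < m) i = \sum_(i in J) (i : nat))%N.
  by rewrite (big_ord_widen N id mN); apply: eq_bigl => i; rewrite inE.
have cJ : #|J| = m.
  rewrite -sum1_card -[RHS]card_ord -sum1_card (big_ord_widen N (fun=> 1%N) mN).
  by apply: eq_bigl => i; rewrite inE.
rewrite sJ (big_setID I) [X in (_ < X)%N](big_setID J) /= finset.setIC ltn_add2l.
have cD : #|J :\: I| = #|I :\: J|.
  by apply/eqP; rewrite -(eqn_add2l #|J :&: I|) cardsID finset.setIC cardsID cI cJ.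
have d0 : (0 < #|I :\: J|)%N.
  rewrite card_gt0; apply: contra neq => /eqP D0.
  by rewrite eqEcard cI cJ leqnn andbT -finset.setD_eq0 D0.
have m0 : (0 < m)%N by rewrite -cI; apply: leq_trans d0 _; exact/subset_leq_card/finset.subsetDl.
apply: (@leq_ltn_trans (\sum_(i in J :\: I) m.-1)%N).
  by apply: leq_sum => i; rewrite !inE => /andP[_]; lia.
rewrite sum_nat_const cD; apply: (@leq_trans (\sum_(i in I :\: J) m)%N).
  by rewrite sum_nat_const; nia.
by apply: leq_sum => i; rewrite !inE -leqNgt => /andP[].
Qed.

End PrincipalMinors.

Lemma det_restrict_initial (K : closedFieldType) (N m : nat) (mN : (m <= N)%N) (A : 'M[K]_N) :
  \det (restrict [set i : 'I_N | (i < m)%N] A)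
  = \det (\matrix_(i, j) A (widen_ord mN i) (widen_ord mN j)).
Proof.
have [k Ek] : exists k, N = (m + k)%N by exists (N - m)%N; rewrite subnKC.
subst N.
set M := restrict _ _; rewrite -[M]submxK.
have -> : dlsubmx M = 0.
  apply/matrixP => i j; rewrite !mxE !inE /= ltnNge leq_addr /=.
  by rewrite -(inj_eq val_inj) /= (gtn_eqF) // ltn_addr.
rewrite det_ublock.
have -> : drsubmx M = 1%:M.
  apply/matrixP => i j; rewrite !mxE !inE /= ltnNge leq_addr /=.
  by rewrite -(inj_eq val_inj) /= eqn_add2l.
rewrite det1 mulr1; congr (\det _); apply/matrixP => i j; rewrite !mxE !inE /= ltn_ord.
by congr (A _ _); apply: val_inj.
Qed.

Section ValuedDeterminant.
Context (K : closedFieldType) (ord : K -> \bar rat) (p : nat).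
Context (hC : is_Cp ord p).
Notation ge := (vge ord).

Lemma ge_sign (b : bool) : ge 0 ((-1) ^+ b).
Proof. by apply: (ge0X hC); apply: (geN hC); exact: (ge1 hC). Qed.

Lemma ord_sign k : ord ((-1) ^+ k) = 0%:E.
Proof. by rewrite (ordX hC (r := 0)) ?mul0r // (ordN hC) (ordK1 hC). Qed.

(** Row i outside [I] receives the bound f(s i) - f i, correct because its only nonzero entry is the
    1 with s i = i. Summed over all rows, the bounds leave the sum of f over [I] for every
    permutation. *)
Lemma ge_det_restrict (N : nat) (A : 'M[K]_N) (f : 'I_N -> rat) (I : {set 'I_N}) :
  (forall i j, ge (f j) (A i j)) -> ge (\sum_(i in I) f i) (\det (restrict I A)).
Proof.
move=> hA; apply: (ge_sum hC) => s _; apply: (ge0M hC); first exact: ge_sign.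
have := @ge_prod _ _ _ hC _ (index_enum 'I_N) predT (fun i => restrict I A i (s i))
  (fun i => f (s i) - (if i \in I then 0 else f i)).
have Ef : \sum_i f (s i) = \sum_i f i by rewrite [RHS](reindex_inj (@perm_inj _ s)).
rewrite sumrB Ef.
have -> : \sum_i f i - \sum_i (if i \in I then 0 else f i) = \sum_(i in I) f i.
  by rewrite [RHS]big_mkcond -sumrB; apply: eq_bigr => i _; case: ifP; rewrite ?subr0 ?subrr.
apply=> i _; rewrite mxE; case: ifP => _; first by rewrite subr0.
case: eqP => [<-|_]; last exact: (ge0 hC).
by rewrite subrr; exact: (ge1 hC).
Qed.

Lemma ord_coef_det_one_subT (N m n : nat) (mN : (m <= N)%N) (A : 'M[K]_N) (v : rat) :
  (0 < n)%N -> (forall i j : 'I_N, ge ((j : nat)%:R / n%:R) (A i j)) ->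
  ord (\det (\matrix_(i, j) A (widen_ord mN i) (widen_ord mN j))) = v%:E ->
  v < (\sum_(i < m) (i : nat)).+1%:R / n%:R ->
  ord (det_one_subT A)`_m = v%:E.
Proof.
move=> n0 hA hD hv; rewrite coef_det_one_subT.
have h0 := ord_sign m; rewrite -[v]add0r; apply: (ordM hC) => //.
have cJ : #|[set i : 'I_N | (i < m)%N]| == m.
  apply/eqP; rewrite -sum1_card -[RHS]card_ord -sum1_card (big_ord_widen N (fun=> 1%N) mN).
  by apply: eq_bigl => i; rewrite inE.
rewrite (bigD1 _ cJ) /= (det_restrict_initial mN).
apply: (ordD_eq hC hD) hv; apply: (ge_sum hC) => I /andP[/eqP cI neq].
apply: geW (ge_det_restrict I hA); rewrite -mulr_suml -natr_sum ler_pM2r ?invr_gt0 ?ltr0n //.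
by rewrite ler_nat; exact: sum_initial_lt.
Qed.

Lemma ge_prod_perturb (I : Type) (r : seq I) (G R : I -> K) (w : I -> rat) (eps : rat) :
  0 <= eps -> (forall i, ge (w i) (G i)) -> (forall i, ge (w i + eps) (R i)) ->
  ge (\sum_(i <- r) w i + eps) (\prod_(i <- r) (G i + R i) - \prod_(i <- r) G i).
Proof.
move=> eps0 hG hR; elim: r => [|i r IH].
  by rewrite !big_nil subrr; exact: (ge0 hC).
rewrite !big_cons.
set P := \prod_(j <- r) _; set Q := \prod_(j <- r) _; set W := \sum_(j <- r) _.
have hP : ge W P.
  apply: (ge_prod hC) => j _; apply: (geD hC) => //.
  by apply: geW (hR j); rewrite lerDl.
have -> : (G i + R i) * P - G i * Q = G i * (P - Q) + R i * P by ring.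
apply: (geD hC).
  by rewrite -addrA; exact: (geM hC).
by rewrite addrAC; exact: (geM hC).
Qed.

(** Bounds that split into a row part and a column part give all Leibniz terms the same bound, here
    attained by [\det G]; the perturbation moves each term only beyond it by [eps]. *)
Lemma ord_det_perturb (m : nat) (B G : 'M[K]_m) (f e : 'I_m -> rat) (eps : rat) :
  0 < eps -> (forall i j, ge (f j + e i) (G i j)) ->
  (forall i j, ge (f j + e i + eps) (B i j - G i j)) ->
  ord (\det G) = (\sum_i f i + \sum_i e i)%:E ->
  ord (\det B) = (\sum_i f i + \sum_i e i)%:E.
Proof.
move=> eps0 hG hR hD; rewrite -(subrKC (\det G) (\det B)).
apply: (ordD_eq hC hD) (_ : _ < \sum_i f i + \sum_i e i + eps); last by rewrite ltrDl.
rewrite -sumrB; apply: (ge_sum hC) => s _; rewrite -mulrBr.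
apply: (ge0M hC); first exact: ge_sign.
have := @ge_prod_perturb _ (index_enum 'I_m) (fun i => G i (s i))
  (fun i => B i (s i) - G i (s i)) (fun i => f (s i) + e i) eps (ltW eps0)
  (fun i => hG i (s i)) (fun i => hR i (s i)).
have Ef : \sum_i f (s i) = \sum_i f i by rewrite [RHS](reindex_inj (@perm_inj _ s)).
rewrite big_split /= Ef.
have -> // : \prod_i (G i (s i) + (B i (s i) - G i (s i))) = \prod_i B i (s i).
by apply: eq_bigr => i _; rewrite subrKC.
Qed.

End ValuedDeterminant.

Lemma nomega_scale n (k : nat) u v : nomega n (k%:Z * u) (k%:Z * v) = k%:Z * nomega n u v.
Proof.
rewrite /nomega; have -> : Num.max 0 (Num.max (- (k%:Z * u)) (- (k%:Z * v)))
  = k%:Z * Num.max 0 (Num.max (- u) (- v)).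
  by rewrite !maxr_pMr ?mulr0 ?mulrN.
by ring.
Qed.

Lemma nomega_basis n i : (0 < n)%N -> (i <= 2 * n)%N ->
  nomega n (basis_x n i) (basis_y n i) = i%:Z.
Proof.
move=> n0 hi; rewrite /basis_x /basis_y; case: ifP => hin; first exact: nomega_nat.
by rewrite /nomega; lia.
Qed.

(** * Entries of the matrix and the leading minor *)

Section Entries.
Context (K : closedFieldType) (ord : K -> \bar rat) (p : nat).
Context (pr : prime p).
Context (hC : is_Cp ord p).
Context (a : nat) (Qq : set K) (Fq : finFieldType) (red : K -> Fq) (t : Fq).
Context (tbar zeta tg : K) (sigma : K -> K).
Context (a_gt0 : (0 < a)%N) (cardF : #|Fq| = (p ^ a)%N).
Context (hQq : unramified_extension ord a Qq).
Context (hred : is_residue_map ord Qq red).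
Context (t0 : t != 0) (htbar : is_teichmuller ord Qq red t tbar).
Context (hsigma : is_frobenius ord p Qq zeta tg sigma).
Context (n : nat) (rho : rat).
Context (n_gt0 : (0 < n)%N) (n_lt_p : (n < p)%N) (odd_p : odd p).
Context (hrho : rho * n%:R * (p%:R - 1) = 1).
Context (ordtg : ord tg = rho%:E).
Notation g := (tg ^+ n).
Context (gsum : is_psum ord (fun k : nat => g ^+ (p ^ k) / p%:R ^+ k) 0).
Context (A : 'M[K]_(2 * n + 1)).
Context (hA : is_matrix_of_alpha1 ord n p Qq zeta g tg tbar sigma A).
Notation ge := (vge ord).
Notation F u v := (Fcoef ord p n tg u v (tprime p a tbar)).

Let p_ge3 : (3 <= p)%N := odd_prime_gt2 odd_p pr.
Let rho0 : 0 < rho := rho_gt0 pr n_gt0 p_ge3 hrho.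
Let tg0 : tg != 0 := ord_neq0 hC ordtg.
Let ordn : ord n%:R = 0%:E.
Proof. by apply: (ord_nat_unit pr hC); rewrite gtnNdvd. Qed.

Let divn (v : int) : v%:~R / n%:R = rho * (p%:R - 1) * v%:~R.
Proof.
have n0 : n%:R != 0 :> rat by rewrite pnatr_eq0 -lt0n.
apply: (mulIf n0); rewrite mulfVK //.
have -> : rho * (p%:R - 1) * v%:~R * n%:R = rho * n%:R * (p%:R - 1) * v%:~R by ring.
by rewrite hrho mul1r.
Qed.

Lemma entry_estimate (i j : 'I_(2 * n + 1)) :
  ge (j%:R / n%:R) (A i j) /\
  ((j < n)%N -> ge (j.+1%:R / n%:R)
    (A i j - tg ^+ i * F (p%:Z * j%:Z - basis_x n i) (- basis_y n i) / tg ^+ j)).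
Proof.
have hi : (i <= 2 * n)%N by have := ltn_ord i; lia.
have hj : (j <= 2 * n)%N by have := ltn_ord j; lia.
have ordt := ord_tbar hred t0 htbar.
have n0 : 0 < n%:R :> rat by rewrite ltr0n.
have [phi [phi_x phi_y phi_good phi_dual]] :=
  dual_functional hC n_gt0 ordn ordt rho0 ordtg j.
have [xi [eta [Cxi Ceta hG]]] := hA.2 i.
have [Q [jQ hQ]] := coordinate pr hC n_gt0 p_ge3 hrho ordtg gsum
  (ge_iter_sigma hC htbar hsigma) phi_x phi_y phi_good phi_dual (erefl (j : nat))
  (C0_decaying pr hC n_gt0 p_ge3 hrho ordtg Cxi)
  (C0_decaying pr hC n_gt0 p_ge3 hrho ordtg Ceta) hG.
pose T (z : int * int) := alpha1 ord n p Qq zeta g tg tbar sigma (teps n tg i) z.1 z.2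
  * phi z.1 z.2.
have TE z : T z = tg ^+ i * F (p%:Z * z.1 - basis_x n i) (p%:Z * z.2 - basis_y n i)
    * phi z.1 z.2.
  rewrite /T (alpha1_teps pr hC a_gt0 cardF hQq hred t0 htbar tg0 hsigma n_gt0 odd_p
    hrho ordtg gsum).
  by [].
have T0 z : nomega n z.1 z.2 < j%:Z -> T z = 0.
  by rewrite /T => /(phi_good _ _).2 ->; rewrite mulr0.
have Tge z : ge ((nomega n z.1 z.2)%:~R / n%:R) (T z).
  have htp : ge 0 (tprime p a tbar) by apply: ge_ord; exact: (ord_tprime hC a hred t0 htbar).
  rewrite TE; have := geM hC (geM hC (geX hC i (ge_ord ordtg))
    (ge_Fcoef pr hC n_gt0 odd_p hrho ordtg
      (p%:Z * z.1 - basis_x n i) (p%:Z * z.2 - basis_y n i) htp))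
    (phi_good z.1 z.2).1.
  apply: geW; rewrite divn.
  (* Writing w for the weight, subadditivity gives p w(z) <= w(p z - basis_i) + i. Since [phi] costs
     rho w(z), what remains is rho (p-1) w(z) = w(z)/n. *)
  have := nomegaD n_gt0 (p%:Z * z.1 - basis_x n i) (p%:Z * z.2 - basis_y n i)
    (basis_x n i) (basis_y n i).
  rewrite !subrK nomega_scale nomega_basis // -(ler_int rat) intrM [leRHS]intrD.
  set b := (nomega n (_ - _) _)%:~R => h.
  rewrite -[i%:R]/(i%:Z%:~R) -[p%:R]/(p%:Z%:~R).
  have -> : rho * i%:Z%:~R + rho * b + - (nomega n z.1 z.2)%:~R * rho
    = rho * (b + i%:Z%:~R - (nomega n z.1 z.2)%:~R) by ring.
  by rewrite -mulrA ler_pM2l // mulrBl mul1r lerD2r.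
have ge_T v z : v%:Z <= nomega n z.1 z.2 -> ge (v%:R / n%:R) (T z).
  move=> hv; apply: geW (Tge z); rewrite ler_pM2r ?invr_gt0 //.
  by rewrite -[v%:R]/(v%:Z%:~R) ler_int.
(* The precision p^2 of [coordinate] covers both bounds to be proved. *)
have le2 v : (v <= 2 * n)%N -> v%:R / n%:R <= 2 :> rat.
  by move=> hv; rewrite ler_pdivrMr // -natrM ler_nat.
split.
  rewrite -(subrK (\sum_(z <- Q) T z) (A i j)); apply: (geD hC).
    exact: geW (le2 _ hj) hQ.
  apply: (ge_sum hC) => z _; have [h|h] := ltP (nomega n z.1 z.2) j%:Z.
    by rewrite T0 //; exact: (ge0 hC).
  exact: ge_T.
move=> jn.
have -> : tg ^+ i * F (p%:Z * j%:Z - basis_x n i) (- basis_y n i) / tg ^+ j = T (j%:Z, 0).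
  rewrite TE /= mulr0 sub0r; congr (_ * _).
  have h : tg ^+ j * phi j%:Z 0 = 1 by have := phi_dual j hj; rewrite (ltnW jn) eqxx.
  by rewrite -[LHS]mulr1 -h mulKf // expf_neq0.
have -> : A i j - T (j%:Z, 0) = (A i j - \sum_(z <- Q) T z)
    + \sum_(z <- (Q `\ (j%:Z, 0))%fset) T z.
  by rewrite [in RHS](big_fsetD1 (j%:Z, 0)) //=; ring.
apply: (geD hC); first by apply: geW hQ; apply: le2; lia.
apply: (ge_sum_seq hC) => -[u v]; rewrite !inE xpair_eqE => /andP[uvj _] _.
have [h|h|h] := ltgtP (nomega n u v) j%:Z.
- by rewrite T0 //; exact: (ge0 hC).
- by apply: ge_T => /=; lia.
- have [u0 v0] : 0 <= u /\ v = 0 by apply: (nomega_small n_gt0); lia.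
  move: uvj h; rewrite v0 eqxx andbT; case: u u0 => // u _.
  by rewrite nomega_nat // => /eqP.
Qed.

End Entries.

Lemma alpha_spec n p i j : (0 < n)%N -> 0 <= alpha n p i j < n%:Z /\
  exists e : int, alpha n p i j = i%:Z - p%:Z * j%:Z + n%:Z * e.
Proof.
move=> n0; rewrite /alpha; set c := Num.ceil _.
split; last by exists c.
have n0' : 0 < n%:Q by rewrite ltr0z.
have := ceil_itv ((p%:Q * j%:Q - i%:Q) / n%:Q); rewrite -/c => /andP[].
rewrite ltr_pdivlMr // ler_pdivrMr // -!intrM -!intrB ltr_int ler_int.
by move=> h1 h2; apply/andP; split; nia.
Qed.

(** * The residues x_j and the minimal sum of alpha *)

Section Residues.
Context (n m p : nat).
Context (m_gt1 : (2 <= m)%N) (m_lt_n : (m < n)%N) (pr : prime p) (n_lt_p : (n < p)%N).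

(* With [x_j = residue j] and [c_i = m-1-i], [alpha_(i,j)] is [x_j - c_i], or
   [x_j - c_i + n] when this is negative; the latter is exactly the case where the
   falling factorial of [x_j] of length [c_i] vanishes. *)
Definition residue (j : nat) : nat := absz ((m.-1%:Z - (p * j)%N%:Z) %% n%:Z)%Z.

Lemma residue_lt j : (residue j < n)%N.
Proof.
have h := ltz_pmod (m.-1%:Z - (p * j)%N%:Z) (_ : 0 < n%:Z).
have h0 := modz_ge0 (m.-1%:Z - (p * j)%N%:Z) (_ : n%:Z != 0).
by rewrite /residue -ltz_nat gez0_abs ?h0 ?h //; lia.
Qed.

(** The exponent taken from Theta(x^n) in the leading term. It does not depend on i, so its
    factorial becomes a column factor. *)
Definition residue_quot (j : nat) : nat := ((p * j + residue j - m.-1) %/ n)%N.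

Lemma residue_spec j : (j < m)%N ->
  (p * j + residue j = m.-1 + n * residue_quot j)%N /\ (residue_quot j < p)%N.
Proof.
move=> jm; have h0 := modz_ge0 (m.-1%:Z - (p * j)%N%:Z) (_ : n%:Z != 0).
have Ex : (residue j)%:Z = ((m.-1%:Z - (p * j)%N%:Z) %% n%:Z)%Z.
  by rewrite /residue gez0_abs ?h0 //; lia.
have hx := residue_lt j.
have [e Ee] : exists e : int, (p * j)%N%:Z + (residue j)%:Z = m.-1%:Z + n%:Z * e.
  exists (- ((m.-1%:Z - (p * j)%N%:Z) %/ n%:Z)%Z); rewrite Ex.
  have := divz_eq (m.-1%:Z - (p * j)%N%:Z) n%:Z.
  by set d := (_ %/ _)%Z; set r := (_ %% _)%Z => h; lia.
have e0 : 0 <= e.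
  case: j jm {Ex h0} hx Ee => [|j] jm hx Ee; first by nia.
  have h : (n < p * j.+1)%N by nia.
  by nia.
have Eq : (p * j + residue j = m.-1 + n * residue_quot j)%N.
  rewrite /residue_quot; have -> : (p * j + residue j - m.-1 = n * absz e)%N by lia.
  by rewrite mulKn; lia.
split => //; nia.
Qed.

Lemma residue_inj j j' : (j < m)%N -> (j' < m)%N -> residue j = residue j' -> j = j'.
Proof.
wlog jj' : j j' / (j <= j')%N.
  by move=> h hj hj' e; have [/h|/ltnW/h hh] := leqP j j'; [exact | exact/esym/hh].
move=> hj hj' e; have [e1 _] := residue_spec hj; have [e2 _] := residue_spec hj'.
have dv : (n %| p * (j' - j))%N.
  by apply/dvdnP; exists (residue_quot j' - residue_quot j)%N; rewrite mulnBl mulnBr; lia.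
have cop : coprime n p by rewrite coprime_sym prime_coprime // gtnNdvd; lia.
rewrite Gauss_dvdr // in dv; have [/eqP|h] := posnP (j' - j); first by lia.
by have := dvdn_leq h dv; lia.
Qed.

Lemma alpha_residue i j : (i < m)%N -> (j < m)%N ->
  alpha n p i j = (residue j)%:Z - (m.-1 - i)%N%:Z
                  + (if (m.-1 - i <= residue j)%N then 0 else n%:Z).
Proof.
move=> im jm; have n0 : (0 < n)%N by lia.
have [/andP[a0 an] [e Ee]] := alpha_spec p i j n0.
have [Eq _] := residue_spec jm; have xn := residue_lt j.
have Eay : alpha n p i j - ((residue j)%:Z - (m.-1 - i)%N%:Z) = n%:Z * (e - (residue_quot j)%:Z).
  by rewrite mulrBr; lia.
move: Eay; set d := e - _ => Eay; case: ifP => h.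
  have -> : alpha n p i j = (residue j)%:Z - (m.-1 - i)%N%:Z + n%:Z * d by lia.
  have -> : d = 0 by nia.
  by rewrite mulr0.
have -> : alpha n p i j = (residue j)%:Z - (m.-1 - i)%N%:Z + n%:Z * d by lia.
have -> : d = 1 by nia.
by rewrite mulr1.
Qed.

(** alpha_(i,j) is at least x_j - c_i, whose sum is the same for all permutations. The permutation
    [s] reaches this bound in every row, so every minimizer has this sum. *)
Lemma sum_alpha_min (d : 'S_m) : d \in minperms n p m ->
  (exists s : 'S_m, forall i : 'I_m, (m.-1 - i <= residue (s i))%N) ->
  \sum_(i < m) alpha n p i (d i)
    = \sum_(i < m) (residue i)%:Z - \sum_(i < m) (m.-1 - i)%N%:Z.
Proof.
move=> hd [s hs].
have lower (e : 'S_m) :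
    \sum_(i < m) (residue i)%:Z - \sum_(i < m) (m.-1 - i)%N%:Z <= alpha_sum n p e.
  rewrite [X in X - _](reindex_inj (@perm_inj _ e)) -sumrB /alpha_sum.
  by apply: ler_sum => i _; rewrite alpha_residue //; case: ifP => _; lia.
apply/eqP; rewrite eq_le lower andbT.
have : alpha_sum n p d <= alpha_sum n p s by move: hd; rewrite inE => /forallP.
move/le_trans; apply.
rewrite [X in _ <= X - _](reindex_inj (@perm_inj _ s)) -sumrB /alpha_sum.
by apply: ler_sum => i _; rewrite alpha_residue // hs addr0.
Qed.

End Residues.

Section ReversedVandermonde.
Context (K : closedFieldType) (m : nat) (x : 'I_m -> int).

(** Arranged to match the leading block of A, where row i carries falling factorials of length m-1-i
    and column j carries x_j. *)
Definition revV : 'M[K]_m := \matrix_(i, j) (Vmx x j (rev_ord i))%:~R.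

Lemma det_revV : exists k : nat, \det revV = (-1) ^+ k * (\det (Vmx x))%:~R.
Proof.
pose s := perm (@rev_ord_inj m); exists s.
have -> : revV = map_mx intr (row_perm s (Vmx x)^T).
  by apply/matrixP => i j; rewrite !mxE permE.
rewrite det_map_mx /= row_permE det_mulmx det_perm det_tr intrM.
by rewrite rmorphXn rmorphN1.
Qed.

End ReversedVandermonde.

Lemma falling_prod (R : comPzRingType) (x c : nat) :
  \prod_(r < c) (x%:R - r%:R) ^+ 2 = (if (c <= x)%N then (x ^_ c)%:R ^+ 2 else 0) :> R.
Proof.
case: leqP => h; last by rewrite (bigD1 (Ordinal h)) //= subrr expr0n mul0r.
rewrite prodrXl ffact_prod natr_prod; congr (_ ^+ 2); apply: eq_bigr => r _.
by rewrite natrB //; have := ltn_ord r; lia.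
Qed.

(** The exponent i + n r + 2 n k - j of tg in the leading term splits as the column part (p-1) j +
    (2n+1) x minus the row part (2n+1) c; subtractions are moved across to stay in nat. *)
Lemma leading_exponent (n m p i j x c r k : nat) : (0 < p)%N -> (c + i = m.-1)%N ->
  (p * j + x = m.-1 + n * r)%N -> x = (c + k)%N ->
  (p.-1 * j + (2 * n + 1) * x + j = i + n * r + n * k + n * k + (2 * n + 1) * c)%N.
Proof.
move=> p0 h1 h2 h3; have : (p.-1 * j + j = p * j)%N by rewrite -mulSnr prednK.
have -> : ((2 * n + 1) * x = (2 * n + 1) * c + (2 * n + 1) * k)%N by rewrite h3 mulnDr.
lia.
Qed.

(** In units of rho, order (j+1)/n is (p-1)(j+1); this compares it with the leading order, at most
    (p-1) j + (2n+1) x. *)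
Lemma weight_gap_next (n p j x c : nat) : ((2 * n + 1) * (n * n) + 1 < p + (2 * n + 1) * n)%N ->
  (x < n)%N -> (p.-1 * j + (2 * n + 1) * x + 1 <= p.-1 * j.+1 + (2 * n + 1) * c)%N.
Proof.
move=> hp xn; rewrite mulnS.
have : ((2 * n + 1) * x + 1 <= p.-1)%N by nia.
lia.
Qed.

(** The next contributing k is larger by at least n, which raises the order by (2n+1) n units of
    rho. *)
Lemma weight_gap_wrap (n p i j x c : nat) : (0 < n)%N -> (0 < p)%N ->
  (p.-1 * j + (2 * n + 1) * x)%N%:Z - ((2 * n + 1) * c)%N%:Z + 1
  <= i%:Z + (p%:Z * j%:Z - i%:Z + (2 * n%:Z + 1) * (x%:Z - c%:Z + n%:Z)) - j%:Z.
Proof. by move=> n0; case: p => // p _ /=; nia. Qed.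

Section LeadingTerm.
Context (K : closedFieldType) (ord : K -> \bar rat) (p : nat).
Context (pr : prime p).
Context (hC : is_Cp ord p).
Context (n : nat) (tg tau : K) (rho : rat).
Context (n_gt0 : (0 < n)%N) (odd_p : odd p).
Context (hrho : rho * n%:R * (p%:R - 1) = 1).
Context (ordtg : ord tg = rho%:E).
Context (tau0 : tau != 0).

(** All indices are below p, so the coefficients of Theta are inverse factorials. Then 1/k! = (x ^_
    c)/x! and tau^k = tau^x / tau^c separate i from j, except for the squared falling factorial. *)
Lemma leading_term (u : int) (P e x c r i j k : nat) :
  x = (c + k)%N -> u + k%:Z = r%:Z * n%:Z -> (r < p)%N -> (x < p)%N ->
  (P + j = i + n * r + n * k + n * k + e)%N ->
  tg ^+ i * Fterm p n tg u 0 tau k / tg ^+ j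
  = (tg ^+ e * tau ^+ c)^-1 * (x ^_ c)%:R ^+ 2
    * (tg ^+ P * tau ^+ x / (r`!%:R * (x`!%:R * x`!%:R))).
Proof.
move=> xk Eu rp xp EP; have tg0 := ord_neq0 hC ordtg.
have kp : (k < p)%N by apply: leq_ltn_trans xp; rewrite xk leq_addl.
rewrite (Fterm_Theta pr hC n_gt0 odd_p hrho ordtg tau Eu (add0r _)).
rewrite !(Theta_small pr hC n ordtg) //.
have fact0 l : (l < p)%N -> l`!%:R != 0 :> K.
  by move=> lp; apply: (natK_neq0 pr hC); exact: fact_gt0.
have ff : x`!%:R = (x ^_ c)%:R * k`!%:R :> K.
  by rewrite -natrM -(@ffact_fact x c) ?xk ?leq_addr // addKn.
have tgP : tg ^+ P * tg ^+ j
    = tg ^+ i * (tg ^+ n) ^+ r * (tg ^+ n) ^+ k * (tg ^+ n) ^+ k * tg ^+ e.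
  by rewrite -!exprM -!exprD EP.
have f1 := fact0 _ rp; have f2 := fact0 _ kp.
have f3 : (x ^_ c)%:R != 0 :> K.
  by have := fact0 _ xp; rewrite ff mulf_eq0 negb_or => /andP[].
have tauc : tau ^+ c != 0 by rewrite expf_neq0.
have tge : tg ^+ e != 0 by rewrite expf_neq0.
have tgj : tg ^+ j != 0 by rewrite expf_neq0.
have -> : tg ^+ P = tg ^+ i * (tg ^+ n) ^+ r * (tg ^+ n) ^+ k
    * (tg ^+ n) ^+ k * tg ^+ e / tg ^+ j by rewrite -tgP mulfK.
have -> : tau ^+ x = tau ^+ c * tau ^+ k by rewrite xk exprD.
rewrite ff.
move: (tg ^+ e) (tg ^+ j) (tg ^+ i) ((tg ^+ n) ^+ r) ((tg ^+ n) ^+ k) (tau ^+ c) (tau ^+ k)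
  tge tgj tauc f1 f2 f3 => b1 b2 b3 b4 b5 b6 b7.
move: (r`!%:R : K) (k`!%:R : K) ((x ^_ c)%:R : K) => d1 d2 d3 h1 h2 h3 h4 h5 h6.
by field; rewrite h1 h2 h3 h4 h5 h6.
Qed.

End LeadingTerm.

Lemma ord_int_small (K : closedFieldType) (ord : K -> \bar rat) (p : nat) (z : int) :
  prime p -> is_Cp ord p -> z != 0 -> (`|z|%N < p)%N -> ord z%:~R = 0%:E.
Proof.
move=> pr hC z0 zp; apply: (ord_int_unit pr hC); rewrite gtnNdvd //.
by rewrite lt0n absz_eq0.
Qed.

Unset Implicit Arguments.

Theorem theorem3p4 (n m p a : nat)
    (hn : (1 < n)%N) (hm : (2 <= m <= n - 1)%N)
    (hV : forall x : 'I_m -> int, injective x ->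
            (forall k, 0 <= x k <= n%:Z - 1) -> \det (Vmx x) != 0)
    (hp : prime p)
    (hpM : (maxdetV n m < p)%N)
    (hpn : 2 * n%:Z ^+ 3 - n%:Z ^+ 2 - n%:Z + 1 < p%:Z)
    (ha : (0 < a)%N)
    (Cp : closedFieldType) (ord : Cp -> \bar rat) (hCp : is_Cp ord p)
    (Qq : set Cp) (hQq : unramified_extension ord a Qq)
    (Fq : finFieldType) (hFq : #|Fq| = (p ^ a)%N)
    (red : Cp -> Fq) (hred : is_residue_map ord Qq red)
    (t : Fq) (ht : t != 0)
    (tbar : Cp) (htbar : is_teichmuller ord Qq red t tbar)
    (zeta : Cp) (hzeta : p.-primitive_root zeta)
    (gamma : Cp) (hgamma : is_gamma ord p gamma)
    (tgamma : Cp) (htgamma : tgamma ^+ n = gamma)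
    (sigma : Cp -> Cp) (hsigma : is_frobenius ord p Qq zeta tgamma sigma)
    (A : 'M[Cp]_(2 * n + 1))
    (hA : is_matrix_of_alpha1 ord n p Qq zeta gamma tgamma tbar sigma A)
    (delta : 'S_m) (hdelta : delta \in minperms n p m) :
  ord (det_one_subT A)`_m
  = (m%:Q * (m%:Q - 1) / (2 * n%:Q)
     + (2 * n%:Q + 1) / (n%:Q * (p%:Q - 1))
       * (\sum_(i < m) alpha n p i (delta i))%:Q)%:E.

Proof.
have /andP[m_gt1 mn1] := hm.
have n_gt0 : (0 < n)%N by lia.
have m_lt_n : (m < n)%N by lia.
(* The bound p > (2n+1)(n^2 - n) + 1, written without subtraction. *)
have hpn' : ((2 * n + 1) * (n * n) + 1 < p + (2 * n + 1) * n)%N.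
  by move: hpn; rewrite !exprS expr0 mulr1; lia.
have n_lt_p : (n < p)%N by nia.
have odd_p : odd p by case: (even_prime hp) => // p2; nia.
have mN : (m <= 2 * n + 1)%N by lia.
subst gamma; have [gsum ordg] := hgamma.
have n0 : 0 < n%:R :> rat by rewrite ltr0n.
have p1 : 0 < p%:R - 1 :> rat by rewrite subr_gt0 ltr1n prime_gt1.
pose rho : rat := (n%:R * (p%:R - 1))^-1.
have rho0 : 0 < rho by rewrite invr_gt0 mulr_gt0.
have hrho : rho * n%:R * (p%:R - 1) = 1.
  by rewrite -mulrA mulVf // mulf_neq0 // gt_eqF.
have ordtg : ord tgamma = rho%:E.
  have tg0 : tgamma != 0.
    by apply: contraTneq (ord_neq0 hCp ordg) => ->; rewrite expr0n gtn_eqF ?eqxx.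
  have [r Er] := ord_fin hCp tg0; rewrite Er; congr (_%:E).
  move: ordg; rewrite (ordX hCp n Er) => -[h].
  by apply: (mulIf (lt0r_neq0 n0)); rewrite h /rho invfM mulrAC mulVf ?mul1r ?gt_eqF.
have tg0 := ord_neq0 hCp ordtg.
have entry := entry_estimate hp hCp ha hFq hQq hred ht htbar hsigma n_gt0 n_lt_p odd_p
  hrho ordtg gsum hA.
pose tau := tprime p a tbar.
have ordtau : ord tau = 0%:E := ord_tprime hCp a hred ht htbar.
pose x (j : 'I_m) := residue n m p j.
have x_lt (j : 'I_m) : (x j < n)%N by exact: residue_lt.
pose r (j : 'I_m) := residue_quot n m p j.
have xr (j : 'I_m) : (p * j + x j = m.-1 + n * r j)%N /\ (r j < p)%N.
  exact: residue_spec.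
pose c (i : 'I_m) : nat := (m.-1 - i)%N.
have cE (i : 'I_m) : (c i + i = m.-1)%N.
  by rewrite /c subnK // -ltnS prednK // (leq_trans _ m_gt1).
have tau0 : tau != 0 := ord_neq0 hCp ordtau.
have Ez (i j : 'I_m) : p%:Z * j%:Z - i%:Z + ((x j)%:Z - (c i)%:Z) = (r j)%:Z * n%:Z.
  by move: (xr j).1 (cE i); clear; lia.
have detV0 : \det (Vmx (fun j => (x j)%:Z)) != 0.
  apply: hV => [i j [/(residue_inj m_gt1 m_lt_n hp n_lt_p) h]|k].
    by apply: val_inj; apply: h.
  by have := x_lt k; clear; lia.
have ordV0 : ord (\det (revV Cp (fun j => (x j)%:Z))) = 0%:E.
  have [k ->] := det_revV Cp (fun j => (x j)%:Z).
  rewrite -[0 : rat]addr0; apply: (ordM hCp); first exact: (ord_sign hCp).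
  apply: (ord_int_small hp hCp) => //; apply: leq_ltn_trans hpM.
  pose y : {ffun 'I_m -> 'I_n} := [ffun j => Ordinal (x_lt j)].
  have yi : injectiveb y.
    apply/injectiveP => i j; rewrite !ffunE => -[/(residue_inj m_gt1 m_lt_n hp n_lt_p) h].
    by apply: val_inj; apply: h.
  have := @leq_bigmax_cond _ (fun y : {ffun 'I_m -> 'I_n} => injectiveb y)
    (fun y : {ffun 'I_m -> 'I_n} => `|\det (Vmx (fun k => (y k)%:Z))|%N) y yi.
  rewrite (_ : (fun k => _) = fun j => (x j)%:Z) //.
  by apply/funext => i; rewrite ffunE.
have revVE i j : revV Cp (fun j => (x j)%:Z) i j
    = if (c i <= x j)%N then (x j ^_ c i)%:R ^+ 2 else 0.
  rewrite !mxE rmorph_prod -falling_prod.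
  have -> : c i = rev_ord i by rewrite /c /= subnS -predn_sub.
  by apply: eq_bigr => k _; rewrite rmorphXn rmorphB.
pose P (j : 'I_m) : nat := (p.-1 * j + (2 * n + 1) * x j)%N.
pose e (i : 'I_m) : nat := ((2 * n + 1) * c i)%N.
pose W (j : 'I_m) : Cp := tgamma ^+ P j * tau ^+ x j
  / ((r j)`!%:R * ((x j)`!%:R * (x j)`!%:R)).
pose Z (i : 'I_m) : Cp := (tgamma ^+ e i * tau ^+ c i)^-1.
have ordfact k : (k < p)%N -> ord (k`!%:R) = 0%:E by exact: ord_fact_unit hp hCp _.
have xp j : (x j < p)%N by apply: ltn_trans (x_lt j) _.
have ordW j : ord (W j) = (rho * (P j)%:R)%:E.
  have := ordM hCp (ordM hCp (ordX hCp (P j) ordtg) (ordX hCp (x j) ordtau))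
    (ordV hCp (ordM hCp (ordfact _ (xr j).2) (ordM hCp (ordfact _ (xp j)) (ordfact _ (xp j))))).
  by rewrite !addr0 mul0r ?addr0 ?oppr0 ?addr0.
have ordZ i : ord (Z i) = (- (rho * (e i)%:R))%:E.
  have := ordV hCp (ordM hCp (ordX hCp (e i) ordtg) (ordX hCp (c i) ordtau)).
  by rewrite mul0r addr0.
pose V := revV Cp (fun j => (x j)%:Z).
pose G : 'M[Cp]_m := \matrix_(i, j) (Z i * V i j * W j).
have GE : G = diag_mx (\row_i Z i) *m V *m diag_mx (\row_j W j).
  by apply/matrixP => i j; rewrite mul_mx_diag mul_diag_mx !mxE.
have p1E : p.-1%:R = p%:R - 1 :> rat by rewrite -subn1 natrB // prime_gt0.
have invn : n%:R^-1 = rho * (p%:R - 1).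
  by apply: (mulIf (lt0r_neq0 n0)); rewrite mulVf ?gt_eqF // mulrAC hrho.
(* A nonzero determinant has a nonzero Leibniz term, and none of the falling factorials in that term
   vanishes. *)
have [s hs] : exists s : 'S_m, forall i : 'I_m, (m.-1 - i <= residue n m p (s i))%N.
  case: (pickP (fun s : 'S_m => [forall i, c i <= x (s i)]%N)) => [s /forallP hs|no].
    by exists s.
  case/negP: (ord_neq0 hCp ordV0); rewrite /determinant big1 // => s _.
  have /negbT := no s; rewrite negb_forall => /existsP[i hi].
  by rewrite (bigD1 i) //= revVE (negbTE hi) mul0r mulr0.
have alphaE : (\sum_(i < m) alpha n p i (delta i))%:Q
    = \sum_i (x i)%:R - \sum_i (c i)%:R.
  rewrite (sum_alpha_min m_gt1 m_lt_n hp n_lt_p hdelta (ex_intro _ s hs)).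
  by rewrite rmorphB !rmorph_sum.
have sumE : \sum_j rho * (P j)%:R + \sum_i - (rho * (e i)%:R)
    = \sum_(i < m) (i : nat)%:R / n%:R
      + rho * (2 * n%:R + 1) * (\sum_(i < m) alpha n p i (delta i))%:Q.
  have -> : \sum_j rho * (P j)%:R
      = rho * (p%:R - 1) * (\sum_(j < m) (j : nat)%:R)
        + rho * (2 * n%:R + 1) * \sum_j (x j)%:R.
    rewrite !mulr_sumr -big_split; apply: eq_bigr => j _ /=.
    by rewrite /P natrD !natrM natrD natrM p1E; ring.
  have -> : \sum_i - (rho * (e i)%:R) = - (rho * (2 * n%:R + 1) * \sum_i (c i)%:R).
    rewrite sumrN mulr_sumr; congr (- _); apply: eq_bigr => i _.
    by rewrite /e !natrM natrD natrM; ring.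
  by rewrite alphaE -mulr_suml invn; ring.
have ordG : ord (\det G) = (\sum_j rho * (P j)%:R + \sum_i - (rho * (e i)%:R))%:E.
  rewrite GE !det_mulmx !det_diag.
  rewrite (ordM hCp (ordM hCp (ord_prod hCp (M := fun i => - (rho * (e i)%:R)) _ _) ordV0)
    (ord_prod hCp (M := fun j => rho * (P j)%:R) _ _)).
  - by rewrite addr0 addrC.
  - by move=> i _; rewrite mxE.
  - by move=> i _; rewrite mxE.
have geV i j : vge ord 0 (V i j).
  rewrite revVE; case: ifP => _; last exact: (ge0 hCp).
  by apply: (ge0X hCp); exact: (ge_nat hCp).
have geG i j : vge ord (rho * (P j)%:R + - (rho * (e i)%:R)) (G i j).
  rewrite mxE [_ * W j]mulrC; apply: (geM hCp); first exact: (ge_ord (ordW j)).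
  by rewrite [Z i * _]mulrC; apply: (ge0M hCp) => //; exact: (ge_ord (ordZ i)).
(* Two errors separate A from [G]: the one in [entry_estimate] and the later terms of the
   coefficient of Ft. Each exceeds the leading order by at least rho. *)
have geR i j : vge ord (rho * (P j)%:R + - (rho * (e i)%:R) + rho)
    ((\matrix_(i, j) A (widen_ord mN i) (widen_ord mN j)) i j - G i j).
  rewrite mxE; have [_ hE] := entry (widen_ord mN i) (widen_ord mN j).
  have im := ltn_ord i; have jm := ltn_ord j.
  have {hE} := hE (ltn_trans jm m_lt_n).
  rewrite /basis_x /basis_y /= (leq_trans (ltnW im) (ltnW m_lt_n)) oppr0 -/tau => hE.
  pose y : int := (x j)%:Z - (c i)%:Z.
  pose u : int := p%:Z * j%:Z - i%:Z.
  have hy : - n%:Z < y < n%:Z.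
    have := cE i; have := x_lt j; rewrite /y; move: m_lt_n; clear; lia.
  have [xr1 xr2] := xr j.
  have uyE : u + y = (r j)%:Z * n%:Z by exact: Ez.
  have ge_tau : vge ord 0 tau by exact: (ge_ord ordtau).
  have hF := Fcoef_lead hp hCp n_gt0 odd_p hrho ordtg
    (_ : (n%:Z %| u + y)%Z) hy ge_tau.
  have {}hF := hF ltac:(by rewrite uyE dvdz_mull).
  (* The default 0 for y < 0, that is x_j < c_i, matches the vanishing of the falling factorial in
     [V i j]. *)
  set Lead := (if 0 <= y then _ else _) in hF.
  have EG : G i j = tgamma ^+ i * Lead / tgamma ^+ j.
    rewrite mxE revVE /Lead; have [cx|cx] := leqP (c i) (x j); last first.
      by rewrite ifF ?mulr0 ?mul0r // /y subr_ge0 lez_nat leqNgt cx.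
    have xk : x j = (c i + (x j - c i))%N by rewrite subnKC.
    have Ey : y = (x j - c i)%N%:Z by rewrite /y subzn.
    rewrite Ey /=; symmetry; apply: (leading_term hp hCp n_gt0 odd_p hrho ordtg tau0 xk).
    - by rewrite -Ey.
    - exact: xr2.
    - exact: xp.
    - by apply: leading_exponent xr1 xk; [exact: prime_gt0 | exact: cE].
  set Fu := Fcoef _ _ _ _ _ _ _ in hE hF.
  have -> : A (widen_ord mN i) (widen_ord mN j) - G i j
    = (A (widen_ord mN i) (widen_ord mN j) - tgamma ^+ i * Fu / tgamma ^+ j)
      + tgamma ^+ i * (Fu - Lead) / tgamma ^+ j by rewrite EG; ring.
  apply: (geD hCp).
    apply: geW hE; rewrite invn -mulrBr -[X in _ + X]mulr1 -mulrDr mulrCA ler_pM2l //.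
    rewrite -p1E -natrM addrAC lerBlDr natr1 -natrD ler_nat /P /e.
    by rewrite -addn1 [(j.+1 * _)%N]mulnC; exact: weight_gap_next hpn' (x_lt j).
  have := geM hCp (geM hCp (ge_ord (ordX hCp i ordtg)) hF)
    (ge_ord (ordV hCp (ordX hCp j ordtg))).
  apply: geW; rewrite -mulrBr -[X in X <= _](_ : rho * ((P j)%:R - (e i)%:R + 1) = _); last by ring.
  rewrite -mulrDr -mulrBr ler_pM2l //.
  rewrite -[1]/(1%:Z%:~R) -[(P j)%:R]/((P j)%:Z%:~R) -[(e i)%:R]/((e i)%:Z%:~R).
  rewrite -[i%:R]/(i%:Z%:~R) -[j%:R]/(j%:Z%:~R) -!intrB -!intrD -intrB ler_int.
  exact: (weight_gap_wrap _ _ _ _ n_gt0 (prime_gt0 hp)).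
have vE : m%:Q * (m%:Q - 1) / (2 * n%:Q) + (2 * n%:Q + 1) / (n%:Q * (p%:Q - 1))
       * (\sum_(i < m) alpha n p i (delta i))%:Q
    = \sum_j rho * (P j)%:R + \sum_i - (rho * (e i)%:R).
  have gauss k : \sum_(i < k) (i : nat)%:R = k%:R * (k%:R - 1) / 2 :> rat.
    by elim: k => [|k IH]; rewrite ?big_ord0 ?mul0r // big_ord_recr /= IH -natr1; field.
  rewrite sumE -mulr_suml gauss -[m%:Q]/(m%:R) -[n%:Q]/(n%:R) -[p%:Q]/(p%:R) /rho.
  by field; rewrite !gt_eqF.
rewrite vE; apply: (ord_coef_det_one_subT (mN := mN) hCp n_gt0).
- by move=> i j; have [] := entry i j.
- exact: (ord_det_perturb hCp rho0 geG geR ordG).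
have -> : (\sum_(i < m) (i : nat)).+1%:R = \sum_(i < m) (i : nat)%:R + 1 :> rat.
  by rewrite -natr1 natr_sum.
rewrite sumE -mulr_suml [ltRHS]mulrDl ltrD2l mul1r invn -mulrA ltr_pM2l //.
(* What remains is (2n+1) S < p - 1, and m < n together with alpha <= n - 1 brings it under the
   bound on p. *)
have S_le : \sum_(i < m) alpha n p i (delta i) <= (m * (n - 1))%N%:Z.
  apply: (@le_trans _ _ (\sum_(i < m) (n - 1)%N%:Z)).
    apply: ler_sum => i _; have [/andP[_ h] _] := alpha_spec p i (delta i) n_gt0.
    by move: h; clear; lia.
  by rewrite sumr_const card_ord -mulr_natl natz PoszM.
set S := \sum_(i < m) _ in S_le *.
have : (2 * n%:Z + 1) * S < p%:Z - 1 by move: S_le hpn' m_lt_n; clear; nia.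
by rewrite -(ltr_int rat) intrM intrB intrD intrM.
Qed.
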